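(* Let $\alpha,\beta\geq0$, let $d\ge1$, let $p_1<p_2<\dots$ be the primes in increasing order, and let $\varphi(s)=c_1+\sum_{j=1}^dc_{p_j}p_j^{-s}$ be a Dirichlet polynomial in $\mathcal{G}$ with unrestricted range and $c_{p_j}\neq0$ for every $j$. Then $\mathcal{C}_\varphi f=f\circ\varphi$ is bounded from $\mathcal{D}_\alpha$ to $\mathcal{D}_\beta$ if and only if \[\frac12+d\left(\frac12+\beta\right)\geq 2^\alpha.\] Moreover, $\mathcal{C}_\varphi:\mathcal{D}_\alpha\to\mathcal{D}_\beta$ is compact if and only if this inequality is strict.
   Context: $\mathbb{C}_\theta=\{s:\operatorname{Re}s>\theta\}$. For $\alpha\ge0$, $\mathcal{D}_\alpha$ is the Hilbert space of Dirichlet series $f(s)=\sum a_nn^{-s}$ with $\|f\|_{\mathcal{D}_\alpha}^2=\sum|a_n|^2/[d(n)]^\alpha<\infty$ ($d(n)$ = number of divisors); $\mathcal{D}_0$ is the Hardy space $\mathcal{H}^2$. The Gordon–Hedenmalm class $\mathcal{G}$ consists of $\varphi:\mathbb{C}_{1/2}\to\mathbb{C}_{1/2}$, $\varphi(s)=c_0s+\sum_{n\ge1}c_nn^{-s}$, with $c_0\in\{0,1,\dots\}$, $\varphi_0=\sum c_nn^{-s}$ converging uniformly in each $\mathbb{C}_\varepsilon$, and: if $c_0=0$ then $\varphi_0(\mathbb{C}_0)\subset\mathbb{C}_{1/2}$; if $c_0\ge1$ then $\varphi_0\equiv0$ or $\varphi_0(\mathbb{C}_0)\subset\mathbb{C}_0$.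 $\varphi$ has unrestricted range if $\varphi(\mathbb{C}_0)\not\subset\mathbb{C}_{1/2+\delta}$ for every $\delta>0$. *)

(* Defs.v *)
From Stdlib Require Import Reals ZArith Znumtheory List Arith.
From Coquelicot Require Import Coquelicot.
Open Scope R_scope.

Definition ndivisors (n : nat) : nat :=
  length (filter (fun k => Nat.eqb (n mod k) 0) (seq 1 n)).

Definition cpow_nat (n : nat) (s : C) : C :=
  (exp (Re s * ln (INR n)) * cos (Im s * ln (INR n)),
   exp (Re s * ln (INR n)) * sin (Im s * ln (INR n))).

Definition DS_term (a : nat -> C) (s : C) (n : nat) : C :=
  match n with O => 0%C | _ => (a n * cpow_nat n (- s))%C end.

Fixpoint csum (f : nat -> C) (n : nat) : C :=
  match n with O => 0%C | S k => (csum f k + f k)%C end.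

Definition DS_partial (a : nat -> C) (s : C) (N : nat) : C := csum (DS_term a s) N.

Definition Dnorm_term (alpha : R) (a : nat -> C) (n : nat) : R :=
  match n with O => 0 | _ => (Cmod (a n))^2 / Rpower (INR (ndivisors n)) alpha end.

Definition inD (alpha : R) (a : nat -> C) : Prop := ex_series (Dnorm_term alpha a).

Definition Dnorm (alpha : R) (a : nat -> C) : R := sqrt (Series (Dnorm_term alpha a)).

(** Gordon--Hedenmalm class G for phi(s) = c0 s + sum_{n>=1} c_n n^{-s}. *)
Definition GH_class (c0 : nat) (c : nat -> C) : Prop :=
  (forall eps, 0 < eps -> exists F : C -> C, forall e, 0 < e -> exists N, forall M,
      (N <= M)%nat -> forall s, eps < Re s -> Cmod (DS_partial c s M - F s) < e) /\
  (forall s, 1/2 < Re s -> exists v, is_series (DS_term c s) v /\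
      1/2 < Re (INR c0 * s + v)%C) /\
  (c0 = O -> forall s, 0 < Re s -> exists v, is_series (DS_term c s) v /\ 1/2 < Re v) /\
  ((1 <= c0)%nat -> (forall n, (1 <= n)%nat -> c n = 0%C) \/
      (forall s, 0 < Re s -> exists v, is_series (DS_term c s) v /\ 0 < Re v)).

Definition unrestricted_range (phi : C -> C) : Prop :=
  forall delta, 0 < delta -> ~ (forall s, 0 < Re s -> 1/2 + delta < Re (phi s)).

(** p enumerates the primes in increasing order: p 0 = 2, p 1 = 3, ... *)
Definition enumerates_primes (p : nat -> nat) : Prop :=
  (forall j, prime (Z.of_nat (p j))) /\
  (forall i j, (i < j)%nat -> (p i < p j)%nat) /\
  (forall q, prime (Z.of_nat q) -> exists j, p j = q).

Definition phi_coef (d : nat) (p : nat -> nat) (c1 : C) (cp : nat -> C) (n : nat) : C :=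
  ((if Nat.eqb n 1 then c1 else 0%C) +
   csum (fun j => if Nat.eqb (p j) n then cp j else 0%C) d)%C.

Definition phi_val (d : nat) (p : nat -> nat) (c1 : C) (cp : nat -> C) (s : C) : C :=
  (c1 + csum (fun j => cp j * cpow_nat (p j) (- s)) d)%C.

(** b is the Dirichlet series of f o phi, f the series with coefficients a,
    on the half-plane C_{1/2} *)
Definition represents (phi : C -> C) (a b : nat -> C) : Prop :=
  forall s, 1/2 < Re s -> exists v,
    is_series (DS_term a (phi s)) v /\ is_series (DS_term b s) v.

Definition comp_bounded (alpha beta : R) (phi : C -> C) : Prop :=
  exists M, forall a, inD alpha a ->
    exists b, inD beta b /\ represents phi a b /\ Dnorm beta b <= M * Dnorm alpha a.

Definition comp_defined (alpha beta : R) (phi : C -> C) : Prop :=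
  forall a, inD alpha a -> exists b, inD beta b /\ represents phi a b.

Definition comp_compact (alpha beta : R) (phi : C -> C) : Prop :=
  comp_defined alpha beta phi /\
  forall (a b : nat -> nat -> C),
    (forall k, inD alpha (a k) /\ Dnorm alpha (a k) <= 1 /\
               inD beta (b k) /\ represents phi (a k) (b k)) ->
    exists (sigma : nat -> nat) (g : nat -> C),
      (forall k, (sigma k < sigma (S k))%nat) /\ inD beta g /\
      is_lim_seq (fun k => Dnorm beta (fun n => (b (sigma k) n - g n)%C)) 0.

(* Main.v *)
Require Import Defs.
From Stdlib Require Import Reals ZArith Znumtheory List Arith Lra Lia Psatz.
From Stdlib Require Import Classical ClassicalEpsilon FunctionalExtensionality.
From Coquelicot Require Import Coquelicot.
Open Scope R_scope.

(** Unrestricted range forces [Re c1 = 1/2 + r] with [r = sum_j |c_j|]: expanding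
    [exp (- y (phi - c1))], which is bounded by [exp (y (Re c1 - 1/2))], bounds its coefficients
    [prod_j (y |c_j|)^(k_j) / k_j!], and [y] tends to infinity.

    Expanding [n^(- phi(s))], the coefficient of [f o phi] at [N = prod_j p_j^(k_j)] is
    [prod_j (- c_j)^(k_j) / k_j!] times [sum_n a_n n^(- c1) (ln n)^m], where [m = sum_j k_j]. After
    normalization the last sum is [l_m = sum_n a_n n^(- 1/2 - i t) P_m(r ln n)] with
    [P_m(x) = e^(-x) x^m / m!], and the squared norm of [f o phi] is comparable to
    [sum_m (m+1)^(- kappa) |l_m|^2] with [kappa = (d-1)/2 + beta d], by estimates for sums of
    squared binomial probabilities. Hence the claim is the comparison of [2^alpha] with [kappa + 1].

    Sufficiency: by Cauchy-Schwarz,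
    [|l_m|^2 <= (sum_n |a_n|^2 d(n)^(- alpha) P_m(r ln n)) (sum_n d(n)^alpha n^(-1) P_m(r ln n))], and
    the second factor is [O((m+1)^(2^alpha - 1))]. This follows from a Gronwall-type recurrence in
    [m] (Chebyshev's bound for primes) and from the order of the pole of [sum_n d(n)^alpha n^(-s)]
    at [1] (Euler products). Necessity: test on [a_n = d(n)^alpha n^(- 1/2 - delta + i t)] as [delta]
    tends to [0]. *)

(** * Unordered sums *)

(** [f o phi] depends on [f] only through the scalars [l_m], so both claims reduce to one weighted
    sequence norm. The obstacle is a pointwise bound in [m]. The pole at [1] controls the Abel sums,
    hence the partial sums, of the Poisson averages of [d(n)^alpha / n], by [M^(2^alpha)]; a bound
    of a single average, smaller by the factor [M], does not follow from that. The recurrence bounds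
    [m] times an average by the sum of the preceding ones and recovers exactly this factor. It is
    the Poisson form of differentiating the Dirichlet series: [ln n] becomes a sum over prime
    powers, and Chebyshev's bound keeps the Poisson averages over prime powers bounded uniformly in
    the index. Cauchy-Schwarz loses nothing in the sum over [m], because the weights [P_m(x)] add up
    to [1]; the remaining factor [(m+1)^(2^alpha - 1 - kappa)] is bounded in the first claim and
    tends to [0] in the second. Every prime after the first adds [beta + 1/2] to [kappa]: [beta]
    from the divisor weight, [1/2] from the size [m^(-1/2)] of a sum of squared binomial
    probabilities. *)

Definition lsum {T : Type} (f : T -> R) (l : list T) : R :=
  fold_right (fun x s => f x + s) 0 l.

Lemma lsum_app {T} (f : T -> R) l1 l2 : lsum f (l1 ++ l2) = lsum f l1 + lsum f l2.
Proof. induction l1 as [|x l1 IH]; simpl; [|rewrite IH]; ring. Qed.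

Lemma lsum_ext {T} (f g : T -> R) l :
  (forall x, In x l -> f x = g x) -> lsum f l = lsum g l.
Proof.
  induction l as [|x l IH]; simpl; intros H; [reflexivity|].
  rewrite IH; [|auto]. rewrite (H x); auto.
Qed.

Lemma lsum_le {T} (f g : T -> R) l :
  (forall x, In x l -> f x <= g x) -> lsum f l <= lsum g l.
Proof.
  induction l as [|x l IH]; simpl; intros H; [lra|].
  apply Rplus_le_compat; auto.
Qed.

Lemma lsum_plus {T} (f g : T -> R) l :
  lsum (fun x => f x + g x) l = lsum f l + lsum g l.
Proof. induction l as [|x l IH]; simpl; [|rewrite IH]; ring. Qed.

Lemma lsum_scal {T} (c : R) (f : T -> R) l :
  lsum (fun x => c * f x) l = c * lsum f l.
Proof. induction l as [|x l IH]; simpl; [|rewrite IH]; ring. Qed.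

Lemma lsum_nonneg {T} (f : T -> R) l : (forall x, 0 <= f x) -> 0 <= lsum f l.
Proof.
  intros H; induction l as [|x l IH]; simpl; [lra|]. specialize (H x); lra.
Qed.

Lemma lsum_map {T U} (e : T -> U) (f : U -> R) l :
  lsum f (map e l) = lsum (fun x => f (e x)) l.
Proof. induction l as [|x l IH]; simpl; [|rewrite IH]; reflexivity. Qed.

Lemma lsum_incl {T} (f : T -> R) l l' :
  (forall x, 0 <= f x) -> NoDup l -> incl l l' -> lsum f l <= lsum f l'.
Proof.
  intros Hf; revert l'; induction l as [|x l IH]; intros l' Hl Hi; simpl.
  - now apply lsum_nonneg.
  - inversion Hl as [|y m Hx Hl']; subst.
    destruct (in_split x l') as (l1 & l2 & ->); [apply Hi; now left|].
    assert (Hle : lsum f l <= lsum f (l1 ++ l2)).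
    { apply IH; auto. intros y Hy.
      assert (Hy' : In y (l1 ++ x :: l2)) by (apply Hi; now right).
      apply in_app_or in Hy'; apply in_or_app.
      destruct Hy' as [|[->|]]; auto. contradiction. }
    rewrite lsum_app in *. simpl. lra.
Qed.

Lemma lsum_list_prod {T U} (f : T * U -> R) l m :
  lsum f (list_prod l m) = lsum (fun x => lsum (fun y => f (x, y)) m) l.
Proof.
  induction l as [|x l IH]; simpl; [reflexivity|].
  now rewrite lsum_app, IH, lsum_map.
Qed.

Lemma lsum_rev (f : nat -> R) m : (forall k, 0 <= f k) ->
  lsum (fun k => f (m - k)%nat) (seq 0 (S m)) <= lsum f (seq 0 (S m)).
Proof.
  intros Hf. rewrite <- (lsum_map (fun i => (m - i)%nat) f). apply lsum_incl; auto.
  - apply NoDup_map_NoDup_ForallPairs; [|apply seq_NoDup].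
    intros x y Hx Hy E. apply in_seq in Hx, Hy. lia.
  - intros x Hx. apply in_map_iff in Hx. destruct Hx as (i & <- & Hi).
    apply in_seq in Hi. apply in_seq. lia.
Qed.

Lemma in_list_max l k : In k l -> (k <= list_max l)%nat.
Proof.
  intros Hk. assert (H : List.Forall (fun k => (k <= list_max l)%nat) l) by (apply list_max_le; lia).
  rewrite List.Forall_forall in H. auto.
Qed.

(** A supremum over finite sets, encoded as duplicate-free lists, refers to no enumeration of [T];
    sums over pairs and multi-indices can therefore be regrouped freely. Nonnegativity is part of
    the predicate. *)
Definition has_sum {T : Type} (f : T -> R) (v : R) : Prop :=
  (forall x, 0 <= f x) /\ (forall l, NoDup l -> lsum f l <= v) /\
  (forall M, (forall l, NoDup l -> lsum f l <= M) -> v <= M).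

Lemma has_sum_unique {T} (f : T -> R) u v : has_sum f u -> has_sum f v -> u = v.
Proof. intros (_ & H1 & H2) (_ & H3 & H4). apply Rle_antisym; auto. Qed.

Lemma has_sum_ext {T} (f g : T -> R) v :
  (forall x, f x = g x) -> has_sum f v -> has_sum g v.
Proof. intros H. now replace g with f by (apply functional_extensionality, H). Qed.

Lemma has_sum_ge0 {T} (f : T -> R) v : has_sum f v -> 0 <= v.
Proof. intros (_ & H & _). apply (H nil). constructor. Qed.

Lemma has_sum_pos {T} (f : T -> R) v x : has_sum f v -> 0 <= f x.
Proof. intros (H & _); auto. Qed.

Lemma has_sum_bounded {T} (f : T -> R) M :
  (forall x, 0 <= f x) -> (forall l, NoDup l -> lsum f l <= M) ->
  exists v, has_sum f v /\ v <= M.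
Proof.
  intros Hf HM.
  destruct (completeness (fun y => exists l, NoDup l /\ y = lsum f l)) as (v & Hv1 & Hv2).
  - exists M. intros y (l & Hl & ->). auto.
  - exists 0, nil. split; [constructor|reflexivity].
  - exists v. split.
    + split; [|split]; auto.
      * intros l Hl. apply Hv1. now exists l.
      * intros M' HM'. apply Hv2. intros y (l & Hl & ->). auto.
    + apply Hv2. intros y (l & Hl & ->). auto.
Qed.

Lemma has_sum_le {T} (f g : T -> R) u v :
  (forall x, f x <= g x) -> has_sum f u -> has_sum g v -> u <= v.
Proof.
  intros H (_ & _ & Hu) (_ & Hv & _). apply Hu. intros l Hl.
  apply Rle_trans with (lsum g l); auto. apply lsum_le; auto.
Qed.

Lemma has_sum_dom {T} (f g : T -> R) v :
  (forall x, 0 <= f x <= g x) -> has_sum g v -> exists u, has_sum f u /\ u <= v.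
Proof.
  intros H (_ & Hv & _). apply has_sum_bounded; [apply H|].
  intros l Hl. apply Rle_trans with (lsum g l); auto. apply lsum_le; intros; apply H.
Qed.

Lemma has_sum_term {T} (f : T -> R) v x : has_sum f v -> f x <= v.
Proof.
  intros (_ & H & _). specialize (H (x :: nil)). simpl in H.
  rewrite Rplus_0_r in H. apply H. repeat constructor. simpl; tauto.
Qed.

Lemma has_sum_zero {T} : has_sum (fun _ : T => 0) 0.
Proof.
  assert (E : forall l : list T, lsum (fun _ => 0) l = 0).
  { induction l; simpl; lra. }
  split; [intros; lra|split].
  - intros l _. rewrite E; lra.
  - intros M H. apply (H nil). constructor.
Qed.

Lemma has_sum_scal {T} (c : R) (f : T -> R) v :
  0 <= c -> has_sum f v -> has_sum (fun x => c * f x) (c * v).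
Proof.
  intros Hc Hf. destruct (Req_dec c 0) as [->|Hc0].
  { rewrite Rmult_0_l. apply has_sum_ext with (fun _ => 0); [intros; ring|].
    apply has_sum_zero. }
  destruct Hf as (H0 & H1 & H2). split; [|split].
  - intros x. apply Rmult_le_pos; auto.
  - intros l Hl. rewrite lsum_scal. apply Rmult_le_compat_l; auto.
  - intros M HM. assert (0 < c) by lra.
    apply Rmult_le_reg_l with (/ c); [now apply Rinv_0_lt_compat|].
    rewrite <- Rmult_assoc, Rinv_l, Rmult_1_l by lra.
    apply H2. intros l Hl. specialize (HM l Hl). rewrite lsum_scal in HM.
    apply Rmult_le_reg_l with c; auto. rewrite <- Rmult_assoc, Rinv_r by lra. lra.
Qed.

Lemma has_sum_plus {T} (f g : T -> R) u v :
  has_sum f u -> has_sum g v -> has_sum (fun x => f x + g x) (u + v).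
Proof.
  intros (F0 & F1 & F2) (G0 & G1 & G2). split; [|split].
  - intros x. specialize (F0 x); specialize (G0 x); lra.
  - intros l Hl. rewrite lsum_plus. apply Rplus_le_compat; auto.
  - intros M HM. cut (u <= M - v); [lra|]. apply F2. intros l Hl.
    cut (v <= M - lsum f l); [lra|]. apply G2. intros l' Hl'.
    (* The two finite sets are merged without repetition, because [HM] bounds both sums over a
       single set. *)
    pose (dec := fun x y : T => excluded_middle_informative (x = y)).
    pose (m := nodup dec (l ++ l')).
    assert (Hm : NoDup m) by apply NoDup_nodup.
    specialize (HM m Hm). rewrite lsum_plus in HM.
    assert (A1 : lsum f l <= lsum f m).
    { apply lsum_incl; auto. intros x Hx. apply nodup_In, in_or_app; auto. }
    assert (A2 : lsum g l' <= lsum g m).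
    { apply lsum_incl; auto. intros x Hx. apply nodup_In, in_or_app; auto. }
    lra.
Qed.

Lemma has_sum_list {T} (l : list T) (f : T -> R) :
  NoDup l -> (forall x, 0 <= f x) -> (forall x, ~ In x l -> f x = 0) ->
  has_sum f (lsum f l).
Proof.
  intros Hl Hf H0. split; [|split]; auto.
  intros m Hm.
  pose (b := fun x => if excluded_middle_informative (In x l) then true else false).
  assert (E : forall m : list T, lsum f m = lsum f (filter b m)).
  { clear m Hm. induction m as [|x m IH]; simpl; [reflexivity|]. unfold b at 1.
    destruct (excluded_middle_informative (In x l)); simpl; rewrite IH; [reflexivity|].
    rewrite H0 by auto. ring. }
  rewrite E. apply lsum_incl; auto.
  - now apply NoDup_filter.
  - intros x Hx. apply filter_In in Hx. destruct Hx as [_ Hx]. unfold b in Hx.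
    destruct (excluded_middle_informative (In x l)); [auto|discriminate].
Qed.

Lemma has_sum_point {T} (x : T) (r : R) : 0 <= r ->
  has_sum (fun y => if excluded_middle_informative (y = x) then r else 0) r.
Proof.
  intros Hr.
  assert (E : lsum (fun y => if excluded_middle_informative (y = x) then r else 0) (x :: nil) = r).
  { simpl. destruct excluded_middle_informative; [ring|tauto]. }
  refine (eq_rect _ (has_sum _) (has_sum_list (x :: nil)
            (fun y => if excluded_middle_informative (y = x) then r else 0) _ _ _) _ E).
  - repeat constructor. simpl; tauto.
  - intros y. destruct excluded_middle_informative; lra.
  - intros y Hy. destruct excluded_middle_informative; auto. subst. simpl in Hy; tauto.
Qed.

Lemma NoDup_pair {T U} (x : T) (B : list U) : NoDup B -> NoDup (map (pair x) B).
Proof.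
  intros H. apply NoDup_map_NoDup_ForallPairs; auto.
  intros y z _ _ E. now inversion E.
Qed.

(** Tonelli's theorem, from iterated to double sum. A finite set of pairs lies in a rectangle, which
    gives the upper bound; for the lower bound the row sums [g x] are replaced by finite subsums one
    row at a time. *)
Lemma has_sum_prod {T U} (f : T -> U -> R) g v :
  (forall x, has_sum (f x) (g x)) -> has_sum g v ->
  has_sum (fun xy => f (fst xy) (snd xy)) v.
Proof.
  intros Hf Hg. split; [|split].
  - intros [x y]; simpl. apply (Hf x).
  - intros l Hl.
    pose (dT := fun x y : T => excluded_middle_informative (x = y)).
    pose (dU := fun x y : U => excluded_middle_informative (x = y)).
    pose (A := nodup dT (map fst l)). pose (B := nodup dU (map snd l)).
    apply Rle_trans with (lsum (fun xy => f (fst xy) (snd xy)) (list_prod A B)).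
    + apply lsum_incl; auto.
      * intros [x y]; apply (Hf x).
      * intros [x y] Hxy. apply in_prod; apply nodup_In.
        -- now apply (in_map fst) in Hxy.
        -- now apply (in_map snd) in Hxy.
    + rewrite lsum_list_prod. simpl.
      apply Rle_trans with (lsum g A).
      * apply lsum_le. intros x _. apply (Hf x). apply NoDup_nodup.
      * apply Hg. apply NoDup_nodup.
  - intros M HM. apply Hg. intros A HA.
    (* The claim is generalized by a finite set [l] of pairs outside the rows of [A]: a row already
       reduced to a finite subsum is moved into [l]. *)
    cut (forall A, NoDup A -> forall l : list (T * U), NoDup l ->
      (forall x y, In (x, y) l -> ~ In x A) ->
      lsum g A + lsum (fun xy => f (fst xy) (snd xy)) l <= M).
    { intros H. specialize (H A HA nil). simpl in H. rewrite Rplus_0_r in H.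
      apply H; [constructor|tauto]. }
    clear A HA. induction A as [|x A IH]; intros HA l Hl Hd; simpl.
    { rewrite Rplus_0_l. auto. }
    inversion HA as [|z m Hx HA']; subst.
    cut (g x <= M - lsum g A - lsum (fun xy => f (fst xy) (snd xy)) l); [lra|].
    apply (Hf x). intros B HB.
    cut (lsum g A + lsum (fun xy => f (fst xy) (snd xy)) (map (pair x) B ++ l) <= M).
    { rewrite lsum_app, lsum_map. simpl. change (fun x0 => f x x0) with (f x). lra. }
    apply IH; auto.
    + apply NoDup_app; auto. { now apply NoDup_pair. }
      intros [x' y'] H1 H2. apply in_map_iff in H1. destruct H1 as (b & E & _).
      inversion E; subst. apply (Hd x' y'); simpl; auto.
    + intros x' y' H. apply in_app_or in H. destruct H as [H|H].
      * apply in_map_iff in H. destruct H as (b & E & _). inversion E; subst; auto.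
      * intros H'. apply (Hd x' y'); simpl; auto.
Qed.

(** Change of variables along an injection whose image contains the support. It serves to pass from
    multi-indices to the integers that they encode and to flip pairs. *)
Lemma has_sum_inj {T U} (e : T -> U) (F : U -> R) v :
  (forall x y, e x = e y -> x = y) ->
  (forall u, 0 <= F u) -> (forall u, (exists t, e t = u) \/ F u = 0) ->
  has_sum (fun t => F (e t)) v <-> has_sum F v.
Proof.
  intros He HF H0.
  assert (P1 : forall l, NoDup l -> exists m, NoDup m /\ lsum (fun t => F (e t)) l <= lsum F m).
  { intros l Hl. exists (map e l). split.
    - apply NoDup_map_NoDup_ForallPairs; auto. intros x y _ _; auto.
    - rewrite lsum_map; lra. }
  assert (P2 : forall m, NoDup m -> exists l, NoDup l /\ lsum F m <= lsum (fun t => F (e t)) l).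
  { intros m Hm.
    assert (Q : exists l, NoDup l /\ (forall t, In t l -> In (e t) m) /\
        lsum F m = lsum (fun t => F (e t)) l).
    { induction m as [|u m IH]. { exists nil. repeat split; [constructor|simpl; tauto]. }
      inversion Hm; subst. destruct IH as (l & Hl & Hi & E); auto.
      destruct (H0 u) as [(t & <-)|Hu].
      - exists (t :: l). split; [|split].
        + constructor; auto.
        + intros t' [->|Ht]; simpl; auto.
        + simpl. now rewrite E.
      - exists l. split; [|split]; auto. { simpl; auto. } simpl. rewrite E, Hu. ring. }
    destruct Q as (l & Hl & _ & E). exists l. split; auto. lra. }
  split; intros (_ & H1 & H2); (split; [auto|split]).
  - intros m Hm. destruct (P2 m Hm) as (l & Hl & Hle). specialize (H1 l Hl). lra.
  - intros M HM. apply H2. intros l Hl. destruct (P1 l Hl) as (m & Hm & Hle).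
    specialize (HM m Hm). lra.
  - intros l Hl. destruct (P1 l Hl) as (m & Hm & Hle). specialize (H1 m Hm). lra.
  - intros M HM. apply H2. intros m Hm. destruct (P2 m Hm) as (l & Hl & Hle).
    specialize (HM l Hl). lra.
Qed.

(** The converse half of Tonelli's theorem: rows are summable as parts of the double sum, and the
    total of the row sums is identified by [has_sum_prod] and uniqueness. *)
Lemma has_sum_prod_inv {T U} (f : T * U -> R) v :
  has_sum f v ->
  exists g, (forall x, has_sum (fun y => f (x, y)) (g x)) /\ has_sum g v.
Proof.
  intros (H0 & H1 & H2).
  assert (Hx : forall x, exists w, has_sum (fun y => f (x, y)) w).
  { intros x. destruct (has_sum_bounded (fun y => f (x, y)) v) as (w & Hw & _); auto.
    - intros l Hl. specialize (H1 (map (pair x) l)). rewrite lsum_map in H1.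
      apply H1. now apply NoDup_pair.
    - now exists w. }
  pose (g := fun x => proj1_sig (constructive_indefinite_description _ (Hx x))).
  assert (Hg : forall x, has_sum (fun y => f (x, y)) (g x)).
  { intros x. unfold g. now destruct (constructive_indefinite_description _ (Hx x)). }
  exists g. split; auto.
  destruct (has_sum_bounded g v) as (w & Hw & _).
  - intros x. apply (has_sum_ge0 _ _ (Hg x)).
  - intros A HA.
    cut (forall A, NoDup A -> forall l : list (T * U), NoDup l ->
      (forall x y, In (x, y) l -> ~ In x A) -> lsum g A + lsum f l <= v).
    { intros H. specialize (H A HA nil). simpl in H. rewrite Rplus_0_r in H.
      apply H; [constructor|tauto]. }
    clear A HA. induction A as [|x A IH]; intros HA l Hl Hd; simpl.
    { rewrite Rplus_0_l. auto. }
    inversion HA as [|z m Hx' HA']; subst.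
    cut (g x <= v - lsum g A - lsum f l); [lra|].
    apply (Hg x). intros B HB.
    cut (lsum g A + lsum f (map (pair x) B ++ l) <= v).
    { rewrite lsum_app, lsum_map. simpl. lra. }
    apply IH; auto.
    + apply NoDup_app; auto. { now apply NoDup_pair. }
      intros [x' y'] Q1 Q2. apply in_map_iff in Q1. destruct Q1 as (b & E & _).
      inversion E; subst. apply (Hd x' y'); simpl; auto.
    + intros x' y' H. apply in_app_or in H. destruct H as [H|H].
      * apply in_map_iff in H. destruct H as (b & E & _). inversion E; subst; auto.
      * intros H'. apply (Hd x' y'); simpl; auto.
  - assert (Hw' : has_sum f w).
    { apply has_sum_ext with (fun xy => f (fst xy, snd xy)); [now intros []|].
      apply (has_sum_prod (fun x y => f (x, y)) g); auto. }
    replace v with w; auto. apply (has_sum_unique f); auto. now split.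
Qed.

Lemma has_sum_swap {T U} (f : T -> U -> R) g v :
  (forall x, has_sum (f x) (g x)) -> has_sum g v ->
  exists h, (forall y, has_sum (fun x => f x y) (h y)) /\ has_sum h v.
Proof.
  intros Hf Hg. pose proof (has_sum_prod f g v Hf Hg) as H.
  apply (has_sum_prod_inv (fun yx => f (snd yx) (fst yx))).
  refine (proj2 (has_sum_inj (fun yx : U * T => (snd yx, fst yx))
            (fun xy : T * U => f (fst xy) (snd xy)) v _ _ _) H).
  - intros [a b] [c d'] E. now inversion E.
  - intros [a b]. apply (Hf a).
  - intros [a b]. left. now exists (b, a).
Qed.

(** For fixed [t] the indicator of [u = e t] contributes [f t] once, and the two sums are
    interchanged. With a product of integers as [e], this collects a Dirichlet convolution. *)
Lemma has_sum_fiber {T U} (e : T -> U) (f : T -> R) v :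
  has_sum f v ->
  exists g, (forall u, has_sum (fun t => if excluded_middle_informative (u = e t)
                                         then f t else 0) (g u)) /\ has_sum g v.
Proof.
  intros Hf.
  apply (has_sum_swap (fun t u => if excluded_middle_informative (u = e t) then f t else 0) f);
    auto.
  intros t. apply has_sum_point, Hf.
Qed.

Lemma sum_n_lsum (f : nat -> R) n : sum_n f n = lsum f (seq 0 (S n)).
Proof.
  induction n as [|n IH].
  - rewrite sum_O. simpl. ring.
  - rewrite sum_Sn, IH. rewrite (seq_S (S n) 0), lsum_app. simpl. unfold plus; simpl. ring.
Qed.

Lemma has_sum_nat (f : nat -> R) v :
  (forall n, 0 <= f n) -> has_sum f v <-> is_series f v.
Proof.
  intros Hf.
  assert (Hgrow : forall n, sum_n f n <= sum_n f (S n)).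
  { intros n. rewrite sum_Sn. unfold plus; simpl. specialize (Hf (S n)). lra. }
  assert (D : forall v, has_sum f v -> is_series f v).
  { intros w (_ & H1 & H2).
    assert (L : is_lim_seq (sum_n f) w).
    { apply is_lim_seq_spec. intros eps.
      assert (Hex : exists n, w - eps < sum_n f n).
      { apply NNPP. intros Hn. assert (w <= w - eps); [|destruct eps; simpl in *; lra].
        apply H2. intros l Hl. apply Rnot_lt_le. intros Hlt. apply Hn.
        exists (list_max l). apply Rlt_le_trans with (1 := Hlt).
        rewrite sum_n_lsum. apply lsum_incl; auto. intros k Hk. apply in_seq.
        split; [lia|]. simpl. apply Nat.lt_succ_r.
        now apply in_list_max. }
      destruct Hex as (N & HN). exists N. intros n Hn.
      assert (sum_n f N <= sum_n f n).
      { induction Hn; [lra|]. specialize (Hgrow m). lra. }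
      assert (sum_n f n <= w). { rewrite sum_n_lsum. apply H1, seq_NoDup. }
      rewrite Rabs_left1; lra. }
    exact L. }
  split; auto.
  intros Hs.
  assert (HB : forall n, sum_n f n <= v).
  { intros n. apply (is_lim_seq_incr_compare (sum_n f) v); auto. }
  destruct (has_sum_bounded f v Hf) as (w & Hw & _).
  - intros l Hl. apply Rle_trans with (sum_n f (list_max l)); auto.
    rewrite sum_n_lsum. apply lsum_incl; auto. intros k Hk. apply in_seq.
    split; [lia|]. simpl. apply Nat.lt_succ_r.
    now apply in_list_max.
  - replace v with w; auto. rewrite <- (is_series_unique _ _ (D w Hw)).
    now apply is_series_unique.
Qed.

(** Choice makes the sum a total function, so that a sum depending on a parameter can be named; it
    is meaningful where [has_sum] holds. *)
Definition tsum {T : Type} (f : T -> R) : R :=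
  epsilon (inhabits 0) (fun v => has_sum f v).

Lemma tsum_eq {T} (f : T -> R) v : has_sum f v -> tsum f = v.
Proof.
  intros H. unfold tsum. apply (has_sum_unique f); auto.
  apply epsilon_spec. now exists v.
Qed.

Lemma has_sum_tsum {T} (f : T -> R) v : has_sum f v -> has_sum f (tsum f).
Proof. intros H. now rewrite (tsum_eq f v H). Qed.

Lemma has_sum_mult {T U} (f : T -> R) (g : U -> R) u v :
  has_sum f u -> has_sum g v -> has_sum (fun xy => f (fst xy) * g (snd xy)) (u * v).
Proof.
  intros Hf Hg. apply (has_sum_prod (fun x y => f x * g y) (fun x => f x * v)).
  - intros x. apply has_sum_scal; auto. apply Hf.
  - apply has_sum_ext with (fun x => v * f x); [intros; ring|].
    rewrite Rmult_comm. apply has_sum_scal; auto. apply (has_sum_ge0 _ _ Hg).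
Qed.

(** * Absolutely convergent real and complex sums *)

Definition has_rsum {T : Type} (f : T -> R) (v : R) : Prop :=
  exists g h u w, has_sum g u /\ has_sum h w /\ (forall x, f x = g x - h x) /\ v = u - w.

Lemma has_rsum_unique {T} (f : T -> R) u v : has_rsum f u -> has_rsum f v -> u = v.
Proof.
  intros (g & h & a & b & Hg & Hh & E & ->) (g' & h' & a' & b' & Hg' & Hh' & E' & ->).
  assert (Q : a + b' = a' + b).
  { apply (has_sum_unique (fun x => g x + h' x)). { now apply has_sum_plus. }
    apply has_sum_ext with (fun x => g' x + h x); [|now apply has_sum_plus].
    intros x. specialize (E x); specialize (E' x). lra. }
  lra.
Qed.

Lemma has_rsum_of_sum {T} (f : T -> R) v : has_sum f v -> has_rsum f v.
Proof.
  intros H. exists f, (fun _ => 0), v, 0.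
  split; [auto|split; [apply has_sum_zero|split; intros; ring]].
Qed.

Lemma has_rsum_ext {T} (f g : T -> R) v :
  (forall x, f x = g x) -> has_rsum f v -> has_rsum g v.
Proof. intros H. now replace g with f by (apply functional_extensionality, H). Qed.

Lemma has_rsum_plus {T} (f g : T -> R) u v :
  has_rsum f u -> has_rsum g v -> has_rsum (fun x => f x + g x) (u + v).
Proof.
  intros (g1 & h1 & a1 & b1 & G1 & H1 & E1 & ->) (g2 & h2 & a2 & b2 & G2 & H2 & E2 & ->).
  exists (fun x => g1 x + g2 x), (fun x => h1 x + h2 x), (a1 + a2), (b1 + b2).
  split; [now apply has_sum_plus|]. split; [now apply has_sum_plus|].
  split; [|ring]. intros x. rewrite E1, E2. ring.
Qed.

Lemma has_rsum_opp {T} (f : T -> R) v : has_rsum f v -> has_rsum (fun x => - f x) (- v).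
Proof.
  intros (g & h & a & b & G & H & E & ->).
  exists h, g, b, a. repeat split; try apply H; try apply G; try ring.
  intros x. rewrite E. ring.
Qed.

Lemma has_rsum_scal {T} (c : R) (f : T -> R) v :
  has_rsum f v -> has_rsum (fun x => c * f x) (c * v).
Proof.
  intros Hf. assert (P : forall c, 0 <= c -> has_rsum (fun x => c * f x) (c * v)).
  { clear c. intros c Hc. destruct Hf as (g & h & a & b & G & H & E & ->).
    exists (fun x => c * g x), (fun x => c * h x), (c * a), (c * b).
    split; [now apply has_sum_scal|]. split; [now apply has_sum_scal|].
    split; [|ring]. intros x. rewrite E. ring. }
  destruct (Rle_dec 0 c) as [Hc|Hc]; auto.
  replace (c * v) with (- (- c * v)) by ring.
  apply has_rsum_ext with (fun x => - (- c * f x)); [intros; ring|].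
  apply has_rsum_opp, P. lra.
Qed.

(** Any decomposition can be exchanged for [f = (|f| + f) - |f|], which depends on [f] alone;
    reindexing and comparison are then inherited from nonnegative sums. *)
Lemma has_rsum_abs {T} (f : T -> R) v :
  has_rsum f v <-> exists A, has_sum (fun x => Rabs (f x)) A /\
                             has_sum (fun x => Rabs (f x) + f x) (A + v).
Proof.
  split.
  - intros (g & h & a & b & G & H & E & ->).
    destruct (has_sum_dom (fun x => Rabs (f x)) (fun x => g x + h x) (a + b))
      as (A & HA & _).
    { intros x. rewrite E. generalize (has_sum_pos _ _ x G) (has_sum_pos _ _ x H).
      split; [apply Rabs_pos|]. apply Rabs_le; lra. }
    { now apply has_sum_plus. }
    exists A. split; auto.
    destruct (has_sum_dom (fun x => Rabs (f x) + f x) (fun x => 2 * Rabs (f x)) (2 * A))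
      as (B & HB & _).
    { intros x. generalize (Rle_abs (f x)) (Rle_abs (- f x)). rewrite Rabs_Ropp. lra. }
    { apply has_sum_scal; auto; lra. }
    assert (Q : B + b = A + a).
    { apply (has_sum_unique (fun x => (Rabs (f x) + f x) + h x)); [now apply has_sum_plus|].
      apply has_sum_ext with (fun x => Rabs (f x) + g x); [|now apply has_sum_plus].
      intros x. rewrite (E x). ring. }
    replace (A + (a - b)) with B by lra. auto.
  - intros (A & H1 & H2). exists (fun x => Rabs (f x) + f x), (fun x => Rabs (f x)), (A + v), A.
    repeat split; try apply H1; try apply H2; try ring. intros; ring.
Qed.

Lemma has_rsum_exists {T} (f g : T -> R) A :
  (forall x, Rabs (f x) <= g x) -> has_sum g A -> exists v, has_rsum f v.
Proof.
  intros H HA.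
  destruct (has_sum_dom (fun x => Rabs (f x) + f x) (fun x => 2 * g x) (2 * A))
    as (B & HB & _).
  { intros x. specialize (H x). generalize (Rle_abs (f x)) (Rle_abs (- f x)).
    rewrite Rabs_Ropp. lra. }
  { apply has_sum_scal; auto; lra. }
  destruct (has_sum_dom (fun x => Rabs (f x)) g A) as (D & HD & _); auto.
  { intros x; split; auto. apply Rabs_pos. }
  exists (B - D), (fun x => Rabs (f x) + f x), (fun x => Rabs (f x)), B, D.
  repeat split; try apply HB; try apply HD. intros; ring.
Qed.

Lemma has_rsum_abs_le {T} (f g : T -> R) A v :
  (forall x, Rabs (f x) <= g x) -> has_sum g A -> has_rsum f v -> Rabs v <= A.
Proof.
  intros H HA Hv. apply has_rsum_abs in Hv. destruct Hv as (B & H1 & H2).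
  assert (B <= A) by (apply (has_sum_le _ _ _ _ H H1 HA)).
  assert (0 <= B + v) by apply (has_sum_ge0 _ _ H2).
  assert (B + v <= 2 * B).
  { apply (has_sum_le (fun x => Rabs (f x) + f x) (fun x => 2 * Rabs (f x))); auto.
    - intros x. generalize (Rle_abs (f x)); lra.
    - apply has_sum_scal; auto; lra. }
  apply Rabs_le. lra.
Qed.

Lemma has_rsum_inj {T U} (e : T -> U) (F : U -> R) v :
  (forall x y, e x = e y -> x = y) -> (forall u, (exists t, e t = u) \/ F u = 0) ->
  has_rsum (fun t => F (e t)) v <-> has_rsum F v.
Proof.
  intros He H0.
  assert (K : forall A, has_sum (fun t => Rabs (F (e t))) A <-> has_sum (fun u => Rabs (F u)) A).
  { intros A. apply (has_sum_inj e (fun u => Rabs (F u))); auto.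
    - intros; apply Rabs_pos.
    - intros u. destruct (H0 u) as [|E]; auto. right. now rewrite E, Rabs_R0. }
  assert (K' : forall A, has_sum (fun t => Rabs (F (e t)) + F (e t)) A
                         <-> has_sum (fun u => Rabs (F u) + F u) A).
  { intros A. apply (has_sum_inj e (fun u => Rabs (F u) + F u)); auto.
    - intros u. generalize (Rle_abs (- F u)). rewrite Rabs_Ropp. lra.
    - intros u. destruct (H0 u) as [|E]; auto. right. rewrite E, Rabs_R0. ring. }
  split; intros H; apply has_rsum_abs in H; apply has_rsum_abs;
    destruct H as (A & H1 & H2); exists A; split; try apply K; try apply K'; auto.
Qed.

Lemma has_rsum_prod_inv {T U} (f : T * U -> R) v :
  has_rsum f v ->
  exists g, (forall x, has_rsum (fun y => f (x, y)) (g x)) /\ has_rsum g v.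
Proof.
  intros (g & h & a & b & G & H & E & ->).
  destruct (has_sum_prod_inv g a G) as (g' & G1 & G2).
  destruct (has_sum_prod_inv h b H) as (h' & H1 & H2).
  exists (fun x => g' x - h' x). split.
  - intros x. exists (fun y => g (x, y)), (fun y => h (x, y)), (g' x), (h' x).
    repeat split; try apply G1; try apply H1. intros y; apply E.
  - exists g', h', a, b. auto.
Qed.

Lemma has_rsum_mult {T U} (f : T -> R) (g : U -> R) u v :
  has_rsum f u -> has_rsum g v -> has_rsum (fun xy => f (fst xy) * g (snd xy)) (u * v).
Proof.
  intros (g1 & h1 & a1 & b1 & G1 & H1 & E1 & ->) (g2 & h2 & a2 & b2 & G2 & H2 & E2 & ->).
  exists (fun xy => g1 (fst xy) * g2 (snd xy) + h1 (fst xy) * h2 (snd xy)),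
         (fun xy => g1 (fst xy) * h2 (snd xy) + h1 (fst xy) * g2 (snd xy)),
         (a1 * a2 + b1 * b2), (a1 * b2 + b1 * a2).
  split; [apply has_sum_plus; now apply has_sum_mult|].
  split; [apply has_sum_plus; now apply has_sum_mult|].
  split; [|ring]. intros x. rewrite E1, E2. ring.
Qed.

Lemma has_rsum_series (f : nat -> R) v : has_rsum f v -> is_series f v.
Proof.
  intros (g & h & a & b & G & H & E & ->).
  apply is_series_ext with (fun n => g n - h n); [intros; now rewrite E|].
  apply (is_series_minus g h a b); apply has_sum_nat; auto; intros n; [apply G|apply H].
Qed.

Definition has_csum {T : Type} (f : T -> C) (v : C) : Prop :=
  has_rsum (fun x => Re (f x)) (Re v) /\ has_rsum (fun x => Im (f x)) (Im v).

Lemma C_eq (x y : C) : Re x = Re y -> Im x = Im y -> x = y.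
Proof. destruct x, y; simpl. now intros -> ->. Qed.

Lemma has_csum_unique {T} (f : T -> C) u v : has_csum f u -> has_csum f v -> u = v.
Proof.
  intros [H1 H2] [H3 H4]. apply C_eq; eapply has_rsum_unique; eauto.
Qed.

Lemma has_csum_ext {T} (f g : T -> C) v :
  (forall x, f x = g x) -> has_csum f v -> has_csum g v.
Proof. intros H. now replace g with f by (apply functional_extensionality, H). Qed.

Lemma has_csum_plus {T} (f g : T -> C) u v :
  has_csum f u -> has_csum g v -> has_csum (fun x => f x + g x)%C (u + v)%C.
Proof. intros [H1 H2] [H3 H4]; split; simpl; now apply has_rsum_plus. Qed.

Lemma has_csum_scal {T} (c : C) (f : T -> C) v :
  has_csum f v -> has_csum (fun x => c * f x)%C (c * v)%C.
Proof.
  intros [H1 H2]; split; simpl.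
  - apply (has_rsum_plus (fun x => Re c * Re (f x)) (fun x => - (Im c * Im (f x)))).
    + now apply has_rsum_scal.
    + now apply has_rsum_opp, has_rsum_scal.
  - apply (has_rsum_plus (fun x => Re c * Im (f x)) (fun x => (Im c * Re (f x))));
    now apply has_rsum_scal.
Qed.

Lemma im_le_Cmod (c : C) : Rabs (Im c) <= Cmod c.
Proof.
  eapply Rle_trans; [|apply Rmax_Cmod]. apply Rmax_r.
Qed.

Lemma has_csum_exists {T} (f : T -> C) g A :
  (forall x, Cmod (f x) <= g x) -> has_sum g A -> exists v, has_csum f v.
Proof.
  intros Hle H.
  destruct (has_rsum_exists (fun x => Re (f x)) g A) as (u & Hu); auto.
  { intros x. eapply Rle_trans; [apply re_le_Cmod|apply Hle]. }
  destruct (has_rsum_exists (fun x => Im (f x)) g A) as (v & Hv); auto.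
  { intros x. eapply Rle_trans; [apply im_le_Cmod|apply Hle]. }
  exists (u, v). now split.
Qed.

(** A unimodular factor [c] rotates [v] to the positive axis, so that the real part alone decides.
    Treating real and imaginary parts separately would lose a constant. *)
Lemma has_csum_Cmod_le {T} (f : T -> C) g A v :
  (forall x, Cmod (f x) <= g x) -> has_sum g A -> has_csum f v -> Cmod v <= A.
Proof.
  intros Hle H Hv. destruct (Ceq_dec v 0) as [->|Hv0].
  { rewrite Cmod_0. apply (has_sum_ge0 _ _ H). }
  assert (Hm : Cmod v <> 0). { apply Cmod_gt_0 in Hv0. lra. }
  pose (c := (Cconj v / Cmod v)%C).
  assert (Hc : Cmod c = 1).
  { unfold c. rewrite Cmod_div, Cmod_conj, Cmod_R, Rabs_pos_eq by
      (try apply Cmod_ge_0; intros E; apply Hm; now inversion E).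
    field; auto. }
  assert (E : (c * v)%C = RtoC (Cmod v)).
  { unfold c. unfold Cdiv. rewrite (Cmult_comm (Cconj v)), <- Cmult_assoc, (Cmult_comm (Cconj v)).
    rewrite <- Cmod2_conj. rewrite <- RtoC_inv by auto.
    rewrite <- RtoC_mult. f_equal. field; auto. }
  apply (has_csum_scal c) in Hv. rewrite E in Hv. destruct Hv as [Hv _].
  change (Re (RtoC (Cmod v))) with (Cmod v) in Hv.
  rewrite <- (Rabs_pos_eq (Cmod v)) by apply Cmod_ge_0.
  apply (has_rsum_abs_le (fun x => Re (c * f x)%C) g A); auto.
  intros x. eapply Rle_trans; [apply re_le_Cmod|]. rewrite Cmod_mult, Hc, Rmult_1_l. auto.
Qed.

Lemma has_csum_abs {T} (f : T -> C) v :
  has_csum f v -> exists A, has_sum (fun x => Cmod (f x)) A.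
Proof.
  intros [H1 H2]. apply has_rsum_abs in H1; apply has_rsum_abs in H2.
  destruct H1 as (A & HA & _), H2 as (B & HB & _).
  destruct (has_sum_dom (fun x => Cmod (f x)) (fun x => Rabs (Re (f x)) + Rabs (Im (f x))) (A + B))
    as (D & HD & _).
  - intros x. split; [apply Cmod_ge_0|]. destruct (f x) as [a b]; simpl.
    replace (a, b) with (RtoC a + Ci * RtoC b)%C
      by (unfold Ci, RtoC, Cplus, Cmult; simpl; f_equal; ring).
    eapply Rle_trans; [apply Cmod_triangle|].
    rewrite Cmod_mult, Cmod_Ci, !Cmod_R. lra.
  - now apply has_sum_plus.
  - now exists D.
Qed.

Lemma has_csum_inj {T U} (e : T -> U) (F : U -> C) v :
  (forall x y, e x = e y -> x = y) -> (forall u, (exists t, e t = u) \/ F u = 0%C) ->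
  has_csum (fun t => F (e t)) v <-> has_csum F v.
Proof.
  intros He H0. unfold has_csum.
  rewrite (has_rsum_inj e (fun u => Re (F u))), (has_rsum_inj e (fun u => Im (F u))); auto.
  - tauto.
  - intros u. destruct (H0 u) as [|E]; auto. right. now rewrite E.
  - intros u. destruct (H0 u) as [|E]; auto. right. now rewrite E.
Qed.

Lemma has_csum_prod_inv {T U} (f : T * U -> C) v :
  has_csum f v ->
  exists g, (forall x, has_csum (fun y => f (x, y)) (g x)) /\ has_csum g v.
Proof.
  intros [H1 H2].
  destruct (has_rsum_prod_inv _ _ H1) as (g & G1 & G2).
  destruct (has_rsum_prod_inv _ _ H2) as (h & K1 & K2).
  exists (fun x => (g x, h x)). split; [intros x; split|split]; simpl; auto.
Qed.

(** Fubini's theorem: Tonelli's theorem for the moduli makes the double family absolutely summable,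
    and its total is then computed along both orders. *)
Lemma has_csum_swap {T U} (f : T -> U -> C) g h A :
  (forall x, has_sum (fun y => Cmod (f x y)) (g x)) -> has_sum g A ->
  (forall x, has_csum (f x) (h x)) ->
  exists k v, (forall y, has_csum (fun x => f x y) (k y)) /\ has_csum k v /\ has_csum h v.
Proof.
  intros Hg HA Hh.
  pose proof (has_sum_prod (fun x y => Cmod (f x y)) g A Hg HA) as HP. simpl in HP.
  destruct (has_csum_exists (fun xy => f (fst xy) (snd xy)) _ A (fun x => Rle_refl _) HP)
    as (v & Hv).
  destruct (has_csum_prod_inv _ _ Hv) as (h' & H1 & H2). simpl in H1.
  assert (Eh : h' = h).
  { apply functional_extensionality. intros x. eapply has_csum_unique; [apply H1|apply Hh]. }
  subst h'.
  assert (Hv' : has_csum (fun yx : U * T => f (snd yx) (fst yx)) v).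
  { refine (proj2 (has_csum_inj (fun yx : U * T => (snd yx, fst yx))
            (fun xy : T * U => f (fst xy) (snd xy)) v _ _) Hv).
    - intros [a b] [c d'] E. now inversion E.
    - intros [a b]. left. now exists (b, a). }
  destruct (has_csum_prod_inv _ _ Hv') as (k & K1 & K2). simpl in K1.
  exists k, v. auto.
Qed.

Lemma has_csum_mult {T U} (f : T -> C) (g : U -> C) u v :
  has_csum f u -> has_csum g v ->
  has_csum (fun xy => f (fst xy) * g (snd xy))%C (u * v)%C.
Proof.
  intros [H1 H2] [H3 H4]; split; simpl.
  - apply (has_rsum_plus (fun xy => Re (f (fst xy)) * Re (g (snd xy)))
             (fun xy => - (Im (f (fst xy)) * Im (g (snd xy))))).
    + now apply (has_rsum_mult (fun x => Re (f x)) (fun x => Re (g x))).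
    + apply has_rsum_opp. now apply (has_rsum_mult (fun x => Im (f x)) (fun x => Im (g x))).
  - apply (has_rsum_plus (fun xy => Re (f (fst xy)) * Im (g (snd xy)))
             (fun xy => (Im (f (fst xy)) * Re (g (snd xy))))).
    + now apply (has_rsum_mult (fun x => Re (f x)) (fun x => Im (g x))).
    + now apply (has_rsum_mult (fun x => Im (f x)) (fun x => Re (g x))).
Qed.

Lemma sum_n_Re (f : nat -> C) n : Re (sum_n f n) = sum_n (fun k => Re (f k)) n.
Proof.
  induction n as [|n IH]; [now rewrite !sum_O|]. rewrite !sum_Sn, <- IH. reflexivity.
Qed.

Lemma sum_n_Im (f : nat -> C) n : Im (sum_n f n) = sum_n (fun k => Im (f k)) n.
Proof.
  induction n as [|n IH]; [now rewrite !sum_O|]. rewrite !sum_Sn, <- IH. reflexivity.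
Qed.

Lemma is_series_C (f : nat -> C) (v : C) :
  is_series (fun n => Re (f n)) (Re v) -> is_series (fun n => Im (f n)) (Im v) ->
  is_series f v.
Proof.
  intros H1 H2. unfold is_series in *.
  apply (filterlim_locally (sum_n f) v). intros eps.
  pose proof (proj1 (filterlim_locally _ _) H1 eps) as K1.
  pose proof (proj1 (filterlim_locally _ _) H2 eps) as K2.
  generalize (filter_and _ _ K1 K2). apply filter_imp. intros n [A B].
  split.
  - change (ball (Re v) eps (Re (sum_n f n))). now rewrite sum_n_Re.
  - change (ball (Im v) eps (Im (sum_n f n))). now rewrite sum_n_Im.
Qed.

Lemma is_series_C_inv (f : nat -> C) (v : C) :
  is_series f v ->
  is_series (fun n => Re (f n)) (Re v) /\ is_series (fun n => Im (f n)) (Im v).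
Proof.
  intros H. unfold is_series in *.
  assert (K := proj1 (filterlim_locally (sum_n f) v) H).
  split; apply filterlim_locally; intros eps; generalize (K eps); apply filter_imp;
    intros n [A B].
  - rewrite <- sum_n_Re. exact A.
  - rewrite <- sum_n_Im. exact B.
Qed.

Lemma is_series_C_unique (f : nat -> C) (u v : C) :
  is_series f u -> is_series f v -> u = v.
Proof.
  intros H1 H2. apply is_series_C_inv in H1; apply is_series_C_inv in H2.
  destruct H1 as [A1 B1], H2 as [A2 B2]. apply C_eq.
  - now rewrite <- (is_series_unique _ _ A1), <- (is_series_unique _ _ A2).
  - now rewrite <- (is_series_unique _ _ B1), <- (is_series_unique _ _ B2).
Qed.

Lemma has_csum_series (f : nat -> C) v : has_csum f v -> is_series f v.
Proof. intros [H1 H2]. apply is_series_C; now apply has_rsum_series. Qed.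

(** * The complex exponential and its power series *)

Lemma exp_le_compat (x y : R) : x <= y -> exp x <= exp y.
Proof. intros [H | ->]; [left; now apply exp_increasing|lra]. Qed.

Definition cexp (z : C) : C := (exp (Re z) * cos (Im z), exp (Re z) * sin (Im z)).

Lemma cexp_plus (z w : C) : cexp (z + w) = (cexp z * cexp w)%C.
Proof.
  destruct z as [a b], w as [c e].
  unfold cexp. apply C_eq; simpl; rewrite exp_plus, ?cos_plus, ?sin_plus; ring.
Qed.

Lemma cexp_0 : cexp 0 = 1%C.
Proof. unfold cexp; simpl. rewrite exp_0, cos_0, sin_0. apply C_eq; simpl; ring. Qed.

Lemma Cmod_cexp (z : C) : Cmod (cexp z) = exp (Re z).
Proof.
  unfold Cmod, cexp; simpl.
  replace (_ + _) with (exp (Re z) * exp (Re z)).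
  - apply sqrt_square. left; apply exp_pos.
  - generalize (sin2_cos2 (Im z)). unfold Rsqr. intros H.
    replace (exp (Re z) * exp (Re z))
      with (exp (Re z) * exp (Re z) * (sin (Im z) * sin (Im z) + cos (Im z) * cos (Im z)))
      by (rewrite H; ring).
    unfold Re, Im. ring.
Qed.

Lemma is_derive_cexp (z w : C) (t : R) :
  is_derive (fun t : R => Re (w * cexp (t * z))%C) t (Re (w * z * cexp (t * z))%C).
Proof.
  destruct z as [a b], w as [c e]. unfold cexp; simpl.
  auto_derive; [exact I|]. unfold Rminus. ring.
Qed.

Lemma Derive_n_cexp (z w : C) n t :
  is_derive_n (fun t : R => Re (w * cexp (t * z))%C) n t
    (Re (w * z ^ n * cexp (t * z))%C).
Proof.
  revert t. induction n as [|n IH]; intros t.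
  - change (Re (w * cexp (t * z))%C = Re (w * 1 * cexp (t * z))%C). now rewrite Cmult_1_r.
  - change (is_derive (Derive_n (fun t : R => Re (w * cexp (t * z))%C) n) t
      (Re (w * (z * z ^ n) * cexp (t * z))%C)).
    apply is_derive_ext with (fun t : R => Re (w * z ^ n * cexp (t * z))%C).
    + intros s. symmetry. apply is_derive_n_unique. apply IH.
    + replace (w * (z * z ^ n))%C with (w * z ^ n * z)%C by ring.
      apply is_derive_cexp.
Qed.

Lemma is_series_exp (x : R) : is_series (fun k => x ^ k / INR (fact k)) (exp x).
Proof.
  apply is_series_ext with (fun k => scal (pow_n x k) (/ INR (fact k))).
  - intros k. rewrite pow_n_pow. reflexivity.
  - apply (is_exp_Reals x).
Qed.

Lemma has_sum_exp (x : R) : 0 <= x -> has_sum (fun k => x ^ k / INR (fact k)) (exp x).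
Proof.
  intros Hx. apply has_sum_nat; [|apply is_series_exp].
  intros n. apply Rmult_le_pos; [now apply pow_le|].
  left. apply Rinv_0_lt_compat, INR_fact_lt_0.
Qed.

(** Taylor's formula with Lagrange remainder on [[0, 1]] for the real function
    [t -> Re (w exp (t z))]. The free factor [w] yields the real part of the series with [w = 1] and
    the imaginary part with [w = - i]. *)
Lemma is_series_Re_cexp (z w : C) :
  is_series (fun k => Re (w * (z ^ k / INR (fact k)))%C) (Re (w * cexp z)%C).
Proof.
  assert (Hk : forall k, Re (w * (z ^ k / INR (fact k)))%C = / INR (fact k) * Re (w * z ^ k)%C).
  { intros k. unfold Cdiv. rewrite <- RtoC_inv by apply INR_fact_neq_0. simpl. ring. }
  unfold is_series.
  pose (K := Cmod w * exp (Rabs (Re z))).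
  assert (HK : 0 <= K).
  { apply Rmult_le_pos; [apply Cmod_ge_0|left; apply exp_pos]. }
  assert (L : is_lim_seq (fun n => K * (Cmod z ^ S n / INR (fact (S n)))) 0).
  { replace (Finite 0) with (Rbar_mult K 0) by (simpl; f_equal; ring).
    apply is_lim_seq_scal_l.
    apply (is_lim_seq_incr_1 (fun n => Cmod z ^ n / INR (fact n))).
    apply (ex_series_lim_0 (fun n => Cmod z ^ n / INR (fact n))).
    eexists. apply is_series_exp. }
  change (is_lim_seq (sum_n (fun k => Re (w * (z ^ k / INR (fact k)))%C)) (Re (w * cexp z)%C)).
  apply is_lim_seq_spec. intros eps. apply is_lim_seq_spec in L.
  destruct (L eps) as (N & HN). exists N. intros n Hn. specialize (HN n Hn).
  destruct (Taylor_Lagrange (fun t : R => Re (w * cexp (t * z))%C) n 0 1) as (zeta & Hz & E).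
  - lra.
  - intros t _ k _. destruct k; simpl; auto.
    eexists. apply (Derive_n_cexp z w (S k) t).
  - rewrite Cmult_1_l in E. rewrite E.
    assert (E2 : sum_n (fun k => Re (w * (z ^ k / INR (fact k)))%C) n =
      sum_f_R0 (fun m => (1 - 0) ^ m / INR (fact m) *
         Derive_n (fun t : R => Re (w * cexp (t * z))%C) m 0) n).
    { rewrite <- sum_n_Reals. apply sum_n_ext. intros k.
      rewrite (is_derive_n_unique _ _ _ _ (Derive_n_cexp z w k 0)).
      rewrite Cmult_0_l, cexp_0, Cmult_1_r, Hk. rewrite Rminus_0_r, pow1.
      unfold Rdiv. now rewrite Rmult_1_l. }
    rewrite E2.
    rewrite (is_derive_n_unique _ _ _ _ (Derive_n_cexp z w (S n) zeta)).
    rewrite Rminus_0_r in HN. rewrite Rminus_0_r, pow1.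
    match goal with |- Rabs (?a - (?a + ?b)) < _ => replace (a - (a + b)) with (- b) by ring end.
    rewrite Rabs_Ropp. eapply Rle_lt_trans; [|apply HN].
    rewrite (Rabs_pos_eq (K * _)).
    2:{ apply Rmult_le_pos; auto. apply Rmult_le_pos; [apply pow_le, Cmod_ge_0|].
        left; apply Rinv_0_lt_compat, INR_fact_lt_0. }
    rewrite Rabs_mult.
    rewrite (Rabs_pos_eq (1 / _)).
    2:{ apply Rmult_le_pos; [lra|]. left; apply Rinv_0_lt_compat, INR_fact_lt_0. }
    assert (HR : Rabs (Re (w * z ^ S n * cexp (zeta * z))%C) <= K * Cmod z ^ S n).
    { eapply Rle_trans; [apply re_le_Cmod|]. rewrite !Cmod_mult, Cmod_pow, Cmod_cexp.
      unfold K.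
      assert (exp (Re (zeta * z)%C) <= exp (Rabs (Re z))).
      { apply exp_le_compat. simpl. rewrite Rmult_0_l, Rminus_0_r.
        generalize (Rle_abs (Re z)) (Rabs_pos (Re z)). unfold Re; nra. }
      assert (0 <= Cmod w * Cmod z ^ S n).
      { apply Rmult_le_pos; [apply Cmod_ge_0|apply pow_le, Cmod_ge_0]. }
      nra. }
    unfold Rdiv. rewrite Rmult_1_l, (Rmult_comm (/ _)), <- Rmult_assoc.
    apply Rmult_le_compat_r; auto.
    left; apply Rinv_0_lt_compat, INR_fact_lt_0.
Qed.

Lemma has_csum_cexp (z : C) : has_csum (fun k => z ^ k / INR (fact k))%C (cexp z).
Proof.
  assert (S1 : is_series (fun k => z ^ k / INR (fact k))%C (cexp z)).
  { apply is_series_C.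
    - apply is_series_ext with (2 := eq_rect _ (is_series _) (is_series_Re_cexp z 1%C) _
        (f_equal Re (Cmult_1_l _))).
      intros n; now rewrite Cmult_1_l.
    - replace (Im (cexp z)) with (Re (- Ci * cexp z)%C) by (simpl; ring).
      apply is_series_ext with (2 := is_series_Re_cexp z (- Ci)%C).
      intros n; simpl; ring. }
  destruct (has_csum_exists (fun k => z ^ k / INR (fact k))%C
              (fun k => Cmod z ^ k / INR (fact k)) (exp (Cmod z))) as (v & Hv).
  - intros k. rewrite Cmod_div, Cmod_pow, Cmod_R, Rabs_pos_eq; [lra|apply pos_INR|].
    intros E. apply (INR_fact_neq_0 k). now inversion E.
  - apply has_sum_exp, Cmod_ge_0.
  - replace (cexp z) with v; auto.
    apply (is_series_C_unique _ _ _ (has_csum_series _ _ Hv) S1).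
Qed.

(** * Divisors, primes and prime factorizations *)

Definition nprime (q : nat) : Prop := prime (Z.of_nat q).

Lemma divide_Z (a b : nat) : Nat.divide a b <-> (Z.of_nat a | Z.of_nat b)%Z.
Proof.
  split.
  - intros [c ->]. exists (Z.of_nat c). lia.
  - intros [c Hc]. destruct (Nat.eq_dec b 0) as [->|Hb]; [exists 0%nat; lia|].
    exists (Z.to_nat c). nia.
Qed.

Lemma nprime_ge2 q : nprime q -> (2 <= q)%nat.
Proof. intros H. apply prime_ge_2 in H. lia. Qed.

Lemma nprime_mult q a b :
  nprime q -> Nat.divide q (a * b) -> Nat.divide q a \/ Nat.divide q b.
Proof.
  intros Hq H. rewrite !divide_Z. apply prime_mult; auto.
  rewrite <- Nat2Z.inj_mul. now apply divide_Z.
Qed.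

Lemma nprime_divisor q x : nprime q -> Nat.divide x q -> x = 1%nat \/ x = q.
Proof.
  intros Hq H. apply divide_Z in H. apply prime_divisors in H; auto. lia.
Qed.

Lemma nprime_exists n : (2 <= n)%nat -> exists q, nprime q /\ Nat.divide q n.
Proof.
  induction n as [n IH] using lt_wf_ind. intros Hn.
  destruct (prime_dec (Z.of_nat n)) as [H|H].
  - exists n. split; [exact H|apply Nat.divide_refl].
  - destruct (not_prime_divide (Z.of_nat n)) as (m & Hm & Hd); [lia|auto|].
    destruct (IH (Z.to_nat m)) as (q & Hq & Hqm); [lia|lia|].
    exists q. split; auto. apply Nat.divide_trans with (1 := Hqm).
    apply divide_Z. now rewrite Z2Nat.id by lia.
Qed.

Lemma nprime_pow q x k : nprime q -> nprime x -> Nat.divide q (x ^ k) -> q = x.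
Proof.
  intros Hq Hx; induction k as [|k IH]; simpl; intros H.
  - apply Nat.divide_1_r in H. apply nprime_ge2 in Hq. lia.
  - apply nprime_mult in H; auto. destruct H as [H|H]; auto.
    apply nprime_divisor in H; auto. apply nprime_ge2 in Hq. lia.
Qed.

Lemma pow_pos_nat q k : (1 <= q)%nat -> (1 <= q ^ k)%nat.
Proof. intros H. induction k; simpl; nia. Qed.

Lemma prime_part q n : nprime q -> (1 <= n)%nat ->
  exists k m, n = (q ^ k * m)%nat /\ (1 <= m)%nat /\ ~ Nat.divide q m.
Proof.
  intros Hq. pose proof (nprime_ge2 _ Hq) as H2.
  induction n as [n IH] using lt_wf_ind. intros Hn.
  destruct (classic (Nat.divide q n)) as [[c Hc]|H].
  - destruct (IH c) as (k & m & E & Hm & Hd); [nia|nia|].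
    exists (S k), m. split; [|auto]. simpl. subst. nia.
  - exists 0%nat, n. simpl. repeat split; auto. lia.
Qed.

Lemma prime_part_inj q i j m n : nprime q -> ~ Nat.divide q m -> ~ Nat.divide q n ->
  (q ^ i * m)%nat = (q ^ j * n)%nat -> i = j /\ m = n.
Proof.
  intros Hq Hm Hn. pose proof (nprime_ge2 _ Hq) as H2.
  revert j; induction i as [|i IH]; intros [|j] E; simpl in E.
  - split; auto. lia.
  - exfalso. apply Hm. exists (q ^ j * n)%nat. nia.
  - exfalso. apply Hn. exists (q ^ i * m)%nat. nia.
  - destruct (IH j); auto. apply Nat.mul_cancel_l with q; nia.
Qed.

Definition divisors (n : nat) : list nat :=
  filter (fun k => Nat.eqb (n mod k) 0) (seq 1 n).

Lemma in_divisors n k : (1 <= n)%nat -> In k (divisors n) <-> Nat.divide k n.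
Proof.
  intros Hn. unfold divisors. rewrite filter_In, in_seq, Nat.eqb_eq.
  rewrite Nat.Lcm0.mod_divide. split; [tauto|]. intros H. split; auto.
  assert (k <= n)%nat by (apply Nat.divide_pos_le; auto).
  assert (k <> 0)%nat by (intros ->; destruct H; lia). lia.
Qed.

Lemma NoDup_divisors n : NoDup (divisors n).
Proof. apply NoDup_filter, seq_NoDup. Qed.

Lemma ndivisors_pos n : (1 <= n)%nat -> (1 <= ndivisors n)%nat.
Proof.
  intros H. change (ndivisors n) with (length (divisors n)).
  assert (In 1%nat (divisors n)) by (apply in_divisors; auto; apply Nat.divide_1_l).
  destruct (divisors n); simpl in *; [tauto|lia].
Qed.

(** A divisor [k] of [a b] is the product of [gcd k a], a divisor of [a], and of [k / gcd k a],
    which divides [b] by Gauss's lemma; so products of pairs of divisors exhaust the divisors of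
    [a b]. *)
Lemma ndivisors_submult a b : (1 <= a)%nat -> (1 <= b)%nat ->
  (ndivisors (a * b) <= ndivisors a * ndivisors b)%nat.
Proof.
  intros Ha Hb.
  change ((length (divisors (a * b)) <= length (divisors a) * length (divisors b))%nat).
  rewrite <- length_prod.
  rewrite <- (length_map (fun xy => fst xy * snd xy)%nat (list_prod _ _)).
  apply NoDup_incl_length; [apply NoDup_divisors|].
  intros k Hk. apply in_divisors in Hk; [|nia].
  set (g := Nat.gcd k a).
  destruct (Nat.gcd_divide_l k a) as [x Hx]. destruct (Nat.gcd_divide_r k a) as [y Hy].
  fold g in Hx, Hy.
  assert (Hg : g <> 0%nat) by (intros E; rewrite E in Hy; lia).
  assert (Hxy : Nat.gcd x y = 1%nat).
  { assert (E := Nat.gcd_mul_mono_r x y g). rewrite <- Hx, <- Hy in E. fold g in E. nia. }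
  assert (Hxb : Nat.divide x b).
  { apply Nat.gauss with y; auto. destruct Hk as [c Hc]. exists c. nia. }
  apply in_map_iff. exists (g, x). simpl. split; [nia|].
  apply in_prod; apply in_divisors; auto. apply Nat.gcd_divide_r.
Qed.

Lemma divisor_prime_part q k m x : nprime q -> (1 <= m)%nat ->
  Nat.divide x (q ^ k * m) -> exists i y, (i <= k)%nat /\ Nat.divide y m /\ x = (q ^ i * y)%nat.
Proof.
  intros Hq Hm. pose proof (nprime_ge2 _ Hq) as H2.
  revert x; induction k as [|k IH]; intros x Hx.
  - exists 0%nat, x. simpl in *. rewrite Nat.add_0_r in *. repeat split; auto.
  - destruct (classic (Nat.divide q x)) as [[c ->]|H].
    + destruct (IH c) as (i & y & Hi & Hy & ->).
      { destruct Hx as [z Hz]. exists z. simpl in Hz. nia. }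
      exists (S i), y. split; [lia|split; auto]. simpl. nia.
    + destruct (IH x) as (i & y & Hi & Hy & ->).
      { simpl in Hx. rewrite <- Nat.mul_assoc in Hx. apply Nat.gauss with q; auto.
        destruct (nprime_divisor q (Nat.gcd x q)) as [E|E]; auto.
        - apply Nat.gcd_divide_r.
        - exfalso. apply H. rewrite <- E. apply Nat.gcd_divide_l. }
      exists i, y. split; [lia|auto].
Qed.

Lemma ndivisors_prime_part q k m : nprime q -> (1 <= m)%nat -> ~ Nat.divide q m ->
  ndivisors (q ^ k * m) = (S k * ndivisors m)%nat.
Proof.
  intros Hq Hm Hd. pose proof (nprime_ge2 _ Hq) as H2.
  pose proof (pow_pos_nat q k ltac:(lia)) as Hp.
  pose (e := fun xy : nat * nat => (q ^ fst xy * snd xy)%nat).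
  assert (EL : length (map e (list_prod (seq 0 (S k)) (divisors m)))
               = (S k * ndivisors m)%nat).
  { rewrite length_map, length_prod, length_seq. reflexivity. }
  rewrite <- EL.
  change (ndivisors (q ^ k * m)) with (length (divisors (q ^ k * m))).
  apply Nat.le_antisymm; apply NoDup_incl_length.
  - apply NoDup_divisors.
  - intros x Hx. apply in_divisors in Hx; [|nia].
    destruct (divisor_prime_part q k m x) as (i & y & Hi & Hy & ->); auto.
    apply in_map_iff. exists (i, y). split; auto. apply in_prod; [apply in_seq; lia|].
    now apply in_divisors.
  - assert (Hl : NoDup (list_prod (seq 0 (S k)) (divisors m))).
    { generalize (seq_NoDup (S k) 0). generalize (seq 0 (S k)).
      induction l as [|i l IHl]; intros Hl; simpl; [constructor|].
      inversion Hl; subst. apply NoDup_app; auto.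
      - apply NoDup_pair, NoDup_divisors.
      - intros [a b] A B. apply in_map_iff in A. destruct A as (z & E & _).
        inversion E; subst. apply in_prod_iff in B. tauto. }
    apply NoDup_map_NoDup_ForallPairs; auto.
    intros [i x] [j y] A B E. apply in_prod_iff in A, B. unfold e in E; simpl in E.
    destruct A as [_ A], B as [_ B]. apply in_divisors in A, B; auto.
    destruct (prime_part_inj q i j x y); subst; auto.
    + intros D. apply Hd. now apply Nat.divide_trans with x.
    + intros D. apply Hd. now apply Nat.divide_trans with y.
  - intros x Hx. apply in_map_iff in Hx. destruct Hx as ([i y] & <- & Hx).
    apply in_prod_iff in Hx. destruct Hx as [Hi Hy]. apply in_seq in Hi.
    apply in_divisors in Hy; auto. apply in_divisors; [nia|]. unfold e; simpl.
    destruct Hy as [c Hc]. exists (q ^ (k - i) * c)%nat.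
    assert (Ek : k = ((k - i) + i)%nat) by lia. rewrite Ek at 1.
    rewrite Nat.pow_add_r. subst. nia.
Qed.

(** The index of a product [prod_j (p j)^(k_j)] over [j] in the list [l]. *)
Fixpoint midx (l : list nat) : Type :=
  match l with nil => unit | _ :: l' => (nat * midx l')%type end.

Fixpoint enc (p : nat -> nat) (l : list nat) : midx l -> nat :=
  match l with
  | nil => fun _ => 1%nat
  | j :: l' => fun m => (p j ^ fst m * enc p l' (snd m))%nat
  end.

(** For primes [p j], the number of prime factors of [enc p l m] with multiplicity; it grades the
    expansion of the composition. *)
Fixpoint wt (l : list nat) : midx l -> nat :=
  match l with
  | nil => fun _ => 0%nat
  | j :: l' => fun m => (fst m + wt l' (snd m))%nat
  end.

Fixpoint mprod (h : nat -> nat -> R) (l : list nat) : midx l -> R :=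
  match l with
  | nil => fun _ => 1
  | j :: l' => fun m => h j (fst m) * mprod h l' (snd m)
  end.

Fixpoint cprod (h : nat -> nat -> C) (l : list nat) : midx l -> C :=
  match l with
  | nil => fun _ => RtoC 1
  | j :: l' => fun m => (h j (fst m) * cprod h l' (snd m))%C
  end.

Definition lprod (H : nat -> R) (l : list nat) : R := fold_right (fun j r => H j * r) 1 l.

Lemma has_sum_unit (x : R) : 0 <= x -> has_sum (fun _ : unit => x) x.
Proof.
  intros Hx.
  refine (eq_rect _ (has_sum _) (has_sum_list (tt :: nil) (fun _ => x) _ _ _) _ (Rplus_0_r x)).
  - repeat constructor. simpl; tauto.
  - auto.
  - intros [] H. simpl in H; tauto.
Qed.

(** A finite product of series is expanded over multi-indices: an Euler product when the [h j] are
    local factors, the exponential of a sum when they are exponential series. *)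
Lemma has_sum_mprod h H l :
  (forall j, In j l -> has_sum (h j) (H j)) -> has_sum (mprod h l) (lprod H l).
Proof.
  induction l as [|j l IH]; intros Hl; simpl.
  - apply has_sum_unit; lra.
  - apply (has_sum_mult (h j) (mprod h l)).
    + apply Hl; now left.
    + apply IH. intros; apply Hl; now right.
Qed.

Lemma has_csum_cprod h H l :
  (forall j, In j l -> has_csum (h j) (H j)) ->
  has_csum (cprod h l) (fold_right (fun j r => H j * r)%C (RtoC 1) l).
Proof.
  induction l as [|j l IH]; intros Hl; simpl.
  - split; simpl; apply has_rsum_of_sum, has_sum_unit; lra.
  - apply (has_csum_mult (h j) (cprod h l)).
    + apply Hl; now left.
    + apply IH. intros; apply Hl; now right.
Qed.

Lemma Cmod_cprod h l m : Cmod (cprod h l m) = mprod (fun j k => Cmod (h j k)) l m.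
Proof.
  induction l as [|j l IH]; simpl; [apply Cmod_1|]. now rewrite Cmod_mult, IH.
Qed.

Lemma mprod_ext h h' l m :
  (forall j k, In j l -> h j k = h' j k) -> mprod h l m = mprod h' l m.
Proof.
  induction l as [|j l IH]; simpl; intros H; auto.
  rewrite H by auto. rewrite IH; auto.
Qed.

Lemma cprod_ext h h' l m :
  (forall j k, In j l -> h j k = h' j k) -> cprod h l m = cprod h' l m.
Proof.
  induction l as [|j l IH]; simpl; intros H; auto.
  rewrite H by auto. rewrite IH; auto.
Qed.

Lemma mprod_mult h h' l m :
  mprod (fun j k => h j k * h' j k) l m = mprod h l m * mprod h' l m.
Proof. induction l as [|j l IH]; simpl; [|rewrite IH]; ring. Qed.

Lemma cprod_mult h h' l m :
  cprod (fun j k => h j k * h' j k)%C l m = (cprod h l m * cprod h' l m)%C.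
Proof. induction l as [|j l IH]; simpl; [|rewrite IH]; ring. Qed.

Lemma mprod_nonneg h l m : (forall j k, In j l -> 0 <= h j k) -> 0 <= mprod h l m.
Proof.
  induction l as [|j l IH]; simpl; intros H; [lra|].
  apply Rmult_le_pos; auto.
Qed.

Lemma mprod_pos h l m : (forall j k, In j l -> 0 < h j k) -> 0 < mprod h l m.
Proof.
  induction l as [|j l IH]; simpl; intros H; [lra|].
  apply Rmult_lt_0_compat; auto.
Qed.

Lemma mprod_pow (c : R) l m : mprod (fun _ k => c ^ k) l m = c ^ wt l m.
Proof.
  induction l as [|j l IH]; simpl; [reflexivity|]. rewrite pow_add, IH. reflexivity.
Qed.

Lemma cprod_pow (c : C) l m : cprod (fun _ k => c ^ k)%C l m = (c ^ wt l m)%C.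
Proof.
  induction l as [|j l IH]; simpl; [reflexivity|]. rewrite Cpow_add_r, IH. reflexivity.
Qed.

Lemma enc_pos p l m : (forall j, In j l -> nprime (p j)) -> (1 <= enc p l m)%nat.
Proof.
  induction l as [|j l IH]; simpl; intros H; [lia|].
  specialize (IH (snd m) (fun j Hj => H j (or_intror Hj))).
  pose proof (nprime_ge2 _ (H j (or_introl eq_refl))).
  pose proof (pow_pos_nat (p j) (fst m) ltac:(lia)). nia.
Qed.

Lemma enc_not_divide p l m q : (forall j, In j l -> nprime (p j)) -> nprime q ->
  ~ In q (map p l) -> ~ Nat.divide q (enc p l m).
Proof.
  induction l as [|j l IH]; simpl; intros H Hq Hn D.
  - apply Nat.divide_1_r in D. apply nprime_ge2 in Hq. lia.
  - apply nprime_mult in D; auto. destruct D as [D|D].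
    + apply nprime_pow in D; auto.
    + revert D. apply IH; auto.
Qed.

Lemma enc_inj p l m m' : (forall j, In j l -> nprime (p j)) -> NoDup (map p l) ->
  enc p l m = enc p l m' -> m = m'.
Proof.
  induction l as [|j l IH]; simpl; intros H Hl E.
  - now destruct m, m'.
  - inversion Hl; subst. destruct m as [k m], m' as [k' m']; simpl in *.
    apply prime_part_inj in E; auto using enc_not_divide.
    destruct E as [-> E]. f_equal. auto.
Qed.

Lemma enc_surj p l n : (forall j, In j l -> nprime (p j)) -> (1 <= n)%nat ->
  (forall q, nprime q -> Nat.divide q n -> In q (map p l)) -> exists m, enc p l m = n.
Proof.
  revert n; induction l as [|j l IH]; simpl; intros n H Hn Hq.
  - exists tt. destruct (Nat.eq_dec n 1) as [|Hn1]; auto.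
    destruct (nprime_exists n) as (q & H1 & H2); [lia|]. destruct (Hq q H1 H2).
  - destruct (prime_part (p j) n) as (k & M & -> & HM & Hd); auto.
    destruct (IH M) as (m & <-); auto.
    { intros q Hq1 Hq2. destruct (Hq q Hq1) as [<-|]; auto.
      - apply Nat.divide_trans with M; auto. exists (p j ^ k)%nat. reflexivity.
      - contradiction. }
    now exists (k, m).
Qed.

Lemma ndivisors_enc p l m : (forall j, In j l -> nprime (p j)) -> NoDup (map p l) ->
  INR (ndivisors (enc p l m)) = mprod (fun _ k => INR (S k)) l m.
Proof.
  induction l as [|j l IH]; intros H Hl; [reflexivity|].
  cbn [enc mprod]. simpl in Hl. inversion Hl; subst.
  rewrite ndivisors_prime_part.
  - rewrite mult_INR, IH; auto. intros; apply H; now right.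
  - apply H; now left.
  - apply enc_pos. intros; apply H; now right.
  - apply enc_not_divide; auto.
    + intros; apply H; now right.
    + apply H; now left.
Qed.

Lemma ln_pow_nat q k : (1 <= q)%nat -> ln (INR (q ^ k)) = INR k * ln (INR q).
Proof.
  intros Hq. rewrite pow_INR, ln_pow; auto. apply lt_0_INR; lia.
Qed.

Lemma ln_INR_nonneg n : 0 <= ln (INR n).
Proof.
  destruct n as [|n].
  - simpl. unfold ln. destruct (Rlt_dec 0 0); [exfalso; lra|lra].
  - rewrite <- ln_1. apply ln_le; [lra|]. rewrite S_INR. generalize (pos_INR n); lra.
Qed.

(** The identity [ln n = sum_(d | n) Lambda(d)] for the von Mangoldt function, with the prime powers
    kept as pairs. The full power of one prime is split off at a time, and its exponents [1, ..., k]
    contribute [k ln q]. *)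
Lemma ln_von_Mangoldt n : (1 <= n)%nat ->
  exists L : list (nat * nat), NoDup L /\
    (forall q k, In (q, k) L -> nprime q /\ (1 <= k)%nat /\ Nat.divide (q ^ k) n) /\
    ln (INR n) = lsum (fun qk => ln (INR (fst qk))) L.
Proof.
  induction n as [n IH] using lt_wf_ind. intros Hn.
  destruct (Nat.eq_dec n 1) as [->|Hn1].
  { exists nil. repeat split; try (simpl in *; tauto); [constructor|]. simpl. apply ln_1. }
  destruct (nprime_exists n) as (q & Hq & Hqn); [lia|].
  destruct (prime_part q n) as (k & M & E & HM & Hd); auto.
  pose proof (nprime_ge2 _ Hq) as H2.
  assert (Hk : (1 <= k)%nat).
  { destruct k; [|lia]. simpl in E. rewrite Nat.add_0_r in E. congruence. }
  assert (HMn : (M < n)%nat).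
  { destruct k as [|k]; [lia|]. simpl in E. pose proof (pow_pos_nat q k ltac:(lia)).
    assert (2 * M <= q * q ^ k * M)%nat by (apply Nat.mul_le_mono_r; nia). lia. }
  destruct (IH M HMn HM) as (L & HL & HL1 & HL2).
  exists (map (pair q) (seq 1 k) ++ L). split; [|split].
  - apply NoDup_app; auto. { apply NoDup_pair, seq_NoDup. }
    intros [q' i] A B. apply in_map_iff in A. destruct A as (i' & A & Hi).
    inversion A; subst. apply HL1 in B. destruct B as (_ & Hi' & B). apply Hd.
    apply Nat.divide_trans with (2 := B). destruct i as [|i]; [lia|].
    exists (q' ^ i)%nat. simpl. lia.
  - intros q' i A. apply in_app_or in A. destruct A as [A|A].
    + apply in_map_iff in A. destruct A as (i' & A & Hi). inversion A; subst.
      apply in_seq in Hi. split; [auto|split; [lia|]].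
      exists (q' ^ (k - i) * M)%nat.
      assert (Ek : k = ((k - i) + i)%nat) by lia. rewrite Ek at 1.
      rewrite Nat.pow_add_r. lia.
    + apply HL1 in A. destruct A as (A1 & A2 & A3). split; [auto|split; [auto|]].
      apply Nat.divide_trans with (1 := A3). exists (q ^ k)%nat. lia.
  - rewrite lsum_app, <- HL2, lsum_map. simpl.
    assert (Q : forall s, lsum (fun _ : nat => ln (INR q)) (seq s k) = INR k * ln (INR q)).
    { clear. induction k as [|k IH]; intros s; [simpl; ring|].
      cbn [seq lsum fold_right]. rewrite S_INR. unfold lsum in IH. rewrite IH. ring. }
    rewrite Q, E, mult_INR, ln_mult.
    + now rewrite ln_pow_nat by lia.
    + apply lt_0_INR. pose proof (pow_pos_nat q k ltac:(lia)). lia.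
    + apply lt_0_INR. lia.
Qed.

(** * Chebyshev's upper bound for primes *)

Fixpoint binom (n k : nat) : nat :=
  match k, n with
  | O, _ => 1
  | S _, O => 0
  | S k', S n' => binom n' k' + binom n' k
  end.

(** Written with [n + k] on top and multiplied out, so that neither subtraction nor division of
    naturals occurs. *)
Lemma binom_fact n k : (binom (n + k) k * (fact k * fact n) = fact (n + k))%nat.
Proof.
  revert n; induction k as [|k IHk]; intros n.
  - rewrite Nat.add_0_r. destruct n; simpl; lia.
  - induction n as [|n IHn].
    + specialize (IHk 0%nat). simpl in *.
      assert (Z : forall m, binom m (S m) = 0%nat).
      { assert (Z : forall m j, (m < j)%nat -> binom m j = 0%nat).
        { clear. induction m as [|m IH]; intros [|j] H; simpl; auto; [lia|lia|].
          rewrite !IH; lia. }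
        intros; apply Z; lia. }
      rewrite Z. nia.
    + replace (S n + S k)%nat with (S (S n + k)) by lia.
      cbn [binom]. specialize (IHk (S n)).
      replace (n + S k)%nat with (S n + k)%nat in IHn by lia.
      change (fact (S k)) with (S k * fact k)%nat in *.
      change (fact (S n)) with (S n * fact n)%nat in *.
      change (fact (S (S n + k))) with (S (S n + k) * fact (S n + k))%nat.
      nia.
Qed.

(** From [n] to [n + 1] the central binomial coefficient grows by the factor
    [(2n+2)(2n+1)/(n+1)^2 <= 4]. *)
Lemma central_binom_le n : (fact (n + n) <= 4 ^ n * (fact n * fact n))%nat.
Proof.
  induction n as [|n IH]; [simpl; lia|].
  replace (S n + S n)%nat with (S (S (n + n))) by lia.
  change (fact (S (S (n + n)))) with (S (S (n + n)) * (S (n + n) * fact (n + n)))%nat.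
  change (fact (S n)) with (S n * fact n)%nat.
  change (4 ^ S n)%nat with (4 * 4 ^ n)%nat.
  set (F := fact (n + n)) in *. set (a := (4 ^ n * (fact n * fact n))%nat) in *.
  replace (4 * 4 ^ n * (S n * fact n * (S n * fact n)))%nat with (4 * S n * S n * a)%nat
    by (unfold a; ring).
  nia.
Qed.

Lemma nprime_fact q n : nprime q -> Nat.divide q (fact n) -> (q <= n)%nat.
Proof.
  intros Hq; induction n as [|n IH]; intros H.
  - simpl in H. apply Nat.divide_1_r in H. apply nprime_ge2 in Hq. lia.
  - change (fact (S n)) with (S n * fact n)%nat in H. apply nprime_mult in H; auto.
    destruct H as [H|H]; [apply Nat.divide_pos_le in H; lia|]. specialize (IH H). lia.
Qed.

Lemma divide_fact q n : (1 <= q <= n)%nat -> Nat.divide q (fact n).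
Proof.
  induction n as [|n IH]; intros H; [lia|].
  change (fact (S n)) with (S n * fact n)%nat.
  destruct (Nat.eq_dec q (S n)) as [->|]; [exists (fact n); lia|].
  apply Nat.divide_mul_r, IH. lia.
Qed.

Lemma lsum_ln_primes_le (l : list nat) X : NoDup l -> (1 <= X)%nat ->
  (forall q, In q l -> nprime q /\ Nat.divide q X) ->
  lsum (fun q => ln (INR q)) l <= ln (INR X).
Proof.
  revert X; induction l as [|q l IH]; intros X Hl HX H; simpl.
  - apply ln_INR_nonneg.
  - inversion Hl; subst. destruct (H q) as [Hq [c Hc]]; [now left|].
    pose proof (nprime_ge2 _ Hq).
    assert (lsum (fun q => ln (INR q)) l <= ln (INR c)).
    { apply IH; auto; [nia|]. intros x Hx. destruct (H x) as [Hx1 Hx2]; [now right|].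
      split; auto. rewrite Hc in Hx2. apply nprime_mult in Hx2; auto.
      destruct Hx2 as [|Hx2]; auto. apply nprime_divisor in Hx2; auto.
      apply nprime_ge2 in Hx1. exfalso. destruct Hx2; subst; [lia|contradiction]. }
    rewrite Hc, mult_INR, ln_mult; [lra| |]; apply lt_0_INR; nia.
Qed.

(** A prime in [(N, 2N]] divides [(2N)!] but not [N!], hence divides the central binomial
    coefficient, which is at most [4^N]; distinct primes then contribute their product. *)
Lemma chebyshev (N : nat) (l : list nat) : (1 <= N)%nat -> NoDup l ->
  (forall q, In q l -> nprime q /\ (N < q <= N + N)%nat) ->
  lsum (fun q => ln (INR q)) l <= INR N * ln 4.
Proof.
  intros HN Hl H. pose proof (binom_fact N N) as HB. pose proof (central_binom_le N) as HC.
  assert (Hf : (1 <= fact N)%nat) by (generalize (lt_O_fact N); lia).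
  assert (Hf2 : (1 <= fact (N + N))%nat) by (generalize (lt_O_fact (N + N)); lia).
  set (B := binom (N + N) N) in *.
  assert (HB1 : (1 <= B)%nat) by nia.
  apply Rle_trans with (ln (INR B)).
  - apply lsum_ln_primes_le; auto. intros q Hq. destruct (H q Hq) as [Hp Hr].
    split; auto. assert (D : Nat.divide q (B * (fact N * fact N))).
    { rewrite HB. apply divide_fact. lia. }
    apply nprime_mult in D; auto. destruct D as [|D]; auto.
    exfalso. apply nprime_mult in D; auto. destruct D as [D|D]; apply nprime_fact in D; auto; lia.
  - replace 4 with (INR 4) by (simpl; ring). rewrite <- ln_pow_nat by lia.
    apply ln_le; [apply lt_0_INR; lia|]. apply le_INR. nia.
Qed.

(** * The Dirichlet series of a power of the divisor function near its pole *)

Lemma exp_ineq (x : R) : 1 + x <= exp x.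
Proof.
  destruct (Req_dec x 0) as [->|H]; [rewrite exp_0; lra|].
  left. now apply exp_ineq1.
Qed.

Lemma Rpower_pos x y : 0 < Rpower x y.
Proof. apply exp_pos. Qed.

Lemma Rpower_base_le x y a : 0 < x -> x <= y -> 0 <= a -> Rpower x a <= Rpower y a.
Proof. intros. apply Rle_Rpower_l; lra. Qed.

Lemma Rpower_base_ge x y a : 0 < x -> x <= y -> 0 <= a -> Rpower y (- a) <= Rpower x (- a).
Proof.
  intros. rewrite !Rpower_Ropp. apply Rinv_le_contravar; [apply Rpower_pos|].
  now apply Rpower_base_le.
Qed.

Lemma Rpower_one a : Rpower 1 a = 1.
Proof. unfold Rpower. now rewrite ln_1, Rmult_0_r, exp_0. Qed.

Lemma Rpower_le_exp (k : R) : 0 <= k ->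
  exists K, 0 < K /\ forall x, 0 < x -> Rpower x k <= K * exp x.
Proof.
  (* The constant is [(k+1)^k]: [ln (x/(k+1)) <= x/(k+1)] gives [k ln x <= x + k ln (k+1)]. The
     shift by [1] covers [k = 0]. *)
  intros Hk. exists (exp (k * ln (k + 1))). split; [apply exp_pos|].
  intros x Hx. unfold Rpower. rewrite <- exp_plus. apply exp_le_compat.
  assert (E : ln x = ln (x / (k + 1)) + ln (k + 1)).
  { rewrite <- ln_mult; [f_equal; field; lra| |lra]. apply Rdiv_lt_0_compat; lra. }
  assert (H : ln (x / (k + 1)) <= x / (k + 1)).
  { assert (Hp : 0 < x / (k + 1)) by (apply Rdiv_lt_0_compat; lra).
    generalize (exp_ineq (ln (x / (k + 1)))). rewrite exp_ln by auto. lra. }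
  assert (Hq : k * (x / (k + 1)) <= x).
  { replace (k * (x / (k + 1))) with (x - x / (k + 1)) by (field; lra).
    assert (0 < x / (k + 1)) by (apply Rdiv_lt_0_compat; lra). lra. }
  rewrite E. nra.
Qed.

Lemma Rpower_le_geom (k rho : R) : 0 <= k -> 1 < rho ->
  exists K, 0 < K /\ forall n : nat, Rpower (INR (S n)) k <= K * rho ^ n.
Proof.
  intros Hk Hr. destruct (Rpower_le_exp k Hk) as (K & HK & H).
  assert (Hl : 0 < ln rho) by (rewrite <- ln_1; apply ln_increasing; lra).
  exists (K * rho * Rpower (ln rho) (- k)).
  pose proof (Rpower_pos (ln rho) (- k)).
  split; [repeat apply Rmult_lt_0_compat; lra|]. intros n.
  assert (Hn : 0 < INR (S n)) by (apply lt_0_INR; lia).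
  specialize (H (ln rho * INR (S n)) (Rmult_lt_0_compat _ _ Hl Hn)).
  rewrite <- Rpower_mult_distr in H by auto.
  assert (E : exp (ln rho * INR (S n)) = rho * rho ^ n).
  { rewrite Rmult_comm, <- ln_pow, exp_ln by (try apply pow_lt; lra). reflexivity. }
  rewrite E in H.
  apply Rmult_le_reg_l with (Rpower (ln rho) k); [apply Rpower_pos|].
  apply Rle_trans with (1 := H). right. rewrite Rpower_Ropp. field.
  generalize (Rpower_pos (ln rho) k); lra.
Qed.

Lemma has_sum_geom q : 0 <= q < 1 -> has_sum (fun n => q ^ n) (/ (1 - q)).
Proof.
  intros H. apply has_sum_nat; [intros; apply pow_le; lra|].
  apply is_series_geom. rewrite Rabs_pos_eq; lra.
Qed.

(* The local factor [sum_k (k+1)^a y^k] agrees with [(1-y)^(-2^a)] up to [exp (O(y^2))]. *)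
Lemma euler_factor (a : R) : 0 <= a ->
  exists K, 0 < K /\ forall y, 0 < y <= 1/2 ->
    exists H, has_sum (fun k => Rpower (INR (S k)) a * y ^ k) H /\
      Rpower (/ (1 - y)) (Rpower 2 a) * exp (- K * y ^ 2) <= H /\
      H <= Rpower (/ (1 - y)) (Rpower 2 a) * exp (K * y ^ 2).
Proof.
  intros Ha. set (A := Rpower 2 a). assert (HA : 0 < A) by apply Rpower_pos.
  (* The ratio [3/2] leaves [(3/2) y <= 3/4 < 1] for [y <= 1/2]; the terms with [k >= 2] are then at
     most [4 K y^2 (3/4)^k]. *)
  destruct (Rpower_le_geom a (3/2) Ha) as (K & HK & HB); [lra|].
  (* [16 K] is the geometric tail of the upper bound; the lower bound needs [A^2] from
     [ln (1 + A y)] and [2 A] from [ln (1/(1-y)) <= y + 2 y^2]. *)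
  exists (16 * K + A * A + 2 * A). split; [nra|].
  intros y Hy.
  assert (Hpow : forall k, 0 <= y ^ k) by (intros; apply pow_le; lra).
  destruct (has_sum_dom (fun k => Rpower (INR (S k)) a * y ^ k)
    (fun k => (if excluded_middle_informative (k = O) then 1 else 0) +
              ((if excluded_middle_informative (k = 1%nat) then A * y else 0) +
               4 * K * y ^ 2 * (3/4) ^ k)) (1 + (A * y + 4 * K * y ^ 2 * / (1 - 3/4))))
    as (H & HH & Hle).
  { intros k. split. { apply Rmult_le_pos; auto. left; apply Rpower_pos. }
    assert (0 <= 4 * K * y ^ 2 * (3/4) ^ k).
    { repeat apply Rmult_le_pos; try lra; auto. apply pow_le; lra. }
    destruct k as [|[|k]]; repeat destruct excluded_middle_informative; try lia; try lra.
    - simpl INR. rewrite Rpower_one. simpl in *. lra.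
    - simpl INR. replace (1 + 1) with 2 by ring. fold A. simpl in *. lra.
    - rewrite !Rplus_0_l.
      apply Rle_trans with (K * (3/2) ^ S (S k) * y ^ S (S k)).
      + apply Rmult_le_compat_r; auto.
      + replace (3/4) with (3/2 * (1/2)) by field. rewrite Rpow_mult_distr.
        replace (y ^ S (S k)) with (y ^ 2 * y ^ k) by (simpl; ring).
        replace ((1/2) ^ S (S k)) with (/4 * (1/2) ^ k) by (simpl; field).
        assert (y ^ k <= (1/2) ^ k) by (apply pow_incr; lra).
        assert (0 <= K * (3/2) ^ S (S k) * y ^ 2).
        { repeat apply Rmult_le_pos; auto; try lra. apply pow_le; lra. }
        nra. }
  { apply has_sum_plus; [apply has_sum_point; lra|].
    apply has_sum_plus; [apply has_sum_point; nra|].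
    apply has_sum_scal; [|apply has_sum_geom; lra].
    repeat apply Rmult_le_pos; auto; lra. }
  assert (Hge : 1 + A * y <= H).
  { destruct HH as (_ & HH & _). specialize (HH (0 :: 1 :: nil)%nat).
    simpl in HH. rewrite Rpower_one in HH. replace (1 + 1) with 2 in HH by ring.
    fold A in HH. assert (NoDup (0 :: 1 :: nil)%nat).
    { repeat constructor; simpl; [intros [|[]]; lia|tauto]. }
    specialize (HH H0). lra. }
  exists H. split; [auto|].
  assert (Hln : y <= ln (/ (1 - y)) <= y + 2 * y ^ 2).
  { rewrite ln_Rinv by lra. split.
    - assert (ln (1 - y) <= - y); [|lra].
      rewrite <- (ln_exp (- y)). apply ln_le; [lra|]. generalize (exp_ineq (- y)); lra.
    - rewrite <- ln_Rinv by lra. rewrite <- (ln_exp (y + 2 * y ^ 2)).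
      apply ln_le; [apply Rinv_0_lt_compat; lra|].
      eapply Rle_trans; [|apply exp_ineq].
      apply Rmult_le_reg_l with (1 - y); [lra|]. rewrite Rinv_r by lra. nra. }
  unfold Rpower. rewrite <- !exp_plus. split.
  - apply Rle_trans with (2 := Hge).
    apply Rle_trans with (exp (A * y / (1 + A * y))).
    + apply exp_le_compat.
      assert (A * y - (A * y) ^ 2 <= A * y / (1 + A * y)).
      { apply Rmult_le_reg_r with (1 + A * y); [nra|].
        unfold Rdiv. rewrite Rmult_assoc, Rinv_l by nra.
        assert (0 <= (A * y) ^ 3) by (apply pow_le; nra). nra. }
      assert (A * ln (/ (1 - y)) <= A * (y + 2 * y ^ 2)) by (apply Rmult_le_compat_l; lra).
      assert (0 <= K * y ^ 2) by (apply Rmult_le_pos; [lra|auto]). nra.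
    + assert (P : 0 < 1 + A * y) by nra.
      generalize (exp_ineq (- (A * y / (1 + A * y)))). rewrite exp_Ropp.
      replace (1 + - (A * y / (1 + A * y))) with (/ (1 + A * y)) by (field; lra).
      intros Q. apply Rinv_le_contravar in Q; [|now apply Rinv_0_lt_compat].
      rewrite !Rinv_inv in Q. auto.
  - apply Rle_trans with (1 := Hle).
    eapply Rle_trans; [apply exp_ineq|]. apply exp_le_compat.
    replace (/ (1 - 3/4)) with 4 by field.
    assert (A * y <= A * ln (/ (1 - y))) by (apply Rmult_le_compat_l; lra).
    assert (0 <= A * A * y ^ 2) by (repeat apply Rmult_le_pos; try lra; auto).
    assert (0 <= A * y ^ 2) by (repeat apply Rmult_le_pos; try lra; auto). nra.
Qed.

(** Terms of [sum d(n)^a n^(-s)], which is the Riemann zeta function for [a = 0]. The value [0] at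
    index [0] lets sums range over all naturals. *)
Definition gterm (a s : R) (n : nat) : R :=
  match n with O => 0 | _ => Rpower (INR (ndivisors n)) a * Rpower (INR n) (- s) end.

Lemma gterm_pos_eq a s n : (1 <= n)%nat ->
  gterm a s n = Rpower (INR (ndivisors n)) a * Rpower (INR n) (- s).
Proof. destruct n; [lia|reflexivity]. Qed.

Lemma gterm_nonneg a s n : 0 <= gterm a s n.
Proof.
  destruct n; simpl; [lra|]. apply Rmult_le_pos; left; apply Rpower_pos.
Qed.

Lemma Rpower_mprod (h : nat -> nat -> R) a l m : (forall j k, In j l -> 0 < h j k) ->
  Rpower (mprod h l m) a = mprod (fun j k => Rpower (h j k) a) l m.
Proof.
  induction l as [|j l IH]; simpl; intros H; [apply Rpower_one|].
  rewrite <- Rpower_mult_distr.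
  - now rewrite IH by auto.
  - auto.
  - apply mprod_pos; auto.
Qed.

Lemma INR_enc p l m : INR (enc p l m) = mprod (fun j k => INR (p j) ^ k) l m.
Proof.
  induction l as [|j l IH]; [reflexivity|]. cbn [enc mprod].
  now rewrite mult_INR, pow_INR, IH.
Qed.

Lemma gterm_enc a s p l m : (forall j, In j l -> nprime (p j)) -> NoDup (map p l) ->
  gterm a s (enc p l m) =
  mprod (fun j k => Rpower (INR (S k)) a * Rpower (INR (p j)) (- s) ^ k) l m.
Proof.
  intros Hp Hl. rewrite gterm_pos_eq by (now apply enc_pos).
  assert (Hpos : forall j, In j l -> 0 < INR (p j)).
  { intros j Hj. apply lt_0_INR. pose proof (nprime_ge2 _ (Hp j Hj)). lia. }
  rewrite ndivisors_enc, INR_enc by auto.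
  rewrite !Rpower_mprod.
  - rewrite <- mprod_mult. apply mprod_ext. intros j k Hj. f_equal.
    rewrite <- !Rpower_pow by (auto using Rpower_pos).
    rewrite !Rpower_mult. f_equal. ring.
  - intros j k Hj. apply pow_lt. auto.
  - intros j k Hj. apply lt_0_INR. lia.
Qed.

Lemma lsum_inv_sq (l : list nat) : NoDup l -> (forall n, In n l -> (1 <= n)%nat) ->
  lsum (fun n => / (INR n) ^ 2) l <= 2.
Proof.
  intros Hl H.
  assert (Q : forall N, lsum (fun n => / (INR n) ^ 2) (seq 1 (S N)) <= 2 - / INR (S N)).
  { induction N as [|N IH]; [simpl; lra|].
    rewrite seq_S, lsum_app. change (1 + S N)%nat with (S (S N)).
    cbn [lsum fold_right]. rewrite Rplus_0_r, (S_INR (S N)).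
    set (u := INR (S N)) in *.
    assert (Hu : 1 <= u) by (unfold u; rewrite S_INR; generalize (pos_INR N); lra).
    assert (/ (u + 1) ^ 2 <= / u - / (u + 1)); [|lra].
    replace (/ u - / (u + 1)) with (/ (u * (u + 1))) by (field; lra).
    apply Rinv_le_contravar; nra. }
  apply Rle_trans with (lsum (fun n => / (INR n) ^ 2) (seq 1 (S (list_max l)))).
  - apply lsum_incl; auto.
    + intros x. destruct x as [|x]; [simpl; rewrite Rmult_0_l, Rinv_0; lra|].
      left. apply Rinv_0_lt_compat, pow_lt, lt_0_INR; lia.
    + intros k Hk. apply in_seq. specialize (H k Hk).
      pose proof (in_list_max l k Hk) as Q'. lia.
  - specialize (Q (list_max l)).
    assert (0 < / INR (S (list_max l))) by (apply Rinv_0_lt_compat, lt_0_INR; lia). lra.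
Qed.

Definition primes_upto (N : nat) : list nat :=
  filter (fun q => if prime_dec (Z.of_nat q) then true else false) (seq 0 (S N)).

Lemma in_primes_upto N q : In q (primes_upto N) <-> nprime q /\ (q <= N)%nat.
Proof.
  unfold primes_upto, nprime. rewrite filter_In, in_seq.
  destruct (prime_dec (Z.of_nat q)); split; intros [H1 H2]; try discriminate; try contradiction; split; auto; lia.
Qed.

Lemma NoDup_primes_upto N : NoDup (primes_upto N).
Proof. apply NoDup_filter, seq_NoDup. Qed.

(* Both sums run over the integers without prime factor above [N]. *)
Lemma smooth_sum_bounds (a : R) : 0 <= a ->
  exists K, 0 < K /\ forall N s, 1 <= s -> exists u v,
    has_sum (fun m => gterm a s (enc (fun q => q) (primes_upto N) m)) u /\
    has_sum (fun m => gterm 0 s (enc (fun q => q) (primes_upto N) m)) v /\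
    0 < v /\ / K * Rpower v (Rpower 2 a) <= u <= K * Rpower v (Rpower 2 a).
Proof.
  intros Ha. destruct (euler_factor a Ha) as (K & HK & HE).
  (* Each local factor is off by at most [exp (K y_q^2)], and [sum y_q^2 <= sum 1/n^2 <= 2]
     uniformly in [N] and in [s >= 1]. *)
  exists (exp (2 * K)). split; [apply exp_pos|]. intros N s Hs.
  set (l := primes_upto N). set (A := Rpower 2 a).
  assert (Hp : forall j, In j l -> nprime j) by (intros j Hj; now apply in_primes_upto in Hj).
  assert (Hl : NoDup (map (fun q => q) l)) by (rewrite map_id; apply NoDup_primes_upto).
  pose (y := fun q : nat => Rpower (INR q) (- s)).
  assert (Hy0 : forall q, In q l -> 0 < y q <= / INR q).
  { intros q Hq. split; [apply Rpower_pos|]. pose proof (nprime_ge2 _ (Hp q Hq)) as H2.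
    unfold y. rewrite Rpower_Ropp. apply Rinv_le_contravar; [apply lt_0_INR; lia|].
    rewrite <- (Rpower_1 (INR q)) at 1 by (apply lt_0_INR; lia).
    apply Rle_Rpower; auto. apply (le_INR 1); lia. }
  assert (Hy : forall q, In q l -> 0 < y q <= 1/2).
  { intros q Hq. destruct (Hy0 q Hq) as [H1 H2]. split; auto.
    apply Rle_trans with (1 := H2). pose proof (nprime_ge2 _ (Hp q Hq)) as H3.
    apply le_INR in H3. simpl in H3. unfold Rdiv. rewrite Rmult_1_l.
    apply Rinv_le_contravar; lra. }
  pose (H := fun q => tsum (fun k => Rpower (INR (S k)) a * y q ^ k)).
  assert (HH : forall q, In q l -> has_sum (fun k => Rpower (INR (S k)) a * y q ^ k) (H q) /\
      Rpower (/ (1 - y q)) A * exp (- K * y q ^ 2) <= H q /\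
      H q <= Rpower (/ (1 - y q)) A * exp (K * y q ^ 2)).
  { intros q Hq. destruct (HE (y q) (Hy q Hq)) as (h & H1 & H2).
    unfold H. rewrite (tsum_eq _ _ H1). auto. }
  exists (lprod H l), (lprod (fun q => / (1 - y q)) l).
  assert (Hsq : lsum (fun q => y q ^ 2) l <= 2).
  { apply Rle_trans with (lsum (fun n => / (INR n) ^ 2) l).
    - apply lsum_le. intros q Hq. destruct (Hy0 q Hq) as [H1 H2].
      rewrite <- pow_inv. apply pow_incr. lra.
    - apply lsum_inv_sq; [apply NoDup_primes_upto|].
      intros n Hn. pose proof (nprime_ge2 _ (Hp n Hn)). lia. }
  split; [|split; [|split]].
  - apply has_sum_ext with (mprod (fun j k => Rpower (INR (S k)) a * y j ^ k) l).
    { intros m. now rewrite gterm_enc. }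
    apply has_sum_mprod. intros j Hj. now apply HH.
  - apply has_sum_ext with (mprod (fun j k => y j ^ k) l).
    { intros m. rewrite gterm_enc by auto. apply mprod_ext. intros j k Hj.
      rewrite Rpower_O by (apply lt_0_INR; lia). unfold y. ring. }
    apply has_sum_mprod. intros j Hj. apply has_sum_geom. specialize (Hy j Hj). lra.
  - clear - Hy. induction l as [|q l IH]; simpl; [lra|].
    apply Rmult_lt_0_compat.
    + apply Rinv_0_lt_compat. specialize (Hy q (or_introl eq_refl)). lra.
    + apply IH. intros; apply Hy; now right.
  - assert (Hb : 0 < lprod (fun q => / (1 - y q)) l /\
      Rpower (lprod (fun q => / (1 - y q)) l) A * exp (- K * lsum (fun q => y q ^ 2) l)
      <= lprod H l <=
      Rpower (lprod (fun q => / (1 - y q)) l) A * exp (K * lsum (fun q => y q ^ 2) l)).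
    { clear - Hy HH. induction l as [|q l IH]; cbn [lprod lsum fold_right].
      - rewrite !Rmult_0_r, exp_0, Rpower_one. lra.
      - destruct IH as (I1 & I2 & I3).
        { intros; apply Hy; now right. } { intros; apply HH; now right. }
        destruct (HH q (or_introl eq_refl)) as (_ & J2 & J3).
        assert (Q : 0 < / (1 - y q)).
        { apply Rinv_0_lt_compat. specialize (Hy q (or_introl eq_refl)). lra. }
        unfold lprod, lsum in *. split; [now apply Rmult_lt_0_compat|].
        rewrite <- Rpower_mult_distr by auto.
        rewrite !Rmult_plus_distr_l, !exp_plus.
        set (B := Rpower (/ (1 - y q)) A) in *.
        set (D := Rpower (fold_right _ 1 l) A) in *.
        assert (0 < B) by apply Rpower_pos. assert (0 < D) by apply Rpower_pos.
        split.
        + replace (B * D * (exp (- K * y q ^ 2) * exp (- K * fold_right (fun x s => y x ^ 2 + s) 0 l)))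
            with ((B * exp (- K * y q ^ 2)) * (D * exp (- K * fold_right (fun x s => y x ^ 2 + s) 0 l)))
            by ring.
          apply Rmult_le_compat; auto; left; apply Rmult_lt_0_compat; auto; apply exp_pos.
        + replace (B * D * (exp (K * y q ^ 2) * exp (K * fold_right (fun x s => y x ^ 2 + s) 0 l)))
            with ((B * exp (K * y q ^ 2)) * (D * exp (K * fold_right (fun x s => y x ^ 2 + s) 0 l)))
            by ring.
          apply Rmult_le_compat; auto.
          * eapply Rle_trans; [|apply J2]. left; apply Rmult_lt_0_compat; auto; apply exp_pos.
          * eapply Rle_trans; [|apply I2]. left; apply Rmult_lt_0_compat; auto; apply exp_pos. }
    destruct Hb as (_ & B1 & B2). set (D := Rpower (lprod _ l) A) in *.
    assert (0 < D) by apply Rpower_pos. rewrite <- exp_Ropp. split.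
    + apply Rle_trans with (2 := B1). rewrite Rmult_comm. apply Rmult_le_compat_l; [lra|].
      apply exp_le_compat. nra.
    + apply Rle_trans with (1 := B2). rewrite Rmult_comm. apply Rmult_le_compat_r; [lra|].
      apply exp_le_compat. nra.
Qed.

(** An integer [n] with [1 <= n <= N] has no prime factor above [N], hence is among the encoded
    integers; unique factorization prevents it from being counted twice. *)
Lemma smooth_sum_ge a s N u (L : list nat) :
  has_sum (fun m => gterm a s (enc (fun q => q) (primes_upto N) m)) u ->
  NoDup L -> (forall n, In n L -> (n <= N)%nat) -> lsum (gterm a s) L <= u.
Proof.
  intros Hu HL HN. set (l := primes_upto N) in *.
  assert (Hp : forall j, In j l -> nprime j) by (intros j Hj; now apply in_primes_upto in Hj).
  assert (Hl : NoDup (map (fun q => q) l)) by (rewrite map_id; apply NoDup_primes_upto).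
  pose (F := fun n => if excluded_middle_informative (exists m, enc (fun q => q) l m = n)
                      then gterm a s n else 0).
  assert (HF : has_sum F u).
  { apply (has_sum_inj (enc (fun q => q) l) F).
    - intros x y. now apply enc_inj.
    - intros n. unfold F. destruct excluded_middle_informative; [apply gterm_nonneg|lra].
    - intros n. unfold F. destruct excluded_middle_informative; auto.
    - apply has_sum_ext with (2 := Hu). intros m. unfold F.
      destruct excluded_middle_informative as [|n]; auto. destruct n. now exists m. }
  rewrite (lsum_ext _ F); [now apply HF|]. intros n Hn. unfold F.
  destruct excluded_middle_informative as [|H]; auto.
  (* The integer [0] is not encoded, but its term is [0]. *)
  destruct n as [|n]; [reflexivity|]. destruct H. apply enc_surj; auto; [lia|].
  intros q Hq Hd. rewrite map_id. apply in_primes_upto. split; auto.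
  apply Nat.divide_pos_le in Hd; [|lia]. specialize (HN _ Hn). lia.
Qed.

Lemma smooth_sum_le a s N u v :
  has_sum (fun m => gterm a s (enc (fun q => q) (primes_upto N) m)) u ->
  has_sum (gterm a s) v -> u <= v.
Proof.
  intros Hu Hv. set (l := primes_upto N) in *.
  assert (Hp : forall j, In j l -> nprime j) by (intros j Hj; now apply in_primes_upto in Hj).
  assert (Hl : NoDup (map (fun q => q) l)) by (rewrite map_id; apply NoDup_primes_upto).
  apply Hu. intros L HL.
  rewrite <- (lsum_map (enc (fun q => q) l) (gterm a s)). apply Hv.
  apply NoDup_map_NoDup_ForallPairs; auto. intros x y _ _. now apply enc_inj.
Qed.

(** The mean value theorem for [t^(-x)]: an integral comparison for [sum n^(-1-x)] in a form that
    telescopes. *)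
Lemma zeta_term_telescope (x : R) (n : nat) : 0 < x -> (1 <= n)%nat ->
  x * Rpower (INR (S n)) (- (1 + x)) <= Rpower (INR n) (- x) - Rpower (INR (S n)) (- x)
    <= x * Rpower (INR n) (- (1 + x)).
Proof.
  intros Hx Hn. assert (Hn0 : 0 < INR n) by (apply lt_0_INR; lia).
  assert (HS : INR (S n) = INR n + 1) by apply S_INR.
  destruct (MVT_cor2 (fun t => Rpower t (- x)) (fun t => - x * Rpower t (- x - 1))
    (INR n) (INR (S n))) as (c & E & Hc).
  - lra.
  - intros c Hc. apply derivable_pt_lim_power. lra.
  - replace (INR (S n) - INR n) with 1 in E by lra.
    replace (- x - 1) with (- (1 + x)) in E by ring.
    replace (Rpower (INR n) (- x) - Rpower (INR (S n)) (- x))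
      with (x * Rpower c (- (1 + x))) by lra.
    split; apply Rmult_le_compat_l; try lra; apply Rpower_base_ge; lra.
Qed.

Lemma gterm0 s n : (1 <= n)%nat -> gterm 0 s n = Rpower (INR n) (- s).
Proof.
  intros Hn. rewrite gterm_pos_eq by auto. rewrite Rpower_O; [ring|].
  apply lt_0_INR. now apply ndivisors_pos.
Qed.

Lemma zeta_partial (x : R) (N : nat) : 0 < x ->
  (1 - Rpower (INR (S N)) (- x)) / x <= lsum (gterm 0 (1 + x)) (seq 1 N) /\
  lsum (gterm 0 (1 + x)) (seq 1 (S N)) <= 1 + (1 - Rpower (INR (S N)) (- x)) / x.
Proof.
  intros Hx. induction N as [|N [I1 I2]].
  - simpl. rewrite !Rpower_one. split; [right; field; lra|].
    right; field; lra.
  - rewrite (seq_S (S N) 1), (seq_S N 1), !lsum_app. rewrite (seq_S N 1), lsum_app in I2.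
    change (1 + S N)%nat with (S (S N)) in *. change (1 + N)%nat with (S N) in *.
    cbn [lsum fold_right] in *. fold (lsum (gterm 0 (1 + x)) (seq 1 N)) in *.
    rewrite !gterm0 in * by lia.
    destruct (zeta_term_telescope x (S N) Hx) as [T1 T2]; [lia|].
    assert (D : forall u w t, u - w <= x * t -> (u - w) / x <= t).
    { intros u w t Ht. apply Rmult_le_reg_l with x; auto.
      replace (x * ((u - w) / x)) with (u - w) by (field; lra). auto. }
    assert (D' : forall u w t, x * t <= u - w -> t <= (u - w) / x).
    { intros u w t Ht. apply Rmult_le_reg_l with x; auto.
      replace (x * ((u - w) / x)) with (u - w) by (field; lra). auto. }
    apply D in T2. apply D' in T1.
    replace ((1 - Rpower (INR (S (S N))) (- x)) / x) with
      ((1 - Rpower (INR (S N)) (- x)) / x +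
       (Rpower (INR (S N)) (- x) - Rpower (INR (S (S N))) (- x)) / x) by (field; lra).
    unfold lsum in *. split; lra.
Qed.

(** The order of the pole is read off from smooth sums. For the upper bound, a finite set of
    integers lies in a smooth sum whose zeta part is at most [2/x]. For the lower bound one [N] with
    [(N+1)^(-x) <= 1/2] suffices, the zeta part being then at least [1/(2x)]. These factors [2] give
    [Rpower 2 A] in the constant. *)
Lemma ndivisors_series_bounds (a : R) : 0 <= a ->
  exists K, 0 < K /\ forall x, 0 < x <= 1 -> exists v, has_sum (gterm a (1 + x)) v /\
    / K * Rpower x (- Rpower 2 a) <= v <= K * Rpower x (- Rpower 2 a).
Proof.
  intros Ha. destruct (smooth_sum_bounds a Ha) as (K & HK & HS).
  set (A := Rpower 2 a) in *. assert (HA : 0 < A) by apply Rpower_pos.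
  assert (HP : 0 < Rpower 2 A) by apply Rpower_pos.
  exists (K * Rpower 2 A). split; [now apply Rmult_lt_0_compat|].
  intros x Hx.
  assert (HK' : 0 < / K) by now apply Rinv_0_lt_compat.
  assert (Zub : forall L, NoDup L -> lsum (gterm 0 (1 + x)) L <= 2 * / x).
  { intros L HL. apply Rle_trans with (lsum (gterm 0 (1 + x)) (0 :: seq 1 (S (list_max L)))%nat).
    - apply lsum_incl; auto using gterm_nonneg. intros n Hn.
      pose proof (in_list_max L n Hn) as Q'.
      destruct n; [now left|right]. apply in_seq. lia.
    - cbn [lsum fold_right]. change (gterm 0 (1 + x) 0) with 0. rewrite Rplus_0_l.
      apply Rle_trans with (1 := proj2 (zeta_partial x (list_max L) (proj1 Hx))).
      pose proof (Rpower_pos (INR (S (list_max L))) (- x)).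
      assert (1 <= / x). { rewrite <- Rinv_1. apply Rinv_le_contravar; lra. }
      unfold Rdiv. nra. }
  destruct (has_sum_bounded (gterm 0 (1 + x)) (2 * / x) (gterm_nonneg 0 (1 + x)) Zub)
    as (z & Hz & Hz2).
  assert (Gub : forall L, NoDup L ->
            lsum (gterm a (1 + x)) L <= K * Rpower 2 A * Rpower x (- A)).
  { intros L HL. destruct (HS (list_max L) (1 + x)) as (u & v & Hu & Hv & Hv0 & _ & Huv); [lra|].
    assert (Hv2 : v <= 2 * / x) by (apply Rle_trans with z; auto; eapply smooth_sum_le; eauto).
    apply Rle_trans with u.
    { eapply smooth_sum_ge; eauto. intros n Hn.
      now apply in_list_max. }
    apply Rle_trans with (1 := Huv). rewrite Rmult_assoc. apply Rmult_le_compat_l; [lra|].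
    apply Rle_trans with (Rpower (2 * / x) A).
    - apply Rpower_base_le; lra.
    - rewrite <- Rpower_mult_distr by (try apply Rinv_0_lt_compat; lra).
      right. f_equal. unfold Rpower. rewrite ln_Rinv by lra. f_equal. ring. }
  destruct (has_sum_bounded (gterm a (1 + x)) _ (gterm_nonneg a (1 + x)) Gub) as (g & Hg & Hg2).
  exists g. split; [auto|split; [|auto]].
  assert (HN : exists N, Rpower (INR (S N)) (- x) <= 1/2).
  { destruct (nfloor_ex (exp (ln 2 / x))) as (N & HN); [left; apply exp_pos|].
    exists N. rewrite Rpower_Ropp. unfold Rdiv. rewrite Rmult_1_l.
    apply Rinv_le_contravar; [lra|].
    rewrite <- (exp_ln 2) by lra. unfold Rpower. apply exp_le_compat.
    replace (ln 2) with (x * (ln 2 / x)) by (field; lra).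
    apply Rmult_le_compat_l; [lra|]. rewrite <- (ln_exp (ln 2 / x)).
    apply ln_le; [apply exp_pos|]. rewrite S_INR. lra. }
  destruct HN as (N & HN).
  destruct (HS N (1 + x)) as (u & v & Hu & Hv & Hv0 & Huv & _); [lra|].
  assert (Hv2 : / 2 * / x <= v).
  { apply Rle_trans with (lsum (gterm 0 (1 + x)) (seq 1 N)).
    - apply Rle_trans with (2 := proj1 (zeta_partial x N (proj1 Hx))).
      assert (0 < / x) by (apply Rinv_0_lt_compat; lra). unfold Rdiv. nra.
    - eapply smooth_sum_ge; eauto; [apply seq_NoDup|]. intros n Hn. apply in_seq in Hn. lia. }
  apply Rle_trans with u; [|eapply smooth_sum_le; eauto].
  apply Rle_trans with (2 := Huv). rewrite Rinv_mult, Rmult_assoc.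
  apply Rmult_le_compat_l; [lra|].
  apply Rle_trans with (Rpower (/ 2 * / x) A).
  - rewrite <- Rpower_mult_distr by (try apply Rinv_0_lt_compat; lra).
    right. f_equal.
    + rewrite <- Rpower_Ropp. unfold Rpower. rewrite ln_Rinv by lra. f_equal. ring.
    + unfold Rpower. rewrite ln_Rinv by lra. f_equal. ring.
  - apply Rpower_base_le; try lra. apply Rmult_lt_0_compat; apply Rinv_0_lt_compat; lra.
Qed.

(** * Poisson averages of the divisor function *)

(** For fixed [x] the probabilities of a Poisson law in [m]; for fixed [m] the density of a Gamma
    law in [x]. Both readings are used. *)
Definition pois (m : nat) (x : R) : R := exp (- x) * (x ^ m / INR (fact m)).

Lemma pois_nonneg m x : 0 <= x -> 0 <= pois m x.
Proof.
  intros Hx. apply Rmult_le_pos; [left; apply exp_pos|].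
  apply Rmult_le_pos; [now apply pow_le|]. left; apply Rinv_0_lt_compat, INR_fact_lt_0.
Qed.

(** The generating function of the Poisson law. At [x = r ln n] its value is [n^(- r (1 - z))], a
    shift of the exponent of a Dirichlet series. *)
Lemma has_sum_pois_pow z x : 0 <= z -> 0 <= x ->
  has_sum (fun m => z ^ m * pois m x) (exp (- ((1 - z) * x))).
Proof.
  intros Hz Hx. replace (exp (- ((1 - z) * x))) with (exp (- x) * exp (z * x))
    by (rewrite <- exp_plus; f_equal; ring).
  apply has_sum_ext with (fun m => exp (- x) * ((z * x) ^ m / INR (fact m))).
  - intros m. unfold pois. rewrite Rpow_mult_distr. field. apply INR_fact_neq_0.
  - apply has_sum_scal; [left; apply exp_pos|]. apply has_sum_exp. nra.
Qed.

Lemma has_sum_pois x : 0 <= x -> has_sum (fun m => pois m x) 1.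
Proof.
  intros Hx. apply has_sum_ext with (fun m => 1 ^ m * pois m x).
  - intros m. rewrite pow1. ring.
  - pose proof (has_sum_pois_pow 1 x Rle_0_1 Hx) as H.
    replace (- ((1 - 1) * x)) with 0 in H by ring. now rewrite exp_0 in H.
Qed.

Lemma pois_le_1 m x : 0 <= x -> pois m x <= 1.
Proof. intros Hx. apply (has_sum_term _ _ m (has_sum_pois x Hx)). Qed.

Lemma pois_S m x : INR (S m) * pois (S m) x = x * pois m x.
Proof.
  unfold pois. change (fact (S m)) with (S m * fact m)%nat. rewrite mult_INR.
  simpl pow. field. split; [apply INR_fact_neq_0|apply not_0_INR; lia].
Qed.

(** The binomial theorem, or the sum of two independent Poisson variables. With [x] and [y]
    multiples of the logarithms of two integers it splits the weight along their product. *)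
Lemma pois_plus m x y :
  pois m (x + y) = lsum (fun i => pois i x * pois (m - i) y) (seq 0 (S m)).
Proof.
  unfold pois. rewrite binomial, <- sum_n_Reals, sum_n_lsum.
  unfold Rdiv. rewrite Rmult_comm, Rmult_assoc, Rmult_comm, <- lsum_scal.
  apply lsum_ext. intros i Hi. apply in_seq in Hi.
  replace (exp (- (x + y))) with (exp (- x) * exp (- y)) by (rewrite <- exp_plus; f_equal; ring).
  unfold Binomial.C. field. repeat split; apply INR_fact_neq_0.
Qed.

(** The derivative of [pois (l+1)] is [pois l - pois (l+1)], so the derivative of the partial sum
    telescopes to its last term. *)
Lemma is_derive_pois_sum i x :
  is_derive (fun x => sum_n (fun l => pois l x) i) x (- pois i x).
Proof.
  induction i as [|i IH].
  - apply is_derive_ext with (fun x => exp (- x)).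
    + intros t. rewrite sum_O. unfold pois. simpl. field.
    + unfold pois. simpl. auto_derive; [exact I|]. field.
  - apply is_derive_ext with (fun x => plus (sum_n (fun l => pois l x) i) (pois (S i) x)).
    + intros t. now rewrite sum_Sn.
    + replace (- pois (S i) x) with (plus (- pois i x) (pois i x - pois (S i) x))
        by (unfold plus; simpl; ring).
      apply (is_derive_plus (fun x => sum_n (fun l => pois l x) i) (pois (S i))); auto.
      unfold pois.
      assert (E : x ^ i / INR (fact i) = INR (S i) * x ^ i / INR (fact (S i))).
      { change (fact (S i)) with (S i * fact i)%nat. rewrite mult_INR. field.
        split; [apply INR_fact_neq_0|apply not_0_INR; lia]. }
      rewrite E. auto_derive; [exact I|]. unfold Rdiv.

      change (match i with O => 1 | S _ => INR i + 1 end) with (INR (S i)).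
      change (fact i + i * fact i)%nat with (fact (S i)). simpl pow. ring.
Qed.

(** Over a step of length at most [h] the power grows and the exponential loses at most [exp h];
    this lets one value stand for a whole interval to its left. *)
Lemma pois_step h i x y : 0 <= x -> x <= y <= x + h -> pois i x <= exp h * pois i y.
Proof.
  intros Hx Hy. unfold pois. rewrite <- Rmult_assoc, <- exp_plus.
  apply Rmult_le_compat.
  - left; apply exp_pos.
  - apply Rmult_le_pos; [now apply pow_le|]. left; apply Rinv_0_lt_compat, INR_fact_lt_0.
  - apply exp_le_compat. lra.
  - apply Rmult_le_compat_r; [left; apply Rinv_0_lt_compat, INR_fact_lt_0|].
    apply pow_incr. lra.
Qed.

(* Over a step [h], [pois i] is at most [exp h / h] times the drop of the Poisson
   distribution function [sum_(l <= i) pois l], and the drops telescope. *)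
Lemma pois_lattice_sum h i J : 0 < h ->
  lsum (fun j => pois i (INR (S j) * h)) (seq 0 J) <= exp h / h.
Proof.
  intros Hh. set (Q := fun x => sum_n (fun l => pois l x) i).
  assert (HQ : forall x, 0 <= x -> 0 <= Q x <= 1).
  { intros x Hx. unfold Q. rewrite sum_n_lsum. split.
    - assert (E : forall l : list nat, 0 <= lsum (fun l => pois l x) l).
      { induction l as [|k l IH]; simpl; [lra|]. pose proof (pois_nonneg k x Hx). lra. }
      apply E.
    - apply (has_sum_pois x Hx). apply seq_NoDup. }
  assert (HT : lsum (fun j => pois i (INR (S j) * h)) (seq 0 J)
               <= exp h / h * (Q (INR 1 * h) - Q (INR (S J) * h))).
  { induction J as [|J IH].
    - simpl. rewrite Rminus_diag. lra.
    - rewrite seq_S, lsum_app. cbn [lsum fold_right plus Nat.add].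
      fold (lsum (fun j => pois i (INR (S j) * h)) (seq 0 J)).
      set (x := INR (S J) * h) in *.
      assert (Ex : INR (S (S J)) * h = x + h) by (unfold x; rewrite (S_INR (S J)); ring).
      assert (Hx : 0 <= x) by (apply Rmult_le_pos; [apply pos_INR|lra]).
      rewrite Ex.
      destruct (MVT_cor2 Q (fun t => - pois i t) x (x + h)) as (c & E & Hc); [lra| |].
      { intros c _. apply is_derive_Reals. apply is_derive_pois_sum. }
      assert (P := pois_step h i x c Hx ltac:(lra)).
      assert (E' : exp h / h * (Q x - Q (x + h)) = exp h * pois i c).
      { replace (Q x - Q (x + h)) with (pois i c * h) by lra. field. lra. }
      replace (exp h / h * (Q (INR 1 * h) - Q (x + h))) with
        (exp h / h * (Q (INR 1 * h) - Q x) + exp h / h * (Q x - Q (x + h))) by ring.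
      rewrite E'. simpl Nat.add. fold x. lra. }
  apply Rle_trans with (1 := HT).
  assert (0 < exp h / h) by (apply Rdiv_lt_0_compat; [apply exp_pos|auto]).
  destruct (HQ (INR 1 * h)) as [_ A1]; [simpl; lra|].
  destruct (HQ (INR (S J) * h)) as [A2 _].
  { apply Rmult_le_pos; [apply pos_INR|lra]. }
  nra.
Qed.

(** * Poisson averages over primes and prime powers *)

Lemma lsum_filter {T} (b : T -> bool) (f : T -> R) l :
  lsum f l = lsum f (filter b l) + lsum f (filter (fun x => negb (b x)) l).
Proof.
  induction l as [|x l IH]; simpl; [ring|]. rewrite IH. destruct (b x); simpl; ring.
Qed.

(** Dyadic decomposition. On [(2^J, 2^(J+1)]] Chebyshev's bound gives [sum ln q / q <= ln 4], and
    the Poisson weight is at most [exp h] times its value at the right end, with [h = r ln 2]. The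
    remaining lattice sum of Poisson weights is bounded uniformly in [i]. *)
Lemma prime_pois_sum (r : R) : 0 < r -> exists B, forall i l,
  NoDup l -> (forall q, In q l -> nprime q) ->
  lsum (fun q => ln (INR q) / INR q * pois i (r * ln (INR q))) l <= B.
Proof.
  intros Hr. set (h := r * ln 2).
  assert (Hln2 : 0 < ln 2) by (rewrite <- ln_1; apply ln_increasing; lra).
  assert (Hh : 0 < h) by (unfold h; nra).
  exists (exp h * ln 4 * (exp h / h)). intros i l Hl Hp.
  assert (Hln4 : 0 < ln 4) by (rewrite <- ln_1; apply ln_increasing; lra).
  assert (Hlpos : forall q, 0 <= ln (INR q)) by apply ln_INR_nonneg.
  assert (HJ : forall J l, NoDup l -> (forall q, In q l -> nprime q /\ (q <= 2 ^ J)%nat) ->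
    lsum (fun q => ln (INR q) / INR q * pois i (r * ln (INR q))) l
    <= exp h * ln 4 * lsum (fun j => pois i (INR (S j) * h)) (seq 0 J)).
  { clear l Hl Hp. induction J as [|J IH]; intros l Hl Hp.
    - destruct l as [|q l]; [simpl; lra|]. destruct (Hp q (or_introl eq_refl)) as [H1 H2].
      apply nprime_ge2 in H1. simpl in H2. lia.
    - rewrite (lsum_filter (fun q => Nat.leb q (2 ^ J))), seq_S, lsum_app, Rmult_plus_distr_l.
      apply Rplus_le_compat.
      + apply IH; [now apply NoDup_filter|]. intros q Hq. apply filter_In in Hq.
        destruct Hq as [Hq1 Hq2]. apply Nat.leb_le in Hq2. split; auto. now apply Hp.
      + set (l' := filter (fun q => negb (Nat.leb q (2 ^ J))) l).
        assert (Hl' : NoDup l') by now apply NoDup_filter.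
        assert (Hp' : forall q, In q l' -> nprime q /\ (2 ^ J < q <= 2 ^ J + 2 ^ J)%nat).
        { intros q Hq. apply filter_In in Hq. destruct Hq as [Hq1 Hq2].
          apply Bool.negb_true_iff, Nat.leb_gt in Hq2. destruct (Hp q Hq1) as [H1 H2].
          split; auto. simpl in H2. lia. }
        assert (H2J : (1 <= 2 ^ J)%nat) by (apply pow_pos_nat; lia).
        pose proof (chebyshev _ l' H2J Hl' Hp') as HC.
        assert (H2J' : 0 < INR (2 ^ J)) by (apply lt_0_INR; lia).
        cbn [lsum fold_right]. rewrite Rplus_0_r. simpl Nat.add.
        set (P := pois i (INR (S J) * h)).
        assert (HP : 0 <= P).
        { apply pois_nonneg. apply Rmult_le_pos; [apply pos_INR|lra]. }
        apply Rle_trans with (lsum (fun q => / INR (2 ^ J) * (exp h * P) * ln (INR q)) l').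
        * apply lsum_le. intros q Hq. destruct (Hp' q Hq) as [H1 H2].
          assert (Hq0 : 0 < INR q) by (apply lt_0_INR; lia).
          assert (A1 : / INR q <= / INR (2 ^ J)).
          { apply Rinv_le_contravar; auto. apply le_INR. lia. }
          assert (A2 : pois i (r * ln (INR q)) <= exp h * P).
          { apply pois_step; [apply Rmult_le_pos; auto; lra|].
            assert (B1 : ln (INR (2 ^ J)) <= ln (INR q)) by (apply ln_le; auto; apply le_INR; lia).
            assert (B2 : ln (INR q) <= ln (INR (2 ^ S J))).
            { apply ln_le; auto. apply le_INR. simpl. lia. }
            rewrite ln_pow_nat in B1, B2 by lia. change (INR 2) with 2 in *.
            rewrite S_INR in *. unfold h. split; nra. }
          assert (A3 : 0 <= pois i (r * ln (INR q))).
          { apply pois_nonneg. apply Rmult_le_pos; auto; lra. }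
          assert (A4 : 0 < / INR q) by now apply Rinv_0_lt_compat.
          unfold Rdiv. rewrite Rmult_assoc, Rmult_comm. apply Rmult_le_compat_r; auto.
          apply Rmult_le_compat; lra.
        * rewrite lsum_scal.
          apply Rle_trans with (/ INR (2 ^ J) * (exp h * P) * (INR (2 ^ J) * ln 4)).
          -- apply Rmult_le_compat_l; auto. apply Rmult_le_pos.
             ++ left; now apply Rinv_0_lt_compat.
             ++ apply Rmult_le_pos; auto. left; apply exp_pos.
          -- right. field. lra. }
  assert (Hmax : forall q, In q l -> (q <= 2 ^ list_max l)%nat).
  { intros q Hq.
    pose proof (in_list_max l q Hq) as Q'.
    apply Nat.le_trans with (1 := Q'). apply Nat.lt_le_incl, Nat.pow_gt_lin_r. lia. }
  apply Rle_trans with (1 := HJ (list_max l) l Hl (fun q Hq => conj (Hp q Hq) (Hmax q Hq))).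
  apply Rmult_le_compat_l.
  - apply Rmult_le_pos; [left; apply exp_pos|lra].
  - now apply pois_lattice_sum.
Qed.

(** The Poisson average of the von Mangoldt function with the factor [d(q^k)^a q^(-k)], where
    [d(q^k) = k + 1]; extended by [0] to pairs that stand for no prime power. *)
Definition mangoldt_term (a r : R) (i : nat) (qk : nat * nat) : R :=
  if excluded_middle_informative (nprime (fst qk) /\ (1 <= snd qk)%nat)
  then ln (INR (fst qk)) * Rpower (INR (S (snd qk))) a * (/ INR (fst qk)) ^ snd qk *
       pois i (r * (INR (snd qk) * ln (INR (fst qk))))
  else 0.

Lemma mangoldt_term_nonneg a r i qk : 0 <= r -> 0 <= mangoldt_term a r i qk.
Proof.
  intros Hr. unfold mangoldt_term. destruct excluded_middle_informative as [[H _]|]; [|lra].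
  pose proof (ln_INR_nonneg (fst qk)).
  apply Rmult_le_pos; [apply Rmult_le_pos; [apply Rmult_le_pos; auto|]|].
  - left; apply Rpower_pos.
  - apply pow_le. left. apply Rinv_0_lt_compat, lt_0_INR.
    apply nprime_ge2 in H. lia.
  - apply pois_nonneg. repeat apply Rmult_le_pos; auto. apply pos_INR.
Qed.

Lemma ln_le_sqrt x : 0 < x -> ln x <= 2 * Rpower x (1/2).
Proof. intros Hx. unfold Rpower. generalize (exp_ineq (1/2 * ln x)). lra. Qed.

(** Only the primes themselves ([k = 1]) require the decay of the Poisson weight. The powers with
    [k >= 2] form a convergent series, and there the weight is estimated by [1]. *)
Lemma mangoldt_sum_bounded (a r : R) : 0 <= a -> 0 < r ->
  exists B, 0 <= B /\ forall i, exists v, has_sum (mangoldt_term a r i) v /\ v <= B.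
Proof.
  intros Ha Hr. destruct (prime_pois_sum r Hr) as (B & HB).
  (* For [k >= 2], [q^(-k) <= 4 (1/2)^k q^(-2)] and [ln q <= 2 q^(1/2)]; with growth [(5/4)^k] the
     ratio in [k] is [5/8 < 1] and the sum over [q] is at most the zeta sum at [3/2]. *)
  destruct (Rpower_le_geom a (5/4) Ha) as (K & HK & HKb); [lra|].
  destruct (ndivisors_series_bounds 0 (Rle_refl 0)) as (K0 & _ & HZ).
  destruct (HZ (1/2)) as (Z & HZ1 & _); [lra|]. clear HZ.
  assert (HZ0 : 0 <= Z) by apply (has_sum_ge0 _ _ HZ1).
  assert (HB0 : 0 <= B).
  { specialize (HB 0%nat nil). simpl in HB. apply HB; [constructor|tauto]. }
  exists (Rpower 2 a * B + 8 * K * (/ (1 - 5/8) * Z)).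
  assert (H2a : 0 < Rpower 2 a) by apply Rpower_pos.
  split. { assert (0 < / (1 - 5/8)) by (apply Rinv_0_lt_compat; lra).
    apply Rplus_le_le_0_compat; repeat apply Rmult_le_pos; lra. }
  intros i.
  pose (g := fun q => if excluded_middle_informative (nprime q)
              then ln (INR q) / INR q * pois i (r * ln (INR q)) else 0).
  assert (Hg0 : forall q, 0 <= g q).
  { intros q. unfold g. destruct excluded_middle_informative as [Hq|]; [|lra].
    pose proof (ln_INR_nonneg q). apply Rmult_le_pos; [apply Rmult_le_pos; auto|].
    - left. apply Rinv_0_lt_compat, lt_0_INR. apply nprime_ge2 in Hq. lia.
    - apply pois_nonneg. apply Rmult_le_pos; lra. }
  destruct (has_sum_bounded g B Hg0) as (G & HG & HGB).
  { intros l Hl. pose (b := fun q => if excluded_middle_informative (nprime q) then true else false).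
    rewrite (lsum_filter b).
    assert (E1 : lsum g (filter (fun q => negb (b q)) l) = 0).
    { clear. induction l as [|q l IH]; simpl; [reflexivity|]. unfold b at 1.
      destruct (excluded_middle_informative (nprime q)) as [|n]; simpl; auto.
      rewrite IH. unfold g. destruct excluded_middle_informative; [contradiction|ring]. }
    rewrite E1, Rplus_0_r.
    rewrite (lsum_ext _ (fun q => ln (INR q) / INR q * pois i (r * ln (INR q)))).
    - apply HB; [now apply NoDup_filter|]. intros q Hq. apply filter_In in Hq.
      destruct Hq as [_ Hq]. unfold b in Hq. destruct excluded_middle_informative; auto.
      discriminate.
    - intros q Hq. apply filter_In in Hq. destruct Hq as [_ Hq]. unfold b in Hq. unfold g.
      destruct (excluded_middle_informative (nprime q)); auto. discriminate. }
  pose (f1 := fun qk : nat * nat => if Nat.eqb (snd qk) 1 then g (fst qk) else 0).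
  assert (H1 : has_sum f1 G).
  { apply (has_sum_inj (fun q => (q, 1%nat)) f1).
    - intros x y E. now inversion E.
    - intros [q k]. unfold f1. simpl. destruct (Nat.eqb k 1); [auto|lra].
    - intros [q k]. unfold f1. simpl. destruct (Nat.eqb_spec k 1); [|auto].
      left. exists q. now subst.
    - exact HG. }
  assert (H2 : has_sum (fun qk => gterm 0 (1 + 1/2) (fst qk) * (5/8) ^ snd qk) (Z * / (1 - 5/8))).
  { apply has_sum_mult; auto. apply has_sum_geom. lra. }
  destruct (has_sum_dom (mangoldt_term a r i) (fun qk => Rpower 2 a * f1 qk +
     8 * K * (gterm 0 (1 + 1/2) (fst qk) * (5/8) ^ snd qk))
     (Rpower 2 a * G + 8 * K * (Z * / (1 - 5/8)))) as (v & Hv & Hle).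
  - intros [q k]. split; [apply mangoldt_term_nonneg; lra|].
    unfold mangoldt_term. cbn [fst snd].
    assert (Q2 : 0 <= 8 * K * (gterm 0 (1 + 1/2) q * (5/8) ^ k)).
    { apply Rmult_le_pos; [lra|]. apply Rmult_le_pos; [apply gterm_nonneg|apply pow_le; lra]. }
    assert (Q1 : 0 <= Rpower 2 a * f1 (q, k)).
    { apply Rmult_le_pos; [lra|]. unfold f1; simpl. destruct (Nat.eqb k 1); [auto|lra]. }
    destruct excluded_middle_informative as [[Hq Hk]|]; [|lra].
    pose proof (nprime_ge2 _ Hq) as Hq2.
    assert (Hq0 : 0 < INR q) by (apply lt_0_INR; lia).
    destruct (Nat.eqb_spec k 1) as [->|Hk1].
    + apply Rle_trans with (Rpower 2 a * f1 (q, 1%nat)); [|lra]. right.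
      unfold f1, g; simpl. destruct excluded_middle_informative; [|contradiction].
      replace (1 + 1) with 2 by ring. rewrite Rmult_1_l. field. lra.
    + apply Rle_trans with (8 * K * (gterm 0 (1 + 1/2) q * (5/8) ^ k)); [|lra].
      rewrite gterm0 by lia.
      assert (B1 := ln_le_sqrt (INR q) Hq0). pose proof (ln_INR_nonneg q) as B0.
      assert (B2 := HKb k).
      assert (B3 : (/ INR q) ^ k <= 4 * (1/2) ^ k * Rpower (INR q) (- 2)).
      { destruct k as [|[|k]]; try lia.
        assert (P : / INR q <= 1/2).
        { unfold Rdiv. rewrite Rmult_1_l. apply Rinv_le_contravar; [lra|].
          apply le_INR in Hq2. exact Hq2. }
        assert (P0 : 0 < / INR q) by now apply Rinv_0_lt_compat.
        assert (P1 : (/ INR q) ^ k <= (1/2) ^ k) by (apply pow_incr; lra).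
        assert (P2 : Rpower (INR q) (- 2) = (/ INR q) ^ 2).
        { replace (-2) with (- INR 2) by (simpl; lra). rewrite Rpower_Ropp, Rpower_pow by auto.
          now rewrite pow_inv. }
        rewrite P2. replace ((/ INR q) ^ S (S k)) with ((/ INR q) ^ 2 * (/ INR q) ^ k)
          by (simpl; ring).
        replace (4 * (1/2) ^ S (S k)) with ((1/2) ^ k) by (simpl; field).
        rewrite Rmult_comm. apply Rmult_le_compat_r; auto. apply pow_le; lra. }
      assert (B4 : 0 <= pois i (r * (INR k * ln (INR q))) <= 1).
      { assert (0 <= r * (INR k * ln (INR q))).
        { repeat apply Rmult_le_pos; auto; try lra. apply pos_INR. }
        split; [now apply pois_nonneg|now apply pois_le_1]. }
      set (P := pois i _) in *.
      assert (C1 : 0 <= Rpower (INR (S k)) a) by (left; apply Rpower_pos).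
      assert (C2 : 0 <= (/ INR q) ^ k) by (apply pow_le; left; now apply Rinv_0_lt_compat).
      set (X := ln (INR q) * Rpower (INR (S k)) a * (/ INR q) ^ k).
      assert (HX : X <= 2 * Rpower (INR q) (1/2) * (K * (5/4) ^ k) *
                     (4 * (1/2) ^ k * Rpower (INR q) (- 2))).
      { unfold X. repeat (apply Rmult_le_compat; auto using Rmult_le_pos). }
      assert (HX0 : 0 <= X) by (unfold X; auto using Rmult_le_pos).
      apply Rle_trans with (X * 1); [apply Rmult_le_compat_l; lra|].
      rewrite Rmult_1_r. apply Rle_trans with (1 := HX). right.
      replace (- (1 + 1/2)) with (1/2 + - 2) by field. rewrite Rpower_plus.
      replace (5/8) with (5/4 * (1/2)) by field. rewrite Rpow_mult_distr. ring.
  - apply has_sum_plus; apply has_sum_scal; auto; lra.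
  - exists v. split; auto. apply Rle_trans with (1 := Hle).
    assert (Rpower 2 a * G <= Rpower 2 a * B) by (apply Rmult_le_compat_l; lra). lra.
Qed.

(** * Pointwise bounds for the Poisson averages of [d(n)^a / n] *)

Definition sterm (a r : R) (m n : nat) : R := gterm a 1 n * pois m (r * ln (INR n)).

Lemma sterm_nonneg a r m n : 0 <= r -> 0 <= sterm a r m n.
Proof.
  intros Hr. apply Rmult_le_pos; [apply gterm_nonneg|]. apply pois_nonneg.
  apply Rmult_le_pos; auto. apply ln_INR_nonneg.
Qed.

Lemma gterm_shift a s t n : (1 <= n)%nat ->
  gterm a s n * exp (- (t * ln (INR n))) = gterm a (s + t) n.
Proof.
  intros Hn. rewrite !gterm_pos_eq by auto. rewrite Rmult_assoc. f_equal.
  unfold Rpower. rewrite <- exp_plus. f_equal. ring.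
Qed.

Lemma gterm_submult a s x y : 0 <= a -> (1 <= x)%nat -> (1 <= y)%nat ->
  gterm a s (x * y) <= gterm a s x * gterm a s y.
Proof.
  intros Ha Hx Hy. rewrite !gterm_pos_eq by nia.
  assert (Px : 0 < INR x) by (apply lt_0_INR; lia).
  assert (Py : 0 < INR y) by (apply lt_0_INR; lia).
  assert (Dx : 0 < INR (ndivisors x)) by (apply lt_0_INR, ndivisors_pos; auto).
  assert (Dy : 0 < INR (ndivisors y)) by (apply lt_0_INR, ndivisors_pos; auto).
  assert (Dxy : 0 < INR (ndivisors (x * y))) by (apply lt_0_INR, ndivisors_pos; nia).
  rewrite mult_INR, <- Rpower_mult_distr by auto.
  replace (Rpower (INR (ndivisors x)) a * Rpower (INR x) (- s) *
     (Rpower (INR (ndivisors y)) a * Rpower (INR y) (- s))) with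
    (Rpower (INR (ndivisors x)) a * Rpower (INR (ndivisors y)) a *
     (Rpower (INR x) (- s) * Rpower (INR y) (- s))) by ring.
  rewrite (Rpower_mult_distr (INR (ndivisors x))) by auto. apply Rmult_le_compat_r.
  - apply Rmult_le_pos; left; apply Rpower_pos.
  - apply Rpower_base_le; auto. rewrite <- mult_INR. apply le_INR.
    now apply ndivisors_submult.
Qed.

Lemma gterm_prime_pow a q k : nprime q ->
  gterm a 1 (q ^ k) = Rpower (INR (S k)) a * (/ INR q) ^ k.
Proof.
  intros Hq. pose proof (nprime_ge2 _ Hq).
  assert (Hq0 : 0 < INR q) by (apply lt_0_INR; lia).
  rewrite gterm_pos_eq by (apply pow_pos_nat; lia).
  replace (ndivisors (q ^ k)) with (S k).
  - f_equal. rewrite Rpower_Ropp, pow_INR, pow_inv. f_equal.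
    rewrite Rpower_1; auto. now apply pow_lt.
  - rewrite <- (Nat.mul_1_r (q ^ k)), ndivisors_prime_part; auto.
    + change (ndivisors 1) with 1%nat. lia.
    + intros D. apply Nat.divide_1_r in D. lia.
Qed.

Lemma has_sum_lsum {T U} (f : U -> T -> R) (g : U -> R) l :
  (forall i, In i l -> has_sum (f i) (g i)) ->
  has_sum (fun x => lsum (fun i => f i x) l) (lsum g l).
Proof.
  induction l as [|i l IH]; intros H; simpl; [apply has_sum_zero|].
  apply has_sum_plus; [apply H; now left|]. apply IH. intros; apply H; now right.
Qed.

(* Differentiating the Dirichlet series: [ln n <= sum_(q^k | n) ln q] and the
   submultiplicativity of [ndivisors] bound the coefficients of the derivative by a
   Dirichlet convolution. *)
Lemma sterm_recurrence (a r : R) (m : nat) (B : R) (S : nat -> R) :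
  0 <= a -> 0 < r ->
  (forall i, exists v, has_sum (mangoldt_term a r i) v /\ v <= B) ->
  (forall i, has_sum (sterm a r i) (S i)) ->
  INR (Datatypes.S m) * S (Datatypes.S m) <= r * B * lsum S (seq 0 (Datatypes.S m)).
Proof.
  intros Ha Hr HB HS.
  pose (Lam := fun i => tsum (mangoldt_term a r i)).
  assert (HL : forall i, has_sum (mangoldt_term a r i) (Lam i) /\ Lam i <= B).
  { intros i. destruct (HB i) as (v & Hv & Hle). unfold Lam. now rewrite (tsum_eq _ _ Hv). }
  (* A double convolution: additive in the Poisson index through [i], multiplicative through
     [t = ((q, k), M)] with product [q^k M], whose fibers are collected next. *)
  pose (F := fun t : (nat * nat) * nat =>
    lsum (fun i => mangoldt_term a r i (fst t) * sterm a r (m - i) (snd t)) (seq 0 (Datatypes.S m))).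
  assert (HF : has_sum F (lsum (fun i => Lam i * S (m - i)%nat) (seq 0 (Datatypes.S m)))).
  { unfold F. apply (has_sum_lsum (fun i t => mangoldt_term a r i (fst t) * sterm a r (m - i) (snd t))).
    intros i _. apply has_sum_mult; auto. apply HL. }
  set (v := lsum (fun i => Lam i * S (m - i)%nat) _) in HF.
  destruct (has_sum_fiber (fun t : (nat * nat) * nat => (fst (fst t) ^ snd (fst t) * snd t)%nat) F v HF)
    as (g & Hg & Hgv).
  assert (HF0 : forall t, 0 <= F t) by (intros; apply HF).
  assert (Hmain : INR (Datatypes.S m) * S (Datatypes.S m) <= r * v).
  { apply (has_sum_le (fun n => INR (Datatypes.S m) * sterm a r (Datatypes.S m) n)
      (fun n => r * g n)).
    - intros n. destruct n as [|n].
      { unfold sterm. change (gterm a 1 0) with 0. rewrite Rmult_0_l, Rmult_0_r.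
        apply Rmult_le_pos; [lra|]. apply (has_sum_pos _ _ 0%nat Hgv). }
      set (N := Datatypes.S n). assert (HN : (1 <= N)%nat) by (unfold N; lia).
      clearbody N. clear n.
      destruct (ln_von_Mangoldt N HN) as (L & HLd & HL1 & HL2).
      unfold sterm.
      replace (INR (Datatypes.S m) * (gterm a 1 N * pois (Datatypes.S m) (r * ln (INR N)))) with
        (gterm a 1 N * (INR (Datatypes.S m) * pois (Datatypes.S m) (r * ln (INR N)))) by ring.
      (* [pois_S] releases a factor [r ln N], the trace of the derivative. It alone is expanded over
         prime powers; the argument of the Poisson weight keeps [ln N]. *)
      rewrite pois_S, HL2 at 1.
      replace (gterm a 1 N * (r * lsum (fun qk => ln (INR (fst qk))) L * pois m (r * ln (INR N))))
        with (r * (gterm a 1 N * pois m (r * ln (INR N)) * lsum (fun qk => ln (INR (fst qk))) L))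
        by ring.
      apply Rmult_le_compat_l; [lra|]. rewrite <- lsum_scal.
      pose (e := fun qk : nat * nat => (qk, (N / (fst qk ^ snd qk))%nat)).
      apply Rle_trans with (lsum (fun t : (nat * nat) * nat =>
         if excluded_middle_informative (N = (fst (fst t) ^ snd (fst t) * snd t)%nat)
         then F t else 0) (map e L)).
      2:{ apply (Hg N). apply NoDup_map_NoDup_ForallPairs; auto.
          intros x y _ _ E. now inversion E. }
      rewrite lsum_map. apply lsum_le. intros [q k] Hqk.
      destruct (HL1 q k Hqk) as (Hq & Hk & [M HM]).
      pose proof (nprime_ge2 _ Hq) as Hq2.
      pose proof (pow_pos_nat q k ltac:(lia)) as Hqk1.
      unfold e; cbn [fst snd].
      assert (EM : (N / q ^ k)%nat = M) by (rewrite HM; apply Nat.div_mul; lia).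
      rewrite EM. destruct excluded_middle_informative as [_|n]; [|exfalso; apply n; lia].
      assert (HM1 : (1 <= M)%nat) by nia.
      assert (EN : N = (q ^ k * M)%nat) by lia.
      assert (Eln : ln (INR N) = INR k * ln (INR q) + ln (INR M)).
      { rewrite EN, mult_INR, ln_mult by (apply lt_0_INR; lia). now rewrite ln_pow_nat by lia. }
      assert (EF : F ((q, k), M) = ln (INR q) * gterm a 1 (q ^ k) * gterm a 1 M * pois m (r * ln (INR N))).
      { rewrite Eln, Rmult_plus_distr_l, pois_plus, <- lsum_scal. unfold F.
        apply lsum_ext. intros i _. unfold mangoldt_term, sterm. cbn [fst snd].
        destruct excluded_middle_informative as [_|n]; [|tauto].
        rewrite gterm_prime_pow by auto. ring. }
      rewrite EF.
      assert (P0 : 0 <= pois m (r * ln (INR N))).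
      { apply pois_nonneg, Rmult_le_pos; [lra|apply ln_INR_nonneg]. }
      pose proof (ln_INR_nonneg q).
      assert (P1 : gterm a 1 N <= gterm a 1 (q ^ k) * gterm a 1 M).
      { rewrite EN. now apply gterm_submult. }
      replace (ln (INR q) * gterm a 1 (q ^ k) * gterm a 1 M * pois m (r * ln (INR N)))
        with (gterm a 1 (q ^ k) * gterm a 1 M * pois m (r * ln (INR N)) * ln (INR q)) by ring.
      apply Rmult_le_compat_r; auto. apply Rmult_le_compat_r; auto.
    - apply has_sum_scal; [apply pos_INR|apply HS].
    - apply has_sum_scal; [lra|auto]. }
  apply Rle_trans with (1 := Hmain). rewrite Rmult_assoc. apply Rmult_le_compat_l; [lra|].
  unfold v. apply Rle_trans with (lsum (fun i => B * S (m - i)%nat) (seq 0 (Datatypes.S m))).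
  - apply lsum_le. intros i _. apply Rmult_le_compat_r; [apply (has_sum_ge0 _ _ (HS _))|apply HL].
  - rewrite lsum_scal. apply Rmult_le_compat_l.
    + destruct (HL 0%nat) as [A1 A2]. apply has_sum_ge0 in A1. lra.
    + apply lsum_rev. intros i. apply (has_sum_ge0 _ _ (HS i)).
Qed.

(** Summed against [z^m] the Poisson weight becomes [n^(- r (1 - z))], so the Abel sum of the
    averages is the divisor series at [s + r (1 - z)]. With [s = 1], letting [z] approach [1] probes
    the pole. *)
Lemma pois_generating (a s r z : R) v : 0 < r -> 0 < z < 1 ->
  has_sum (gterm a (s + r * (1 - z))) v ->
  exists S, (forall m, has_sum (fun n => gterm a s n * pois m (r * ln (INR n))) (S m)) /\
            has_sum (fun m => z ^ m * S m) v.
Proof.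
  intros Hr Hz Hv.
  destruct (has_sum_swap (fun n m => z ^ m * (gterm a s n * pois m (r * ln (INR n))))
    (gterm a (s + r * (1 - z))) v) as (T & HT & HTv); auto.
  - intros n. destruct n as [|n].
    + apply has_sum_ext with (fun _ => 0); [intros; simpl; ring|apply has_sum_zero].
    + rewrite <- gterm_shift by lia.
      apply has_sum_ext with (fun m => gterm a s (S n) * (z ^ m * pois m (r * ln (INR (S n)))));
        [intros; ring|].
      apply has_sum_scal; [apply gterm_nonneg|].
      replace (- (r * (1 - z) * ln (INR (S n)))) with (- ((1 - z) * (r * ln (INR (S n))))) by ring.
      apply has_sum_pois_pow; [lra|]. apply Rmult_le_pos; [lra|apply ln_INR_nonneg].
  - assert (Hzm : forall m, 0 < z ^ m) by (intros; apply pow_lt; lra).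
    exists (fun m => / z ^ m * T m). split.
    + intros m. specialize (Hzm m).
      apply has_sum_ext with (fun n => / z ^ m * (z ^ m * (gterm a s n * pois m (r * ln (INR n))))).
      { intros n. field. lra. }
      apply has_sum_scal; [left; now apply Rinv_0_lt_compat|apply HT].
    + apply has_sum_ext with T; auto. intros m. specialize (Hzm m). field. lra.
Qed.

(** The partial sum up to [M] is read off from an Abel sum with [1 - z] of order [1/(M+1)]; the
    recurrence turns it into a bound of one average, a power of [m] smaller. *)
Lemma sterm_sum_bound (a r : R) : 0 <= a -> 0 < r ->
  exists K S, 0 < K /\ forall m, has_sum (sterm a r m) (S m) /\
    S m <= K * Rpower (INR (Datatypes.S m)) (Rpower 2 a - 1).
Proof.
  intros Ha Hr. set (A := Rpower 2 a).
  assert (HA : 1 <= A).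
  { unfold A. rewrite <- (Rpower_O 2) by lra. apply Rle_Rpower; lra. }
  destruct (ndivisors_series_bounds a Ha) as (C & HC & HG). fold A in HG.
  destruct (mangoldt_sum_bounded a r Ha Hr) as (B & HB0 & HB).
  (* With [w = 1/(k (M+1))] this choice gives [w <= 1/2], keeps [r w <= 1] in the range of the
     series bound, and makes [M w <= 1/2], so that [z^M >= 1/2] by Bernoulli's inequality. *)
  set (k := r + 2).
  pose (S := fun m => tsum (sterm a r m)).
  (* [z = 1 - 1 / (k (M + 1))] *)
  assert (Hz : forall M, exists z v, 0 < z < 1 /\ 1/2 <= z ^ M /\
     has_sum (gterm a (1 + r * (1 - z))) v /\ v <= C * Rpower (k / r) A * Rpower (INR (Datatypes.S M)) A).
  { intros M. assert (HM : 1 <= INR (Datatypes.S M)) by (rewrite S_INR; generalize (pos_INR M); lra).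
    assert (Hk : 2 <= k) by (unfold k; lra).
    set (w := / (k * INR (Datatypes.S M))).
    assert (Hw : 0 < w <= 1/2).
    { unfold w. split; [apply Rinv_0_lt_compat; nra|].
      unfold Rdiv. rewrite Rmult_1_l. apply Rinv_le_contravar; nra. }
    assert (Hw1 : w * k * INR (Datatypes.S M) = 1) by (unfold w; field; split; nra).
    destruct (HG (r * w)) as (v & Hv & _ & Hle).
    { split; [nra|]. assert (r * w <= k * w) by (apply Rmult_le_compat_r; unfold k; lra). nra. }
    exists (1 - w), v. split; [lra|]. split; [|split].
    - assert (Hb : 1 - INR M * w <= (1 - w) ^ M).
      { clearbody w. clear - Hw. induction M as [|M IH]; [simpl; lra|]. rewrite S_INR.
        change ((1 - w) ^ Datatypes.S M) with ((1 - w) * (1 - w) ^ M).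
        pose proof (pos_INR M).
        assert ((1 - w) * (1 - INR M * w) <= (1 - w) * (1 - w) ^ M)
          by (apply Rmult_le_compat_l; lra).
        assert (0 <= INR M * (w * w)) by (repeat apply Rmult_le_pos; lra). nra. }
      assert (INR M * w <= 1/2); [|lra]. rewrite S_INR in Hw1. pose proof (pos_INR M). nra.
    - now replace (1 - (1 - w)) with w by ring.
    - apply Rle_trans with (1 := Hle). right. rewrite Rmult_assoc. f_equal.
      rewrite Rpower_mult_distr by (try apply Rdiv_lt_0_compat; lra).
      replace (k / r * INR (Datatypes.S M)) with (/ (r * w)) by (unfold w; field; repeat split; nra).
      unfold Rpower. rewrite ln_Rinv by nra. f_equal. ring. }
  assert (HS : forall m, has_sum (sterm a r m) (S m)).
  { intros m. destruct (Hz 0%nat) as (z & v & Hz1 & _ & Hv & _).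
    destruct (pois_generating a 1 r z v Hr Hz1 Hv) as (S' & H1 & _).
    apply (has_sum_tsum _ _ (H1 m)). }
  set (D := 2 * (C * Rpower (k / r) A)).
  assert (HD : 0 < D).
  { unfold D. repeat apply Rmult_lt_0_compat; try lra. apply Rpower_pos. }
  assert (HSum : forall M, lsum S (seq 0 (Datatypes.S M)) <= D * Rpower (INR (Datatypes.S M)) A).
  { intros M. destruct (Hz M) as (z & v & Hz1 & HzM & Hv & Hle).
    destruct (pois_generating a 1 r z v Hr Hz1 Hv) as (S' & H1 & H2).
    assert (ES : forall m, S' m = S m)
      by (intros m; symmetry; apply (tsum_eq (sterm a r m)), H1).
    assert (H3 : lsum (fun m => z ^ M * S m) (seq 0 (Datatypes.S M)) <= v).
    { apply Rle_trans with (lsum (fun m => z ^ m * S' m) (seq 0 (Datatypes.S M))).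
      - apply lsum_le. intros m Hm. apply in_seq in Hm. rewrite ES.
        apply Rmult_le_compat_r; [apply (has_sum_ge0 _ _ (HS m))|].
        assert (EM : M = (m + (M - m))%nat) by (clear - Hm; lia). rewrite EM at 1. rewrite pow_add.
        assert (0 < z ^ m) by (apply pow_lt; lra).
        assert (z ^ (M - m) <= 1) by (rewrite <- (pow1 (M - m)); apply pow_incr; lra). nra.
      - apply H2, seq_NoDup. }
    rewrite lsum_scal in H3.
    assert (0 <= lsum S (seq 0 (Datatypes.S M))).
    { apply lsum_nonneg. intros m. apply (has_sum_ge0 _ _ (HS m)). }
    unfold D. nra. }
  clearbody D. exists (D + r * B * D), S. split; [assert (0 <= r * B * D); [|lra];
    repeat apply Rmult_le_pos; lra|].
  assert (HrBD : 0 <= r * B * D) by (repeat apply Rmult_le_pos; lra).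
  (* The recurrence speaks of indices from [1] on; the average of index [0] is itself a partial
     sum. *)
  intros m. split; auto. destruct m as [|m].
  - specialize (HSum 0%nat). simpl in *. rewrite Rpower_one in *. lra.
  - pose proof (sterm_recurrence a r m B S Ha Hr HB HS) as HR.
    set (u := INR (Datatypes.S m)) in *.
    assert (Hu : 1 <= u) by (unfold u; rewrite S_INR; generalize (pos_INR m); lra).
    assert (H1 : u * S (Datatypes.S m) <= r * B * (D * Rpower u A)).
    { apply Rle_trans with (1 := HR). apply Rmult_le_compat_l; [nra|apply HSum]. }
    assert (Eu : Rpower u A = u * Rpower u (A - 1)).
    { rewrite <- (Rpower_1 u) at 2 by lra. rewrite <- Rpower_plus. f_equal. ring. }
    rewrite Eu in H1.
    assert (H2 : S (Datatypes.S m) <= r * B * D * Rpower u (A - 1)).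
    { apply Rmult_le_reg_l with u; [lra|]. apply Rle_trans with (1 := H1). right; ring. }
    apply Rle_trans with (1 := H2).
    assert (H3 : Rpower u (A - 1) <= Rpower (INR (Datatypes.S (Datatypes.S m))) (A - 1)).
    { apply Rpower_base_le; try lra. rewrite (S_INR (Datatypes.S m)). fold u. lra. }
    pose proof (Rpower_pos u (A - 1)).
    apply Rmult_le_compat; lra.
Qed.

(** * Sums of squared binomial probabilities *)

(** Midpoint and trapezoid rules for the integral of the convex function [1/t] over [[1, 1+x]]; each
    difference has an explicitly nonnegative derivative. *)
Lemma ln_1p_bounds x : 0 < x ->
  2 * x / (2 + x) <= ln (1 + x) <= x / 2 + x / (2 * (1 + x)).
Proof.
  intros Hx. split.
  - destruct (MVT_cor2 (fun t => ln (1 + t) - 2 * t / (2 + t))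
      (fun t => t ^ 2 / ((1 + t) * (2 + t) ^ 2)) 0 x Hx) as (c & E & Hc).
    + intros c Hc. apply is_derive_Reals. auto_derive; [lra|]. field. lra.
    + rewrite Rplus_0_r, ln_1 in E.
      assert (0 <= c ^ 2 / ((1 + c) * (2 + c) ^ 2)).
      { apply Rmult_le_pos; [nra|]. left. apply Rinv_0_lt_compat. nra. }
      replace (2 * 0 / (2 + 0)) with 0 in E by field. nra.
  - destruct (MVT_cor2 (fun t => t / 2 + t / (2 * (1 + t)) - ln (1 + t))
      (fun t => t ^ 2 / (2 * (1 + t) ^ 2)) 0 x Hx) as (c & E & Hc).
    + intros c Hc. apply is_derive_Reals. auto_derive; [lra|]. field. lra.
    + rewrite Rplus_0_r, ln_1 in E.
      assert (0 <= c ^ 2 / (2 * (1 + c) ^ 2)).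
      { apply Rmult_le_pos; [nra|]. left. apply Rinv_0_lt_compat. nra. }
      replace (0 / 2 + 0 / (2 * 1)) with 0 in E by field. nra.
Qed.

(** By the midpoint and trapezoid bounds at [x = 1/u], the error in Stirling's formula decreases in
    [u], and by at most [1/(4u) - 1/(4(u+1))] per step. It starts at [1], so it stays between [3/4]
    and [1]. *)
Lemma stirling_ln n :
  3/4 + / (4 * INR (S n)) <=
  ln (INR (fact (S n))) - (INR (S n) * ln (INR (S n)) - INR (S n) + 1/2 * ln (INR (S n))) <= 1.
Proof.
  induction n as [|n [I1 I2]].
  - simpl. rewrite ln_1. lra.
  - set (u := INR (S n)) in *.
    assert (Hu : 1 <= u) by (unfold u; rewrite S_INR; generalize (pos_INR n); lra).
    rewrite (S_INR (S n)). fold u.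
    change (fact (S (S n))) with (S (S n) * fact (S n))%nat.
    rewrite mult_INR, ln_mult by (try apply INR_fact_lt_0; apply lt_0_INR; lia).
    rewrite (S_INR (S n)). fold u.
    destruct (ln_1p_bounds (/ u)) as [B1 B2]; [apply Rinv_0_lt_compat; lra|].
    assert (E : ln (u + 1) = ln u + ln (1 + / u)).
    { rewrite <- ln_mult; [f_equal; field; lra|lra|].
      assert (0 < / u) by (apply Rinv_0_lt_compat; lra). lra. }
    rewrite E. set (L := ln (1 + / u)) in *.
    replace (2 * / u / (2 + / u)) with (/ (u + 1/2)) in B1 by (field; lra).
    replace (/ u / 2 + / u / (2 * (1 + / u))) with (/2 * (/ u + / (u + 1))) in B2
      by (field; lra).
    assert (C1 : 1 <= (u + 1/2) * L).
    { apply Rmult_le_compat_l with (r := u + 1/2) in B1; [|lra]. rewrite Rinv_r in B1; lra. }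
    assert (C2 : (u + 1/2) * L <= 1 + / (4 * u) - / (4 * (u + 1))).
    { apply Rmult_le_compat_l with (r := u + 1/2) in B2; [|lra].
      apply Rle_trans with (1 := B2). right. field. lra. }
    lra.
Qed.

(** The function [u^k exp (- u)] is largest at [u = k]; for [k >= 1] this is the [k]-th power of
    [u/k <= exp (u/k - 1)]. *)
Lemma pow_le_exp (u : R) k : 0 <= u -> u ^ k <= INR k ^ k * exp (u - INR k).
Proof.
  intros Hu. destruct k as [|k].
  - simpl. rewrite Rminus_0_r. generalize (exp_ineq u). lra.
  - set (v := INR (S k)). assert (Hv : 0 < v) by (apply lt_0_INR; lia).
    assert (H : u <= v * exp (u / v - 1)).
    { generalize (exp_ineq (u / v - 1)). intros H. apply Rle_trans with (v * (u / v)).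
      - right; field; lra.
      - apply Rmult_le_compat_l; lra. }
    apply Rle_trans with ((v * exp (u / v - 1)) ^ S k).
    + apply pow_incr. lra.
    + rewrite Rpow_mult_distr. apply Rmult_le_compat_l; [apply pow_le; lra|].
      right. rewrite <- Rpower_pow by apply exp_pos. fold v. unfold Rpower.
      rewrite ln_exp. f_equal. field. lra.
Qed.

(** The weight [pois k] peaks at [u = k], where Stirling's formula gives the size [1/sqrt k]. The
    shift to [k + 1] under the root includes [k = 0]. *)
Lemma pois_le_sqrt : exists K, 0 < K /\
  (forall k u, 0 <= u -> pois k u <= K / sqrt (INR (S k))) /\
  (forall k, / K / sqrt (INR (S k)) <= pois k (INR k)).
Proof.
  (* [4] exceeds both [2], the loss from [sqrt (k+2)] to [sqrt (k+1)] in the upper bound, and [e],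
     the Stirling constant in the lower bound. *)
  exists 4. split; [lra|].
  assert (S4 : sqrt 4 = 2) by (replace 4 with (2 * 2) by ring; apply sqrt_square; lra).
  assert (HS : forall k, exp (3/4) * INR (S k) ^ S k * exp (- INR (S k)) * sqrt (INR (S k))
     <= INR (fact (S k)) <= exp 1 * INR (S k) ^ S k * exp (- INR (S k)) * sqrt (INR (S k))).
  { intros k. destruct (stirling_ln k) as [H1 H2].
    set (u := INR (S k)) in *.
    assert (Hu : 0 < u) by (apply lt_0_INR; lia).
    assert (E : u ^ S k * exp (- u) * sqrt u = exp (u * ln u - u + 1/2 * ln u)).
    { rewrite <- (Rpower_pow (S k)) by auto. fold u. rewrite <- Rpower_sqrt by auto.
      unfold Rpower. rewrite <- !exp_plus. f_equal. field. }
    rewrite !Rmult_assoc. rewrite <- (Rmult_assoc (u ^ S k)), E.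
    rewrite <- !exp_plus. rewrite <- (exp_ln (INR (fact (S k)))) by apply INR_fact_lt_0.
    assert (0 < / (4 * u)) by (apply Rinv_0_lt_compat; lra).
    split; apply exp_le_compat; lra. }
  assert (Hsq : forall k, 0 < sqrt (INR (S k))) by (intros; apply sqrt_lt_R0, lt_0_INR; lia).
  assert (He : exp 1 <= 3) by apply exp_le_3.
  assert (Hsq2 : forall k, sqrt (INR (S (S k))) <= 2 * sqrt (INR (S k))).
  { intros k. rewrite <- S4, <- sqrt_mult by (try apply pos_INR; lra).
    apply sqrt_le_1_alt. rewrite (S_INR (S k)), (S_INR k). generalize (pos_INR k); lra. }
  split.
  - intros k u Hu. destruct k as [|k].
    + simpl. rewrite sqrt_1. apply Rle_trans with 1; [now apply pois_le_1|lra].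
    + unfold pois. pose proof (pow_le_exp u (S k) Hu) as HP.
      destruct (HS k) as [H1 _]. specialize (Hsq2 k).
      pose proof (Hsq k). pose proof (Hsq (S k)).
      assert (F0 : 0 < INR (fact (S k))) by apply INR_fact_lt_0.
      apply Rmult_le_reg_r with (INR (fact (S k))); auto.
      replace (exp (- u) * (u ^ S k / INR (fact (S k))) * INR (fact (S k)))
        with (exp (- u) * u ^ S k) by (field; lra).
      apply Rle_trans with (exp (- INR (S k)) * INR (S k) ^ S k).
      * apply Rle_trans with (exp (- u) * (INR (S k) ^ S k * exp (u - INR (S k)))).
        -- apply Rmult_le_compat_l; auto. left; apply exp_pos.
        -- right. replace (exp (- INR (S k))) with (exp (- u) * exp (u - INR (S k)))
             by (rewrite <- exp_plus; f_equal; ring). ring.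
      * apply Rle_trans with (4 / sqrt (INR (S (S k))) *
          (exp (3/4) * INR (S k) ^ S k * exp (- INR (S k)) * sqrt (INR (S k)))).
        2:{ apply Rmult_le_compat_l; auto. left. apply Rdiv_lt_0_compat; lra. }
        set (X := exp (- INR (S k)) * INR (S k) ^ S k).
        assert (HX : 0 <= X).
        { apply Rmult_le_pos; [left; apply exp_pos|apply pow_le, pos_INR]. }
        replace (4 / sqrt (INR (S (S k))) *
          (exp (3/4) * INR (S k) ^ S k * exp (- INR (S k)) * sqrt (INR (S k))))
          with (X * (exp (3/4) * (4 * sqrt (INR (S k)) / sqrt (INR (S (S k))))))
          by (unfold X; field; lra).
        assert (1 <= exp (3/4)) by (generalize (exp_ineq (3/4)); lra).
        assert (1 <= 4 * sqrt (INR (S k)) / sqrt (INR (S (S k)))).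
        { apply Rmult_le_reg_r with (sqrt (INR (S (S k)))); auto.
          unfold Rdiv. rewrite Rmult_assoc, Rinv_l by lra. lra. }
        rewrite <- (Rmult_1_r X) at 1. apply Rmult_le_compat_l; auto. nra.
  - intros k. destruct k as [|k].
    + simpl. rewrite sqrt_1. unfold pois. simpl. rewrite Ropp_0, exp_0. lra.
    + unfold pois. destruct (HS k) as [_ H2].
      pose proof (Hsq k). pose proof (Hsq (S k)).
      assert (F0 : 0 < INR (fact (S k))) by apply INR_fact_lt_0.
      apply Rmult_le_reg_r with (INR (fact (S k))); auto.
      replace (exp (- INR (S k)) * (INR (S k) ^ S k / INR (fact (S k))) * INR (fact (S k)))
        with (exp (- INR (S k)) * INR (S k) ^ S k) by (field; lra).
      apply Rle_trans with (/ 4 / sqrt (INR (S (S k))) *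
        (exp 1 * INR (S k) ^ S k * exp (- INR (S k)) * sqrt (INR (S k)))).
      { apply Rmult_le_compat_l; auto. left.
        apply Rdiv_lt_0_compat; lra. }
      set (X := exp (- INR (S k)) * INR (S k) ^ S k).
      assert (HX : 0 <= X).
      { apply Rmult_le_pos; [left; apply exp_pos|apply pow_le, pos_INR]. }
      replace (/ 4 / sqrt (INR (S (S k))) *
        (exp 1 * INR (S k) ^ S k * exp (- INR (S k)) * sqrt (INR (S k))))
        with (X * (exp 1 / 4 * (sqrt (INR (S k)) / sqrt (INR (S (S k))))))
        by (unfold X; field; lra).
      assert (sqrt (INR (S k)) / sqrt (INR (S (S k))) <= 1).
      { apply Rmult_le_reg_r with (sqrt (INR (S (S k)))); auto.
        unfold Rdiv. rewrite Rmult_assoc, Rinv_l by lra. rewrite Rmult_1_r, Rmult_1_l.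
        apply sqrt_le_1_alt, le_INR. lia. }
      assert (0 <= sqrt (INR (S k)) / sqrt (INR (S (S k)))).
      { left. now apply Rdiv_lt_0_compat. }
      pose proof (exp_pos 1).
      rewrite <- (Rmult_1_r X) at 2. apply Rmult_le_compat_l; auto. nra.
Qed.

(** * Binomial probabilities: conditioning, variance, inverse moments *)

Definition bern (q : R) (m k : nat) : R := INR (binom m k) * q ^ k * (1 - q) ^ (m - k).

Lemma binom_gt m k : (m < k)%nat -> binom m k = 0%nat.
Proof.
  revert k; induction m as [|m IH]; intros [|k] H; simpl; auto; try lia.
  rewrite !IH; lia.
Qed.

Lemma bern_nonneg q m k : 0 <= q <= 1 -> 0 <= bern q m k.
Proof.
  intros H. unfold bern. repeat apply Rmult_le_pos; try apply pow_le; try lra. apply pos_INR.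
Qed.

Lemma bern_fact q m k : (k <= m)%nat ->
  bern q m k = INR (fact m) / (INR (fact k) * INR (fact (m - k))) * (q ^ k * (1 - q) ^ (m - k)).
Proof.
  intros H. unfold bern. pose proof (binom_fact (m - k) k) as E.
  replace (m - k + k)%nat with m in E by lia. apply (f_equal INR) in E.
  rewrite !mult_INR in E. rewrite <- E. field. split; apply INR_fact_neq_0.
Qed.

(** Two independent Poisson variables conditioned on their total follow a binomial law; this
    transfers the bounds for [pois] to [bern]. *)
Lemma bern_pois q m k : 0 <= q <= 1 -> (k <= m)%nat ->
  bern q m k * pois m (INR m) = pois k (INR m * q) * pois (m - k) (INR m * (1 - q)).
Proof.
  intros Hq H. rewrite bern_fact by auto. unfold pois.
  replace (exp (- INR m)) with (exp (- (INR m * q)) * exp (- (INR m * (1 - q))))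
    by (rewrite <- exp_plus; f_equal; ring).
  rewrite !Rpow_mult_distr.
  assert (E : INR m ^ m = INR m ^ k * INR m ^ (m - k)).
  { rewrite <- pow_add. f_equal. lia. }
  rewrite E. field. repeat split; apply INR_fact_neq_0.
Qed.

Lemma bern_sym q m k : (k <= m)%nat -> bern q m k = bern (1 - q) m (m - k).
Proof.
  intros H. rewrite !bern_fact by lia. replace (m - (m - k))%nat with k by lia.
  replace (1 - (1 - q)) with q by ring. field. split; apply INR_fact_neq_0.
Qed.

(** A factor [(m+1)/(k+1)] is traded for a shift of both indices; this drives the inverse
    moments. *)
Lemma bern_SS q m k : (k <= m)%nat ->
  INR (S k) * bern q (S m) (S k) = INR (S m) * q * bern q m k.
Proof.
  intros H. rewrite !bern_fact by lia. replace (S m - S k)%nat with (m - k)%nat by lia.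
  change (fact (S m)) with (S m * fact m)%nat. change (fact (S k)) with (S k * fact k)%nat.
  rewrite !mult_INR. simpl pow. field.
  repeat split; try apply INR_fact_neq_0. apply not_0_INR; lia.
Qed.

Definition bmean (q : R) (m : nat) (f : nat -> R) : R :=
  lsum (fun k => bern q m k * f k) (seq 0 (S m)).

(** Conditioning on one trial, by Pascal's rule. Total mass and variance follow from it by induction
    on [m]. *)
Lemma bmean_S q m f :
  bmean q (S m) f = q * bmean q m (fun k => f (S k)) + (1 - q) * bmean q m f.
Proof.
  assert (B : forall k, bern q (S m) (S k) = q * bern q m k + (1 - q) * bern q m (S k)).
  { intros k. unfold bern. cbn [binom]. rewrite plus_INR.
    replace (S m - S k)%nat with (m - k)%nat by lia.
    destruct (le_lt_dec (S k) m) as [H|H].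
    - replace (m - k)%nat with (S (m - S k)) by lia. simpl pow. ring.
    - rewrite (binom_gt m (S k)) by lia. simpl. ring. }
  unfold bmean. rewrite <- !lsum_scal.
  change (seq 0 (S (S m))) with (0%nat :: seq 1 (S m)). cbn [lsum fold_right].
  fold (lsum (fun k => bern q (S m) k * f k) (seq 1 (S m))).
  rewrite <- seq_shift, lsum_map.
  rewrite (lsum_ext _ (fun k => q * (bern q m k * f (S k)) + (1 - q) * (bern q m (S k) * f (S k)))).
  2:{ intros k _. rewrite B. ring. }
  rewrite lsum_plus.
  assert (E : bern q (S m) 0 * f 0%nat +
     lsum (fun k => (1 - q) * (bern q m (S k) * f (S k))) (seq 0 (S m))
     = lsum (fun k => (1 - q) * (bern q m k * f k)) (seq 0 (S (S m)))).
  { change (seq 0 (S (S m))) with (0%nat :: seq 1 (S m)).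
    rewrite <- (seq_shift (S m) 0).
    cbn [lsum fold_right].
    fold (lsum (fun k => (1 - q) * (bern q m k * f k)) (map S (seq 0 (S m)))).
    rewrite lsum_map. unfold bern at 1. simpl binom.
    replace (bern q m 0) with ((1 - q) ^ m).
    2:{ unfold bern. rewrite Nat.sub_0_r. destruct m; simpl; ring. }
    rewrite Nat.sub_0_r. simpl. ring. }
  rewrite (seq_S (S m) 0), lsum_app in E. cbn [lsum fold_right Nat.add] in E.
  fold (lsum (fun k => (1 - q) * (bern q m k * f k)) (seq 0 (S m))) in E.
  assert (Z : bern q m (S m) = 0).
  { unfold bern. rewrite binom_gt by lia. simpl. ring. }
  rewrite Z in E. fold (lsum (fun k => (1 - q) * (bern q m (S k) * f (S k))) (seq 0 (S m))) in E.
  lra.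
Qed.

Lemma bmean_plus q m f g : bmean q m (fun k => f k + g k) = bmean q m f + bmean q m g.
Proof.
  unfold bmean. rewrite <- lsum_plus. apply lsum_ext. intros; ring.
Qed.

Lemma bmean_scal q m c f : bmean q m (fun k => c * f k) = c * bmean q m f.
Proof.
  unfold bmean. rewrite <- lsum_scal. apply lsum_ext. intros; ring.
Qed.

Lemma bmean_ext q m f g : (forall k, (k <= m)%nat -> f k = g k) -> bmean q m f = bmean q m g.
Proof.
  intros H. apply lsum_ext. intros k Hk. apply in_seq in Hk. rewrite H; auto. lia.
Qed.

Lemma bmean_le q m f g : 0 <= q <= 1 -> (forall k, (k <= m)%nat -> f k <= g k) ->
  bmean q m f <= bmean q m g.
Proof.
  intros Hq H. apply lsum_le. intros k Hk. apply in_seq in Hk.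
  apply Rmult_le_compat_l; [now apply bern_nonneg|apply H; lia].
Qed.

Lemma bmean_1 q m : bmean q m (fun _ => 1) = 1.
Proof.
  induction m as [|m IH].
  - unfold bmean, bern. simpl. ring.
  - rewrite bmean_S, IH. ring.
Qed.

Lemma bmean_var q m : bmean q m (fun k => (INR k - INR m * q) ^ 2) = INR m * q * (1 - q).
Proof.
  induction m as [|m IH].
  - unfold bmean, bern. simpl. ring.
  - rewrite bmean_S, S_INR.
    rewrite <- !bmean_scal, <- bmean_plus.
    rewrite (bmean_ext _ _ _ (fun k => (INR k - INR m * q) ^ 2 + q * (1 - q) * 1)).
    + rewrite bmean_plus, bmean_scal, bmean_1, IH. ring.
    + intros k _. rewrite S_INR. ring.
Qed.

(** By Chebyshev's inequality most of the mass lies within [s = sqrt (m+1)] of the mean, on at most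
    [4 s] integers; probabilities concentrated on so few points have a sum of squares of order at
    least [1/s]. The variance is at most [(m+1)/4] for every [q], whence the uniformity. *)
Lemma bern_sq_lower : exists c, 0 < c /\ forall q m, 0 <= q <= 1 ->
  c / sqrt (INR (S m)) <= lsum (fun k => bern q m k ^ 2) (seq 0 (S m)).
Proof.
  exists (1/32). split; [lra|]. intros q m Hq.
  set (s := sqrt (INR (S m))).
  assert (Hm1 : 1 <= INR (S m)) by (rewrite S_INR; generalize (pos_INR m); lra).
  assert (Hs2 : s * s = INR (S m)) by (apply sqrt_sqrt; lra).
  assert (Hs : 1 <= s) by (rewrite <- sqrt_1; apply sqrt_le_1_alt; lra).
  assert (HV := bmean_var q m).
  assert (HV' : INR m * q * (1 - q) <= INR (S m) / 4).
  { rewrite S_INR. pose proof (pos_INR m). rewrite Rmult_assoc.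
    assert (q * (1 - q) <= /4) by (generalize (pow2_ge_0 (q - 1/2)); simpl; lra).
    assert (INR m * (q * (1 - q)) <= INR m * /4) by (apply Rmult_le_compat_l; lra). lra. }
  (* A plateau of width about [2 s]; [w >= 1 - (k - m q)^2 / s^2]. *)
  pose (w := fun k => if Rle_dec (Rabs (INR k - INR m * q)) s then 1 else 0).
  assert (Hw : forall k, 1 - / (s * s) * (INR k - INR m * q) ^ 2 <= w k).
  { intros k. unfold w. destruct Rle_dec as [H|H].
    - assert (0 <= / (s * s) * (INR k - INR m * q) ^ 2); [|lra].
      apply Rmult_le_pos; [left; apply Rinv_0_lt_compat; nra|apply pow2_ge_0].
    - apply Rnot_le_lt in H.
      assert (s * s <= (INR k - INR m * q) ^ 2).
      { rewrite <- pow2_abs. simpl. rewrite Rmult_1_r. apply Rmult_le_compat; lra. }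
      assert (1 <= / (s * s) * (INR k - INR m * q) ^ 2); [|lra].
      apply Rmult_le_reg_l with (s * s); [nra|].
      rewrite <- Rmult_assoc, Rinv_r by nra. lra. }
  assert (Hmean : 3/4 <= bmean q m w).
  { apply Rle_trans with (bmean q m (fun k => 1 + - / (s * s) * (INR k - INR m * q) ^ 2)).
    - rewrite bmean_plus, bmean_scal, bmean_1, HV, Hs2.
      assert (/ INR (S m) * (INR m * q * (1 - q)) <= /4); [|lra].
      apply Rmult_le_reg_l with (INR (S m)); [lra|].
      rewrite <- Rmult_assoc, Rinv_r by lra. lra.
    - apply bmean_le; auto. intros k _. specialize (Hw k). lra. }
  assert (Hcount : lsum w (seq 0 (S m)) <= 4 * s).
  { destruct (nfloor_ex (2 * s)) as (N & HN); [lra|].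
    pose (b := fun k => if Rle_dec (Rabs (INR k - INR m * q)) s then true else false).
    assert (E : forall l, lsum w l = INR (length (filter b l))).
    { clear. induction l as [|k l IH]; [reflexivity|]. cbn [lsum fold_right filter].
      fold (lsum w l). rewrite IH. unfold b at 2, w.
      destruct (Rle_dec (Rabs (INR k - INR m * q)) s); cbn [length]; [rewrite S_INR|]; ring. }
    rewrite E. set (l := filter b (seq 0 (S m))).
    assert (Hl : NoDup l) by apply NoDup_filter, seq_NoDup.
    assert (Hlb : forall k, In k l -> Rabs (INR k - INR m * q) <= s).
    { intros k Hk. apply filter_In in Hk. destruct Hk as [_ Hk]. unfold b in Hk.
      destruct Rle_dec; [auto|discriminate]. }
    clearbody l.
    (* The selected integers lie in a window of [N + 1] consecutive ones that starts at the least of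
       them, since the interval has length [2 s < N + 1]. *)
    assert (Hex : exists k0, incl l (seq k0 (S N))).
    { clear E Hl. induction l as [|k l IH].
      - exists 0%nat. intros x [].
      - destruct IH as (k0 & Hk0); [intros; apply Hlb; now right|].
        destruct l as [|k' l].
        { exists k. intros x [<-|[]]. apply in_seq. lia. }
        clear k0 Hk0.
        destruct (nfloor_ex (Rmax 0 (INR m * q - s))) as (n0 & Hn0); [apply Rmax_l|].
        assert (Hk0 : exists k0 : nat, In k0 (k :: k' :: l) /\
                  forall x, In x (k :: k' :: l) -> (k0 <= x)%nat).
        { clear. generalize (k' :: l). intros L. revert k. induction L as [|a L IH]; intros k.
          - exists k. split; [now left|]. intros x [<-|[]]; lia.
          - destruct (IH a) as (k0 & H1 & H2). destruct (le_lt_dec k k0).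
            + exists k. split; [now left|]. intros x [<-|Hx]; [lia|]. specialize (H2 x Hx). lia.
            + exists k0. split; [now right|]. intros x [<-|Hx]; [lia|]. auto. }
        destruct Hk0 as (k0 & H1 & H2). exists k0. intros x Hx. apply in_seq.
        split; [auto|]. pose proof (Hlb _ H1) as A1. pose proof (Hlb _ Hx) as A2.
        apply Rabs_le_between in A1. apply Rabs_le_between in A2.
        assert (INR x < INR (k0 + S N)); [|now apply INR_lt].
        rewrite plus_INR, S_INR. lra. }
    destruct Hex as (k0 & Hk0). apply NoDup_incl_length in Hk0; auto.
    rewrite length_seq in Hk0. apply le_INR in Hk0. rewrite S_INR in Hk0. lra. }
  (* [b^2 >= 2 t b w - t^2 w^2] with [t = 1 / (8 s)] *)
  set (t := / (8 * s)).
  assert (Ht : t * s = /8) by (unfold t; field; lra).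
  assert (Ht0 : 0 < t) by (apply Rinv_0_lt_compat; lra).
  apply Rle_trans with (lsum (fun k => 2 * t * (bern q m k * w k) + - t ^ 2 * w k) (seq 0 (S m))).
  (* Mean at least [3/4] and count at most [4 s] give [2 t (3/4) - 4 s t^2 = t], because
     [t s = 1/8]; the constant [1/32] asks for [t/4]. *)
  - rewrite lsum_plus, !lsum_scal. fold (bmean q m w).
    replace (1/32 / s) with (t / 4) by (unfold t; field; lra).
    nra.
  - apply lsum_le. intros k _.
    assert (Ew : w k = w k * w k) by (unfold w; destruct Rle_dec; ring).
    rewrite Ew at 2. generalize (pow2_ge_0 (bern q m k - t * w k)). nra.
Qed.

(** Induction on the order: one factor [(m+1)/(k+1)] is absorbed by [bern_SS] at the price [1/q],
    raising [m] and [k] by one; each of the [n] remaining ratios then changes by a factor at most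
    [2]. *)
Lemma bmean_moment (q : R) (n : nat) : 0 < q <= 1 ->
  exists K, 0 < K /\ forall m, bmean q m (fun k => (INR (S m) / INR (S k)) ^ n) <= K.
Proof.
  intros Hq. induction n as [|n (K & HK & IH)].
  - exists 1. split; [lra|]. intros m. simpl. rewrite bmean_1. lra.
  - exists (2 ^ n * / q * K).
    assert (H2n : 0 < 2 ^ n) by (apply pow_lt; lra).
    assert (Hq' : 0 < / q) by (apply Rinv_0_lt_compat; lra).
    split; [repeat apply Rmult_lt_0_compat; auto|]. intros m.
    apply Rle_trans with (2 ^ n * / q * bmean q (S m) (fun k => (INR (S (S m)) / INR (S k)) ^ n)).
    2:{ apply Rmult_le_compat_l; auto. left. now apply Rmult_lt_0_compat. }
    unfold bmean. rewrite <- lsum_scal.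
    set (F := fun k => 2 ^ n * / q * (bern q (S m) k * (INR (S (S m)) / INR (S k)) ^ n)).
    apply Rle_trans with (lsum F (map S (seq 0 (S m)))).
    + rewrite lsum_map. apply lsum_le. intros k Hk. apply in_seq in Hk.
      pose proof (bern_SS q m k ltac:(lia)) as E. unfold F.
      assert (P : 0 < INR (S k)) by (apply lt_0_INR; lia).
      assert (Pm : 0 < INR (S m)) by (apply lt_0_INR; lia).
      assert (B0 : 0 <= bern q (S m) (S k)) by (apply bern_nonneg; lra).
      rewrite <- tech_pow_Rmult.
      replace (bern q m k * (INR (S m) / INR (S k) * (INR (S m) / INR (S k)) ^ n))
        with (/ q * bern q (S m) (S k) * (INR (S m) / INR (S k)) ^ n).
      2:{ replace (bern q (S m) (S k)) with (INR (S m) * q * bern q m k / INR (S k))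
            by (rewrite <- E; field; lra). field. lra. }
      replace (2 ^ n * / q * (bern q (S m) (S k) * (INR (S (S m)) / INR (S (S k))) ^ n))
        with (/ q * bern q (S m) (S k) * (2 * (INR (S (S m)) / INR (S (S k)))) ^ n)
        by (rewrite (Rpow_mult_distr 2); ring).
      apply Rmult_le_compat_l; [apply Rmult_le_pos; lra|].
      apply pow_incr. split; [left; now apply Rdiv_lt_0_compat|].
      rewrite (S_INR (S m)), (S_INR (S k)).
      apply Rmult_le_reg_r with (INR (S k) * (INR (S k) + 1)); [nra|].
      replace (INR (S m) / INR (S k) * (INR (S k) * (INR (S k) + 1)))
        with (INR (S m) * (INR (S k) + 1)) by (field; lra).
      replace (2 * ((INR (S m) + 1) / (INR (S k) + 1)) * (INR (S k) * (INR (S k) + 1)))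
        with (2 * (INR (S m) + 1) * INR (S k)) by (field; lra).
      assert (1 <= INR (S k)) by (rewrite S_INR; generalize (pos_INR k); lra). nra.
    + apply lsum_incl.
      * intros k. unfold F. apply Rmult_le_pos; [left; now apply Rmult_lt_0_compat|].
        apply Rmult_le_pos; [apply bern_nonneg; lra|]. apply pow_le. left.
        apply Rdiv_lt_0_compat; apply lt_0_INR; lia.
      * rewrite seq_shift. apply seq_NoDup.
      * rewrite seq_shift. intros k Hk. apply in_seq in Hk. apply in_seq. lia.
Qed.

(** In the conditioning identity the two Poisson weights of the numerator are bounded above and the
    one of the denominator, taken at its mode [m], is bounded below. The bound is uniform in [q]. *)
Lemma bern_le_sqrt : exists K, 0 < K /\ forall q m k, 0 <= q <= 1 -> (k <= m)%nat ->
  bern q m k <= K * sqrt (INR (S m)) / (sqrt (INR (S k)) * sqrt (INR (S (m - k)))).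
Proof.
  destruct pois_le_sqrt as (K & HK & H1 & H2).
  exists (K * K * K). split; [repeat apply Rmult_lt_0_compat; auto|].
  intros q m k Hq Hk.
  assert (Hsq : forall k, 0 < sqrt (INR (S k))) by (intros; apply sqrt_lt_R0, lt_0_INR; lia).
  pose proof (bern_pois q m k Hq Hk) as E.
  assert (Hm := pos_INR m).
  assert (A1 := H1 k (INR m * q) ltac:(nra)).
  assert (A2 := H1 (m - k)%nat (INR m * (1 - q)) ltac:(nra)).
  assert (A3 := H2 m).
  pose proof (bern_nonneg q m k Hq) as B0.
  set (x := sqrt (INR (S m))) in *. set (y := sqrt (INR (S k))) in *.
  set (z := sqrt (INR (S (m - k)))) in *.
  assert (Hx : 0 < x) by apply Hsq. assert (Hy : 0 < y) by apply Hsq.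
  assert (Hz : 0 < z) by apply Hsq.
  assert (A4 : bern q m k * (/ K / x) <= K / y * (K / z)).
  { apply Rle_trans with (bern q m k * pois m (INR m)).
    - now apply Rmult_le_compat_l.
    - rewrite E. apply Rmult_le_compat; auto; apply pois_nonneg; nra. }
  apply Rmult_le_reg_r with (/ K / x).
  { apply Rdiv_lt_0_compat; auto. now apply Rinv_0_lt_compat. }
  apply Rle_trans with (1 := A4). right. field. lra.
Qed.

(** One factor [bern] is replaced by its pointwise bound and the other is kept as a probability.
    What deviates from the pure power of [m + 1] are powers of [(m+1)/(k+1)] and [(m+1)/(m-k+1)],
    which inverse moments for [q] and [1 - q] absorb. *)
Lemma bern_sq_upper (q a b : R) : 0 < q < 1 -> 0 <= a -> 0 <= b ->
  exists K, 0 < K /\ forall m,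
  lsum (fun k => bern q m k ^ 2 * (Rpower (INR (S k)) (- b) * Rpower (INR (S (m - k))) (- a)))
    (seq 0 (S m)) <= K * Rpower (INR (S m)) (- (a + b + 1/2)).
Proof.
  intros Hq Ha Hb. destruct bern_le_sqrt as (K & HK & HB).
  (* The integer [n] exceeds both exponents [b + 1/2] and [a + 1/2]; the ratios [x k], [y k] are at
     least [1], so their real powers are at most [n]-th powers. *)
  destruct (nfloor_ex (a + b + 1/2)) as (n0 & Hn0); [lra|].
  set (n := S n0).
  destruct (bmean_moment q n) as (K1 & HK1 & M1); [lra|].
  destruct (bmean_moment (1 - q) n) as (K2 & HK2 & M2); [lra|].
  assert (H2n : 0 < 2 ^ n) by (apply pow_lt; lra).
  exists (K * 2 ^ n * (K1 + K2)). split; [apply Rmult_lt_0_compat; [apply Rmult_lt_0_compat|]; lra|].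
  intros m. set (u := INR (S m)).
  assert (Hu : 1 <= u) by (unfold u; rewrite S_INR; generalize (pos_INR m); lra).
  pose (x := fun k => u / INR (S k)). pose (y := fun k => u / INR (S (m - k))).
  apply Rle_trans with (lsum (fun k => K * 2 ^ n * Rpower u (- (a + b + 1/2)) *
     (bern q m k * x k ^ n + bern q m k * y k ^ n)) (seq 0 (S m))).
  - apply lsum_le. intros k Hk. apply in_seq in Hk.
    assert (Hkm : (k <= m)%nat) by lia.
    pose proof (HB q m k ltac:(lra) Hkm) as Hbk.
    pose proof (bern_nonneg q m k ltac:(lra)) as B0.
    set (s := INR (S k)) in *. set (t := INR (S (m - k))) in *.
    assert (Hs : 1 <= s) by (unfold s; rewrite S_INR; generalize (pos_INR k); lra).
    assert (Ht : 1 <= t) by (unfold t; rewrite S_INR; generalize (pos_INR (m - k)); lra).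
    assert (Est : s + t = u + 1).
    { unfold s, t, u. rewrite <- plus_INR, <- S_INR. f_equal. lia. }
    assert (Hx1 : 1 <= x k).
    { unfold x. fold s. apply Rmult_le_reg_r with s; [lra|].
      unfold Rdiv. rewrite Rmult_assoc, Rinv_l by lra. lra. }
    assert (Hy1 : 1 <= y k).
    { unfold y. fold t. apply Rmult_le_reg_r with t; [lra|].
      unfold Rdiv. rewrite Rmult_assoc, Rinv_l by lra. lra. }
    (* Since [(k+1) + (m-k+1) > m+1], the two ratios are not large together, and their product is
       controlled by their sum. *)
    assert (Hxy : x k * y k <= x k + y k).
    { unfold x, y. fold s t. apply Rmult_le_reg_r with (s * t); [nra|].
      replace (u / s * (u / t) * (s * t)) with (u * u) by (field; lra).
      replace ((u / s + u / t) * (s * t)) with (u * (s + t)) by (field; lra). nra. }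
    assert (Hw : bern q m k * (Rpower s (- b) * Rpower t (- a)) <=
       K * Rpower u (- (a + b + 1/2)) * (x k * y k) ^ n).
    { apply Rle_trans with (K * sqrt u / (sqrt s * sqrt t) * (Rpower s (- b) * Rpower t (- a))).
      - apply Rmult_le_compat_r; auto. apply Rmult_le_pos; left; apply Rpower_pos.
      - rewrite <- !Rpower_sqrt by lra.
        replace (K * Rpower u (/ 2) / (Rpower s (/ 2) * Rpower t (/ 2)) *
          (Rpower s (- b) * Rpower t (- a))) with
          (K * (Rpower u (- (a + b + 1/2)) * (Rpower (x k) (b + 1/2) * Rpower (y k) (a + 1/2)))).
        + rewrite Rmult_assoc. apply Rmult_le_compat_l; [lra|].
          apply Rmult_le_compat_l; [left; apply Rpower_pos|].
          rewrite Rpow_mult_distr, <- !Rpower_pow by lra.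
          assert (Hn : a + b + 1/2 <= INR n) by (unfold n; rewrite S_INR; lra).
          apply Rmult_le_compat; try (left; apply Rpower_pos); apply Rle_Rpower; lra.
        + replace (K * Rpower u (/ 2) / (Rpower s (/ 2) * Rpower t (/ 2)) *
            (Rpower s (- b) * Rpower t (- a))) with
            (K * (Rpower u (/ 2) * / (Rpower s (/ 2) * Rpower t (/ 2)) *
            (Rpower s (- b) * Rpower t (- a)))) by (unfold Rdiv; ring).
          f_equal. rewrite Rinv_mult, <- !Rpower_Ropp. unfold x, y. fold s t.
          unfold Rpower. rewrite <- !exp_plus. f_equal.
          unfold Rdiv. rewrite !ln_mult by (try apply Rinv_0_lt_compat; lra).
          rewrite !ln_Rinv by lra. field. }
    assert (Hsum : (x k * y k) ^ n <= 2 ^ n * (x k ^ n + y k ^ n)).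
    { apply Rle_trans with ((x k + y k) ^ n); [apply pow_incr; nra|].
      assert (0 <= x k ^ n) by (apply pow_le; lra). assert (0 <= y k ^ n) by (apply pow_le; lra).
      destruct (Rle_dec (x k) (y k)).
      - apply Rle_trans with ((2 * y k) ^ n); [apply pow_incr; lra|].
        rewrite Rpow_mult_distr. apply Rmult_le_compat_l; lra.
      - apply Rle_trans with ((2 * x k) ^ n); [apply pow_incr; lra|].
        rewrite Rpow_mult_distr. apply Rmult_le_compat_l; lra. }
    replace (bern q m k ^ 2 * (Rpower s (- b) * Rpower t (- a))) with
      (bern q m k * (bern q m k * (Rpower s (- b) * Rpower t (- a)))) by ring.
    replace (K * 2 ^ n * Rpower u (- (a + b + 1 / 2)) * (bern q m k * x k ^ n + bern q m k * y k ^ n))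
      with (bern q m k * (K * Rpower u (- (a + b + 1/2)) * (2 ^ n * (x k ^ n + y k ^ n)))) by ring.
    apply Rmult_le_compat_l; auto. apply Rle_trans with (1 := Hw).
    apply Rmult_le_compat_l; auto.
    apply Rmult_le_pos; [lra|left; apply Rpower_pos].
  - rewrite lsum_scal, lsum_plus.
    replace (K * 2 ^ n * (K1 + K2) * Rpower u (- (a + b + 1/2))) with
      (K * 2 ^ n * Rpower u (- (a + b + 1/2)) * (K1 + K2)) by ring.
    apply Rmult_le_compat_l.
    { apply Rmult_le_pos; [apply Rmult_le_pos; lra|left; apply Rpower_pos]. }
    apply Rplus_le_compat; [apply M1|].
    apply Rle_trans with (2 := M2 m).
    unfold bmean.
    rewrite (lsum_ext _ (fun k => (fun i => bern (1 - q) m i * (u / INR (S i)) ^ n) (m - k)%nat)).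
    + apply (lsum_rev (fun i => bern (1 - q) m i * (u / INR (S i)) ^ n)).
      intros k. apply Rmult_le_pos; [apply bern_nonneg; lra|].
      apply pow_le. left. apply Rdiv_lt_0_compat; [lra|apply lt_0_INR; lia].
    + intros k Hk. apply in_seq in Hk. rewrite bern_sym by lia. reflexivity.
Qed.

(** * The weights of the homogeneous parts of the composition *)

(** The share of one prime [q]: the squared coefficient of [x^k] in [exp (c x)], weighted by
    [d(q^k)^(- beta)]. *)
Definition hfac (beta c : R) (k : nat) : R :=
  (c ^ k / INR (fact k)) ^ 2 * Rpower (INR (S k)) (- beta).

Lemma hfac_pos beta c k : 0 < c -> 0 < hfac beta c k.
Proof.
  intros Hc. apply Rmult_lt_0_compat; [|apply Rpower_pos].
  apply pow_lt, Rdiv_lt_0_compat; [now apply pow_lt|apply INR_fact_lt_0].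
Qed.

(** Up to the factor [(c+r)^n / n!], the product [c^k r^(n-k) / (k! (n-k)!)] is a binomial
    probability of parameter [c/(c+r)]; here everything is squared. *)
Lemma hfac_convolution beta kappa c r n k : 0 < c -> 0 < r -> (k <= n)%nat ->
  hfac beta c k * hfac kappa r (n - k) =
  ((c + r) ^ n / INR (fact n)) ^ 2 *
  (bern (c / (c + r)) n k ^ 2 *
   (Rpower (INR (S k)) (- beta) * Rpower (INR (S (n - k))) (- kappa))).
Proof.
  intros Hc Hr Hk. unfold hfac. rewrite bern_fact by auto.
  assert (E1 : c ^ k = (c + r) ^ k * (c / (c + r)) ^ k).
  { rewrite <- Rpow_mult_distr. f_equal. field. lra. }
  assert (E2 : r ^ (n - k) = (c + r) ^ (n - k) * (1 - c / (c + r)) ^ (n - k)).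
  { rewrite <- Rpow_mult_distr. f_equal. field. lra. }
  assert (E3 : (c + r) ^ n = (c + r) ^ k * (c + r) ^ (n - k)).
  { rewrite <- pow_add. f_equal. lia. }
  rewrite E1, E2, E3. field. repeat split; apply INR_fact_neq_0.
Qed.

Definition homog (beta : R) (c : nat -> R) (l : list nat) (n : nat) (m : midx l) : R :=
  if Nat.eqb (wt l m) n then mprod (fun j k => hfac beta (c j) k) l m else 0.

Definition kappa (beta : R) (l : list nat) : R :=
  (INR (length l) - 1) / 2 + beta * INR (length l).

(** Induction on the number of primes. A further prime convolves the weights in the degree: the
    radii [c j] add up, and the bounds for squared binomial probabilities raise the exponent by
    [beta + 1/2]. A single prime has exponent [beta]. *)
Lemma weight_bounds (beta : R) (c : nat -> R) (l : list nat) : 0 <= beta -> l <> nil ->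
  (forall j, In j l -> 0 < c j) ->
  exists w K, 0 < K /\ 0 < lsum c l /\ forall n, has_sum (homog beta c l n) (w n) /\
    / K * hfac (kappa beta l) (lsum c l) n <= w n <= K * hfac (kappa beta l) (lsum c l) n.
Proof.
  intros Hb. induction l as [|j l IH]; intros Hnil Hc; [contradiction|].
  assert (Hcj : 0 < c j) by (apply Hc; now left).
  destruct l as [|j' l].
  - exists (hfac beta (c j)), 1. simpl. split; [lra|split; [lra|]]. intros n. split.
    + set (h := hfac beta (c j) n).
      assert (Hh : 0 <= h) by (left; now apply hfac_pos).
      assert (Hg : has_sum (fun k => if Nat.eqb k n then h else 0) h).
      { apply has_sum_ext with (2 := has_sum_point n h Hh). intros k.
        destruct excluded_middle_informative, (Nat.eqb_spec k n); congruence. }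
      apply has_sum_ext with (2 := has_sum_prod
        (fun (k : nat) (_ : unit) => if Nat.eqb k n then h else 0) _ _
        (fun k => has_sum_unit (if Nat.eqb k n then h else 0)
                    (has_sum_pos _ _ k Hg)) Hg).
      intros [k u]. unfold homog. simpl. rewrite Nat.add_0_r.
      unfold h. destruct (Nat.eqb_spec k n); [subst; ring|auto].
    + rewrite Rplus_0_r. unfold kappa. simpl.
      replace ((1 - 1) / 2 + beta * 1) with beta by field. lra.
  - set (l' := j' :: l) in *.
    destruct IH as (w & K & HK & Hr & IH); [discriminate|intros; apply Hc; now right|].
    set (r := lsum c l') in *. change (lsum c (j :: l')) with (c j + r).
    set (q := c j / (c j + r)).
    assert (Hq : 0 < q < 1).
    { unfold q. split; [apply Rdiv_lt_0_compat; lra|].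
      apply Rmult_lt_reg_r with (c j + r); [lra|]. unfold Rdiv.
      rewrite Rmult_assoc, Rinv_l; lra. }
    assert (Hk0 : 0 <= kappa beta l').
    { unfold kappa, l'. cbn [length]. rewrite S_INR. pose proof (pos_INR (length l)).
      assert (0 <= beta * (INR (length l) + 1)) by (apply Rmult_le_pos; lra). lra. }
    assert (Ek : kappa beta (j :: l') = kappa beta l' + beta + 1/2).
    { unfold kappa. change (length (j :: l')) with (S (length l')). rewrite S_INR. field. }
    rewrite Ek. set (kp := kappa beta l') in *.
    destruct (bern_sq_upper q kp beta Hq Hk0 Hb) as (C1 & HC1 & HU).
    destruct bern_sq_lower as (c0 & Hc0 & HL).
    exists (fun n => lsum (fun k => hfac beta (c j) k * w (n - k)%nat) (seq 0 (S n))),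
      (K * C1 + K * / c0).
    assert (Hc0' : 0 < / c0) by now apply Rinv_0_lt_compat.
    assert (HKC : 0 < K * C1) by now apply Rmult_lt_0_compat.
    assert (HKc : 0 < K * / c0) by now apply Rmult_lt_0_compat.
    split; [lra|split; [lra|]]. intros n. split.
    + apply has_sum_ext with (fun km : nat * midx l' =>
        (fun k m => hfac beta (c j) k * (if Nat.leb k n then homog beta c l' (n - k) m else 0))
          (fst km) (snd km)).
      { intros [k m]. unfold homog. cbn [wt mprod fst snd].
        destruct (Nat.leb_spec k n).
        - destruct (Nat.eqb_spec (wt l' m) (n - k)), (Nat.eqb_spec (k + wt l' m) n); try lia; ring.
        - destruct (Nat.eqb_spec (k + wt l' m) n); try lia; ring. }
      apply (has_sum_prod
        (fun k m => hfac beta (c j) k * (if Nat.leb k n then homog beta c l' (n - k) m else 0))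
        (fun k => if Nat.leb k n then hfac beta (c j) k * w (n - k)%nat else 0)).
      * intros k. destruct (Nat.leb k n).
        -- apply has_sum_scal; [left; now apply hfac_pos|]. apply IH.
        -- apply has_sum_ext with (fun _ => 0); [intros; ring|apply has_sum_zero].
      * assert (E : lsum (fun k => hfac beta (c j) k * w (n - k)%nat) (seq 0 (S n)) =
          lsum (fun k => if Nat.leb k n then hfac beta (c j) k * w (n - k)%nat else 0) (seq 0 (S n))).
        { apply lsum_ext. intros k Hk. apply in_seq in Hk.
          destruct (Nat.leb_spec k n); [auto|lia]. }
        rewrite E. apply has_sum_list; [apply seq_NoDup| |].
        -- intros k. destruct (Nat.leb k n); [|lra].
           apply Rmult_le_pos; [left; now apply hfac_pos|].
           apply (has_sum_ge0 _ _ (proj1 (IH _))).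
        -- intros k Hk. destruct (Nat.leb_spec k n); auto. destruct Hk. apply in_seq. lia.
    + set (Y := ((c j + r) ^ n / INR (fact n)) ^ 2).
      assert (HY : 0 < Y).
      { apply pow_lt, Rdiv_lt_0_compat; [apply pow_lt; lra|apply INR_fact_lt_0]. }
      set (u := INR (S n)).
      assert (Hu : 1 <= u) by (unfold u; rewrite S_INR; generalize (pos_INR n); lra).
      set (T := lsum (fun k => bern q n k ^ 2 *
          (Rpower (INR (S k)) (- beta) * Rpower (INR (S (n - k))) (- kp))) (seq 0 (S n))).
      assert (ET : lsum (fun k => hfac beta (c j) k * hfac kp r (n - k)) (seq 0 (S n)) = Y * T).
      { unfold T. rewrite <- lsum_scal. apply lsum_ext. intros k Hk. apply in_seq in Hk.
        apply hfac_convolution; auto. lia. }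
      assert (HP : 0 < Rpower u (- (kp + beta + 1/2))) by apply Rpower_pos.
      unfold hfac at 1. fold u Y. split.
      * apply Rle_trans with (/ K * (Y * T)).
        -- apply Rle_trans with (/ K * (Y * (c0 * Rpower u (- (kp + beta + 1/2))))).
           ++ replace (/ K * (Y * (c0 * Rpower u (- (kp + beta + 1/2))))) with
                (/ (K * / c0) * (Y * Rpower u (- (kp + beta + 1/2)))) by (field; lra).
              apply Rmult_le_compat_r; [left; now apply Rmult_lt_0_compat|].
              apply Rinv_le_contravar; lra.
           ++ apply Rmult_le_compat_l; [left; now apply Rinv_0_lt_compat|].
              apply Rmult_le_compat_l; [lra|].
              (* For the lower bound both weights are replaced by their smallest value, attained at
                 the argument [n + 1]; the unweighted sum of squares remains. *)
              apply Rle_trans with (Rpower u (- beta) * Rpower u (- kp) *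
                lsum (fun k => bern q n k ^ 2) (seq 0 (S n))).
              ** specialize (HL q n ltac:(lra)). fold u in HL.
                 apply Rle_trans with (Rpower u (- beta) * Rpower u (- kp) * (c0 / sqrt u)).
                 --- right. unfold Rdiv. rewrite <- Rpower_sqrt, <- Rpower_Ropp by lra.
                     replace (- (kp + beta + 1 * / 2)) with (- beta + - kp + - / 2) by field.
                     rewrite !Rpower_plus. ring.
                 --- apply Rmult_le_compat_l; auto.
                     apply Rmult_le_pos; left; apply Rpower_pos.
              ** unfold T. rewrite <- lsum_scal. apply lsum_le. intros k Hk.
                 apply in_seq in Hk. rewrite Rmult_comm.
                 apply Rmult_le_compat_l; [apply pow2_ge_0|].
                 apply Rmult_le_compat; try (left; apply Rpower_pos);
                   apply Rpower_base_ge; auto; try (apply lt_0_INR; lia); apply le_INR; lia.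
        -- rewrite <- ET, <- lsum_scal. apply lsum_le. intros k _.
           destruct (IH (n - k)%nat) as (_ & I1 & _).
           replace (/ K * (hfac beta (c j) k * hfac kp r (n - k))) with
             (hfac beta (c j) k * (/ K * hfac kp r (n - k))) by ring.
           apply Rmult_le_compat_l; [left; now apply hfac_pos|auto].
      * apply Rle_trans with (K * (Y * T)).
        -- rewrite <- ET, <- lsum_scal. apply lsum_le. intros k _.
           destruct (IH (n - k)%nat) as (_ & _ & I2).
           replace (K * (hfac beta (c j) k * hfac kp r (n - k))) with
             (hfac beta (c j) k * (K * hfac kp r (n - k))) by ring.
           apply Rmult_le_compat_l; [left; now apply hfac_pos|auto].
        -- apply Rle_trans with (K * (Y * (C1 * Rpower u (- (kp + beta + 1/2))))).
           ++ apply Rmult_le_compat_l; [lra|]. apply Rmult_le_compat_l; [lra|]. apply HU.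
           ++ assert (0 < Y * Rpower u (- (kp + beta + 1/2))) by now apply Rmult_lt_0_compat.
              set (Z := Y * Rpower u (- (kp + beta + 1/2))) in *.
              replace (K * (Y * (C1 * Rpower u (- (kp + beta + 1/2))))) with (K * C1 * Z)
                by (unfold Z; ring).
              change (hfac (kp + beta + 1/2) (c j + r) n) with Z.
              apply Rmult_le_compat_r; lra.
Qed.

(** * Dirichlet series *)

Definition clsum (f : nat -> C) (l : list nat) : C := fold_right (fun j r => f j + r)%C 0%C l.

Lemma csum_clsum f d : csum f d = clsum f (seq 0 d).
Proof.
  induction d as [|d IH]; [reflexivity|]. cbn [csum]. rewrite seq_S, IH.
  generalize (seq 0 d). intros l. simpl. induction l as [|j l IHl]; simpl; [ring|].
  rewrite <- IHl. ring.
Qed.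

Lemma cpow_nat_cexp n s : cpow_nat n s = cexp (s * ln (INR n))%C.
Proof.
  unfold cpow_nat, cexp. destruct s as [a b]. simpl.
  replace (a * ln (INR n) - b * 0) with (a * ln (INR n)) by ring.
  replace (a * 0 + b * ln (INR n)) with (b * ln (INR n)) by ring. reflexivity.
Qed.

Lemma cexp_pow z k : (cexp z ^ k)%C = cexp (INR k * z)%C.
Proof.
  induction k as [|k IH].
  - simpl. now rewrite Cmult_0_l, cexp_0.
  - rewrite S_INR, RtoC_plus. cbn [Cpow]. rewrite IH, <- cexp_plus. f_equal. ring.
Qed.

Lemma cpow_nat_mult a b s : (1 <= a)%nat -> (1 <= b)%nat ->
  cpow_nat (a * b) s = (cpow_nat a s * cpow_nat b s)%C.
Proof.
  intros Ha Hb. rewrite !cpow_nat_cexp, <- cexp_plus. f_equal.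
  rewrite mult_INR, ln_mult, RtoC_plus by (apply lt_0_INR; lia). ring.
Qed.

Lemma cpow_nat_pow q k s : (1 <= q)%nat -> cpow_nat (q ^ k) s = (cpow_nat q s ^ k)%C.
Proof.
  intros Hq. rewrite !cpow_nat_cexp, cexp_pow, ln_pow_nat, RtoC_mult by auto. f_equal. ring.
Qed.

Lemma cpow_nat_plus n s t : cpow_nat n (s + t) = (cpow_nat n s * cpow_nat n t)%C.
Proof. rewrite !cpow_nat_cexp, <- cexp_plus. f_equal. ring. Qed.

Lemma Cmod_cpow_nat n s : (1 <= n)%nat -> Cmod (cpow_nat n s) = Rpower (INR n) (Re s).
Proof.
  intros Hn. rewrite cpow_nat_cexp, Cmod_cexp. unfold Rpower. f_equal. destruct s; simpl; ring.
Qed.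

Lemma cpow_nat_enc p l m s : (forall j, In j l -> nprime (p j)) ->
  cpow_nat (enc p l m) s = cprod (fun j k => cpow_nat (p j) s ^ k)%C l m.
Proof.
  induction l as [|j l IH]; intros H.
  - simpl. rewrite cpow_nat_cexp. simpl. now rewrite ln_1, Cmult_0_r, cexp_0.
  - pose proof (nprime_ge2 _ (H j (or_introl eq_refl))).
    cbn [enc cprod]. rewrite cpow_nat_mult, cpow_nat_pow, IH; try lia; auto.
    + intros; apply H; now right.
    + apply pow_pos_nat. lia.
    + apply enc_pos. intros; apply H; now right.
Qed.

(** Coefficients of [prod_j exp (- c_j X_j)]; the sign comes from the exponent [- phi]. *)
Definition ecoef (c : nat -> C) (l : list nat) (m : midx l) : C :=
  cprod (fun j k => (- c j) ^ k / INR (fact k))%C l m.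

(** A product of exponential series, one for each prime. At [x = ln n] the value is
    [n^(- (phi(s) - c1))]; at a large real [x] it is the bounded function that determines the
    constant term. *)
Lemma exp_expansion p c l x s : (forall j, In j l -> nprime (p j)) ->
  has_csum (fun m => ecoef c l m * RtoC x ^ wt l m * cpow_nat (enc p l m) (- s))%C
    (cexp (- (x * clsum (fun j => c j * cpow_nat (p j) (- s)) l))%C).
Proof.
  intros Hp.
  replace (cexp (- (x * clsum (fun j => c j * cpow_nat (p j) (- s)) l))%C) with
    (fold_right (fun j r => cexp (- c j * x * cpow_nat (p j) (- s)) * r)%C (RtoC 1) l).
  - apply has_csum_ext with
      (cprod (fun j k => (- c j * x * cpow_nat (p j) (- s)) ^ k / INR (fact k))%C l).
    + intros m. rewrite cpow_nat_enc by auto. unfold ecoef. rewrite <- cprod_pow, <- !cprod_mult.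
      apply cprod_ext. intros j k _. rewrite !Cpow_mult_l. unfold Cdiv. ring.
    + apply (has_csum_cprod _ (fun j => cexp (- c j * x * cpow_nat (p j) (- s))%C)).
      intros j _. apply has_csum_cexp.
  - clear Hp. induction l as [|j l IH]; simpl.
    + rewrite Cmult_0_r. replace (- 0)%C with (RtoC 0) by ring. now rewrite cexp_0.
    + rewrite IH, <- cexp_plus. f_equal. ring.
Qed.

Lemma Cmod_ecoef c l m :
  Cmod (ecoef c l m) = mprod (fun j k => Cmod (c j) ^ k / INR (fact k)) l m.
Proof.
  unfold ecoef. rewrite Cmod_cprod. apply mprod_ext. intros j k _.
  rewrite Cmod_div, Cmod_pow, Cmod_opp, Cmod_R, Rabs_pos_eq; auto; [apply pos_INR|].
  intros E. apply (INR_fact_neq_0 k). now inversion E.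
Qed.

(** The sum of the moduli of the terms of [phi - c1] on the line [Re s = sigma], hence a majorant
    there. *)
Definition rho (p : nat -> nat) (c : nat -> C) (l : list nat) (sigma : R) : R :=
  lsum (fun j => Cmod (c j) * Rpower (INR (p j)) (- sigma)) l.

(** Taking moduli aligns all phases, so the same product formula holds with [rho]. It supplies the
    absolute convergence for Fubini's theorem. *)
Lemma exp_expansion_Cmod p c l x s : (forall j, In j l -> nprime (p j)) -> 0 <= x ->
  has_sum (fun m => Cmod (ecoef c l m * RtoC x ^ wt l m * cpow_nat (enc p l m) (- s))%C)
    (exp (x * rho p c l (Re s))).
Proof.
  intros Hp Hx. unfold rho.
  replace (exp (x * _)) with
    (lprod (fun j => exp (Cmod (c j) * x * Rpower (INR (p j)) (- Re s))) l).
  - apply has_sum_ext with (mprod (fun j k =>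
      (Cmod (c j) * x * Rpower (INR (p j)) (- Re s)) ^ k / INR (fact k)) l).
    + intros m. rewrite !Cmod_mult, Cmod_ecoef, Cmod_pow, Cmod_R, Rabs_pos_eq by auto.
      rewrite cpow_nat_enc, Cmod_cprod, <- mprod_pow, <- !mprod_mult by auto.
      apply mprod_ext. intros j k Hj. rewrite Cmod_pow, Cmod_cpow_nat, !Rpow_mult_distr.
      * change (Re (- s)%C) with (- Re s). unfold Rdiv. ring.
      * pose proof (nprime_ge2 _ (Hp j Hj)). lia.
    + apply has_sum_mprod. intros j _. apply has_sum_exp.
      repeat apply Rmult_le_pos; auto; [apply Cmod_ge_0|left; apply Rpower_pos].
  - clear. induction l as [|j l IH]; simpl.
    + now rewrite Rmult_0_r, exp_0.
    + rewrite IH, <- exp_plus. f_equal. ring.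
Qed.

Lemma DS_term_pos a s n : (1 <= n)%nat -> DS_term a s n = (a n * cpow_nat n (- s))%C.
Proof. destruct n; [lia|reflexivity]. Qed.

Lemma has_csum_point {T} (x : T) (z : C) :
  has_csum (fun y => if excluded_middle_informative (y = x) then z else 0%C) z.
Proof.
  assert (P : forall r, has_rsum (fun y => if excluded_middle_informative (y = x) then r else 0) r).
  { intros r. exists (fun y => if excluded_middle_informative (y = x) then Rmax r 0 else 0),
      (fun y => if excluded_middle_informative (y = x) then Rmax (- r) 0 else 0),
      (Rmax r 0), (Rmax (- r) 0).
    assert (E : r = Rmax r 0 - Rmax (- r) 0) by (unfold Rmax; repeat destruct Rle_dec; lra).
    split; [apply has_sum_point, Rmax_r|]. split; [apply has_sum_point, Rmax_r|].
    split; auto. intros y. destruct excluded_middle_informative; [auto|ring]. }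
  split.
  - apply has_rsum_ext with (2 := P (Re z)). intros y. now destruct excluded_middle_informative.
  - apply has_rsum_ext with (2 := P (Im z)). intros y. now destruct excluded_middle_informative.
Qed.

(** Links the closed form of the symbol to the series whose sum is constrained in [GH_class]. *)
Lemma phi_val_series d p c1 cp s : (forall j, nprime (p j)) ->
  is_series (DS_term (phi_coef d p c1 cp) s) (phi_val d p c1 cp s).
Proof.
  intros Hp. apply has_csum_series.
  assert (P : forall q z, (1 <= q)%nat ->
    has_csum (DS_term (fun n => if Nat.eqb q n then z else 0%C) s) (z * cpow_nat q (- s))%C).
  { intros q z Hq. apply has_csum_ext with (2 := has_csum_point q (z * cpow_nat q (- s))%C).
    intros n. destruct n as [|n].
    - destruct excluded_middle_informative; [lia|reflexivity].
    - rewrite DS_term_pos by lia.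
      destruct excluded_middle_informative, (Nat.eqb_spec q (S n)); subst; try congruence; ring. }
  apply has_csum_ext with (fun n => DS_term (fun n => if Nat.eqb 1 n then c1 else 0%C) s n +
    DS_term (fun n => csum (fun j => if Nat.eqb (p j) n then cp j else 0%C) d) s n)%C.
  { intros [|n]; [simpl; ring|]. rewrite !DS_term_pos by lia. unfold phi_coef.
    rewrite (Nat.eqb_sym 1). ring. }
  unfold phi_val. apply has_csum_plus.
  - refine (eq_rect _ (has_csum _) (P 1%nat c1 (le_n 1)) _ _).
    rewrite cpow_nat_cexp. simpl. rewrite ln_1, Cmult_0_r, cexp_0. ring.
  - induction d as [|d IH]; cbn [csum].
    + apply has_csum_ext with (fun _ => 0%C).
      * intros [|n]; [reflexivity|]. rewrite DS_term_pos by lia. ring.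
      * split; simpl; apply has_rsum_of_sum, has_sum_zero.
    + apply has_csum_ext with (fun n =>
        DS_term (fun n => csum (fun j => if Nat.eqb (p j) n then cp j else 0%C) d) s n +
        DS_term (fun n => if Nat.eqb (p d) n then cp d else 0%C) s n)%C.
      * intros [|n]; [simpl; ring|]. rewrite !DS_term_pos by lia. ring.
      * apply has_csum_plus; auto. apply P. pose proof (nprime_ge2 _ (Hp d)). lia.
Qed.

(** * Absolute convergence and uniqueness of Dirichlet series in the weighted spaces *)

Lemma gterm_summable a s : 0 <= a -> 1 < s -> exists v, has_sum (gterm a s) v.
Proof.
  intros Ha Hs. destruct (ndivisors_series_bounds a Ha) as (K & _ & H).
  destruct (H (Rmin (s - 1) 1)) as (v & Hv & _).
  { unfold Rmin. destruct Rle_dec; lra. }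
  destruct (has_sum_dom (gterm a s) (gterm a (1 + Rmin (s - 1) 1)) v) as (u & Hu & _); eauto.
  intros n. split; [apply gterm_nonneg|]. destruct n; [simpl; lra|].
  rewrite !gterm_pos_eq by lia. apply Rmult_le_compat_l; [left; apply Rpower_pos|].
  apply Rle_Rpower; [apply (le_INR 1); lia|]. unfold Rmin. destruct Rle_dec; lra.
Qed.

Lemma Dnorm_term_pos a b n : (1 <= n)%nat ->
  Dnorm_term a b n = Cmod (b n) ^ 2 * Rpower (INR (ndivisors n)) (- a).
Proof. intros Hn. destruct n; [lia|]. simpl. now rewrite Rpower_Ropp. Qed.

Lemma Dnorm_term_nonneg a b n : 0 <= Dnorm_term a b n.
Proof.
  destruct n; [simpl; lra|]. rewrite Dnorm_term_pos by lia.
  apply Rmult_le_pos; [apply pow2_ge_0|left; apply Rpower_pos].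
Qed.

Lemma inD_has_sum a b : inD a b <-> exists v, has_sum (Dnorm_term a b) v.
Proof.
  split; intros [v Hv]; exists v; apply has_sum_nat; auto; apply Dnorm_term_nonneg.
Qed.

Lemma Dnorm_eq a b v : has_sum (Dnorm_term a b) v -> Dnorm a b = sqrt v.
Proof.
  intros H. unfold Dnorm. f_equal. apply is_series_unique, has_sum_nat; auto.
  apply Dnorm_term_nonneg.
Qed.

(** The weighted inequality of arithmetic and geometric means. At [t = 1] it gives summability;
    optimized over [t] it gives the Cauchy-Schwarz inequality. *)
Lemma amgm x A B t : 0 <= A -> 0 <= B -> 0 < t -> x ^ 2 <= A * B -> 2 * x <= t * A + / t * B.
Proof.
  intros HA HB Ht Hx. assert (Ht' : 0 < / t) by now apply Rinv_0_lt_compat.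
  assert (E : A * B = (t * A) * (/ t * B)) by (field; lra). rewrite E in Hx.
  assert (0 <= t * A) by nra. assert (0 <= / t * B) by nra.
  set (U := t * A) in *. set (V := / t * B) in *.
  apply Rnot_lt_le. intros Hlt. generalize (pow2_ge_0 (U - V)). nra.
Qed.

Lemma Dnorm_gterm_sq a b u n : (1 <= n)%nat ->
  (Cmod (b n) * Rpower (INR n) (- u)) ^ 2 = Dnorm_term a b n * gterm a (2 * u) n.
Proof.
  intros Hn. rewrite Dnorm_term_pos, gterm_pos_eq by auto.
  set (D := INR (ndivisors n)).
  assert (E3 : Rpower D (- a) * Rpower D a = 1).
  { rewrite <- Rpower_plus. replace (- a + a) with 0 by ring.
    unfold Rpower. now rewrite Rmult_0_l, exp_0. }
  assert (E2 : Rpower (INR n) (- (2 * u)) = Rpower (INR n) (- u) ^ 2).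
  { unfold Rpower. simpl. rewrite Rmult_1_r, <- !exp_plus. f_equal. ring. }
  rewrite E2.
  replace (Cmod (b n) ^ 2 * Rpower D (- a) * (Rpower D a * Rpower (INR n) (- u) ^ 2)) with
    (Cmod (b n) ^ 2 * Rpower (INR n) (- u) ^ 2 * (Rpower D (- a) * Rpower D a)) by ring.
  rewrite E3. ring.
Qed.

(** The divisor weight is moved to the second factor [sum d(n)^a n^(- 2u)], which converges for
    [2u > 1]; so [C_(1/2)] is a half-plane of absolute convergence for every weight. *)
Lemma Dnorm_abs_convergence a b u : 0 <= a -> 1/2 < u -> inD a b ->
  exists v, has_sum (fun n => match n with O => 0 | _ => Cmod (b n) * Rpower (INR n) (- u) end) v.
Proof.
  intros Ha Hu Hb. apply inD_has_sum in Hb. destruct Hb as (x & Hx).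
  destruct (gterm_summable a (2 * u) Ha) as (y & Hy); [lra|].
  destruct (has_sum_dom (fun n => match n with O => 0 | _ => Cmod (b n) * Rpower (INR n) (- u) end)
    (fun n => /2 * (1 * Dnorm_term a b n + / 1 * gterm a (2 * u) n)) (/2 * (1 * x + / 1 * y)))
    as (v & Hv & _).
  - intros n. destruct n as [|n].
    + simpl. lra.
    + split; [apply Rmult_le_pos; [apply Cmod_ge_0|left; apply Rpower_pos]|].
      pose proof (amgm _ _ _ 1 (Dnorm_term_nonneg a b (S n)) (gterm_nonneg a (2 * u) (S n)) Rlt_0_1
        (Req_le _ _ (Dnorm_gterm_sq a b u (S n) ltac:(lia)))). lra.
  - apply has_sum_scal; [lra|]. apply has_sum_plus; apply has_sum_scal; auto; lra.
  - now exists v.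
Qed.

Lemma DS_csum a b s : 0 <= a -> inD a b -> 1/2 < Re s -> exists v, has_csum (DS_term b s) v.
Proof.
  intros Ha Hb Hs. destruct (Dnorm_abs_convergence a b (Re s) Ha Hs Hb) as (A & HA).
  apply (has_csum_exists _ _ A) with (2 := HA).
  intros [|n]; [simpl; rewrite Cmod_0; lra|].
  rewrite DS_term_pos, Cmod_mult, Cmod_cpow_nat by lia. apply Rle_refl.
Qed.

(* Letting [s] tend to infinity isolates the first nonzero coefficient. *)
Lemma DS_coef_zero (e : nat -> C) :
  (forall s : R, 1 <= s -> has_csum (DS_term e s) 0%C) ->
  forall n, (1 <= n)%nat -> e n = 0%C.
Proof.
  intros H n. induction n as [N IH] using lt_wf_ind. intros HN.
  destruct (has_csum_abs _ _ (H 1 (Rle_refl 1))) as (A & HA).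
  assert (HA0 : 0 <= A) by apply (has_sum_ge0 _ _ HA).
  set (u := INR N). assert (Hu : 1 <= u) by (apply (le_INR 1); lia).
  assert (Hb : forall s, 1 <= s -> Cmod (e N) * Rpower u (- s) <= Rpower (u + 1) (- (s - 1)) * A).
  { intros s Hs.
    pose proof (has_csum_plus _ _ _ _ (H s Hs)
      (has_csum_point N (- (e N * cpow_nat N (- s)))%C)) as HP.
    rewrite Cplus_0_l in HP.
    replace (Cmod (e N) * Rpower u (- s)) with (Cmod (- (e N * cpow_nat N (- s)))%C)
      by (rewrite Cmod_opp, Cmod_mult, Cmod_cpow_nat; auto).
    eapply (has_csum_Cmod_le _ (fun n => Rpower (u + 1) (- (s - 1)) * Cmod (DS_term e 1 n))).
    3: exact HP.
    - intros n. destruct (lt_eq_lt_dec n N) as [[Hn| ->]|Hn].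
      + assert (E : DS_term e s n = 0%C).
        { destruct n; [reflexivity|]. rewrite DS_term_pos, IH by lia. ring. }
        rewrite E. destruct excluded_middle_informative; [lia|].
        rewrite Cplus_0_l, Cmod_0.
        apply Rmult_le_pos; [left; apply Rpower_pos|apply Cmod_ge_0].
      + rewrite DS_term_pos by auto. destruct excluded_middle_informative; [|tauto].
        replace (e N * cpow_nat N (- s) + - (e N * cpow_nat N (- s)))%C with (RtoC 0) by ring.
        rewrite Cmod_0. apply Rmult_le_pos; [left; apply Rpower_pos|apply Cmod_ge_0].
      + destruct excluded_middle_informative; [lia|]. rewrite Cplus_0_r.
        rewrite !DS_term_pos, !Cmod_mult, !Cmod_cpow_nat by lia. simpl Re.
        replace (Rpower (INR n) (- s)) with (Rpower (INR n) (- (s - 1)) * Rpower (INR n) (- (1)))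
          by (rewrite <- Rpower_plus; f_equal; ring).
        assert (Rpower (INR n) (- (s - 1)) <= Rpower (u + 1) (- (s - 1))).
        { apply Rpower_base_ge; try lra. unfold u. rewrite <- S_INR. apply le_INR. lia. }
        pose proof (Cmod_ge_0 (e n)). pose proof (Rpower_pos (INR n) (- (1))).
        replace (Cmod (e n) * (Rpower (INR n) (- (s - 1)) * Rpower (INR n) (- (1)))) with
          (Rpower (INR n) (- (s - 1)) * (Cmod (e n) * Rpower (INR n) (- (1)))) by ring.
        apply Rmult_le_compat_r; auto. apply Rmult_le_pos; lra.
    - apply has_sum_scal; auto. left; apply Rpower_pos. }
  apply Cmod_eq_0. apply NNPP. intros Hne.
  assert (Hpos : 0 < Cmod (e N)) by (pose proof (Cmod_ge_0 (e N)); lra).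
  assert (Hln : 0 < ln ((u + 1) / u)).
  { rewrite <- ln_1. apply ln_increasing; [lra|]. apply Rmult_lt_reg_r with u; [lra|].
    unfold Rdiv. rewrite Rmult_assoc, Rinv_l; lra. }
  set (L := ln ((u + 1) / u)) in *.
  (* [|e_N| (1 + t L) <= |e_N| ((u+1)/u)^t <= A u] *)
  assert (Ht : forall t, 0 <= t -> Cmod (e N) * (1 + t * L) <= A * u).
  { intros t Ht. specialize (Hb (t + 1) ltac:(lra)).
    apply Rle_trans with (Cmod (e N) * exp (t * L)).
    { apply Rmult_le_compat_l; [lra|apply exp_ineq]. }
    replace (t + 1 - 1) with t in Hb by ring.
    apply Rmult_le_reg_r with (Rpower (u + 1) (- t)); [apply Rpower_pos|].
    replace (Cmod (e N) * exp (t * L) * Rpower (u + 1) (- t)) with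
      (Cmod (e N) * Rpower u (- (t + 1)) * u).
    - apply Rmult_le_compat_r with (r := u) in Hb; [|lra]. lra.
    - rewrite <- (exp_ln u) at 2 by lra. unfold Rpower, L.
      unfold Rdiv. rewrite ln_mult, ln_Rinv by (try apply Rinv_0_lt_compat; lra).
      rewrite !Rmult_assoc, <- !exp_plus. f_equal. f_equal. ring. }
  (* This [t] makes [|e_N| t L = A u], and [|e_N| <= 0] is left. *)
  specialize (Ht (A * u / (Cmod (e N) * L))).
  assert (0 < Cmod (e N) * L) by nra.
  assert (0 <= A * u / (Cmod (e N) * L)).
  { apply Rmult_le_pos; [nra|]. left. now apply Rinv_0_lt_compat. }
  specialize (Ht H1).
  replace (Cmod (e N) * (1 + A * u / (Cmod (e N) * L) * L)) with (Cmod (e N) + A * u) in Ht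
    by (field; split; lra).
  lra.
Qed.

(** * The constant term of a symbol with unrestricted range *)

Lemma has_sum_of_rsum {T} (f : T -> R) v :
  (forall x, 0 <= f x) -> has_rsum f v -> has_sum f v.
Proof.
  intros Hf H. apply has_rsum_abs in H. destruct H as (A & H1 & H2).
  apply (has_sum_ext _ f) in H1; [|intros; now apply Rabs_pos_eq].
  assert (E : A + v = 2 * A).
  { apply (has_sum_unique _ _ _ H2). apply has_sum_ext with (fun x => 2 * f x).
    - intros x. rewrite Rabs_pos_eq by auto. ring.
    - apply has_sum_scal; auto; lra. }
  replace v with A by lra. auto.
Qed.

Lemma is_derive_lsum {T} (F F' : T -> R -> R) l t :
  (forall x, In x l -> is_derive (F x) t (F' x t)) ->
  is_derive (fun t => lsum (fun x => F x t) l) t (lsum (fun x => F' x t) l).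
Proof.
  induction l as [|x l IH]; intros H; simpl.
  - apply (is_derive_const 0 t).
  - apply (is_derive_plus (F x) (fun t => lsum (fun x => F x t) l)).
    + apply H; now left.
    + apply IH. intros; apply H; now right.
Qed.

(* The mean value over [t] of the sum times [cexp (i lam_{t0} t)] is the coefficient [q t0]. *)
Lemma mean_value {T} (q : T -> C) (lam : T -> R) (A B : R) (t0 : T) :
  has_sum (fun x => Cmod (q x)) A ->
  (forall t : R, exists h, has_csum (fun x => q x * cexp (- (Ci * (lam x * t))))%C h /\ Cmod h <= B) ->
  (forall x, x <> t0 -> lam x <> lam t0) -> Cmod (q t0) <= B.
Proof.
  intros HA Hh Hlam.
  assert (HB : 0 <= B).
  { destruct (Hh 0) as (h & _ & Hle). pose proof (Cmod_ge_0 h). lra. }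
  destruct (Ceq_dec (q t0) 0) as [E0|Hq0]; [rewrite E0, Cmod_0; auto|].
  assert (Hm : 0 < Cmod (q t0)) by now apply Cmod_gt_0.
  set (w := (Cconj (q t0) / Cmod (q t0))%C).
  assert (Hmn : RtoC (Cmod (q t0)) <> RtoC 0) by (intros E; inversion E; lra).
  assert (Hw : Cmod w = 1).
  { unfold w. rewrite Cmod_div, Cmod_conj, Cmod_R, Rabs_pos_eq by (auto; lra). field; lra. }
  assert (Ew : (w * q t0)%C = RtoC (Cmod (q t0))).
  { unfold w, Cdiv. rewrite (Cmult_comm (Cconj (q t0))), <- Cmult_assoc, (Cmult_comm (Cconj (q t0))).
    rewrite <- Cmod2_conj, <- RtoC_inv, <- RtoC_mult by lra. f_equal. field; lra. }
  pose (z := fun x => (Ci * (lam t0 - lam x))%C).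
  pose (f := fun x (t : R) => Re (w * q x * cexp (t * z x))%C).
  assert (Hz : forall x t, Cmod (cexp (RtoC t * z x)%C) = 1).
  { intros x t. rewrite Cmod_cexp. unfold z. simpl. rewrite <- exp_0. f_equal. ring. }
  assert (Hf : forall x t, Rabs (f x t) <= Cmod (q x)).
  { intros x t. eapply Rle_trans; [apply re_le_Cmod|]. rewrite !Cmod_mult, Hw, Hz. lra. }
  apply le_epsilon. intros eps Heps.
  assert (HL : exists L, NoDup L /\ In t0 L /\ A - eps <= lsum (fun x => Cmod (q x)) L).
  { assert (HL : exists L, NoDup L /\ A - eps <= lsum (fun x => Cmod (q x)) L).
    { apply NNPP. intros Hn. destruct HA as (_ & _ & HA).
      assert (A <= A - eps); [|lra]. apply HA. intros L HLd.
      apply Rnot_lt_le. intros Hlt. apply Hn. exists L. split; auto. lra. }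
    destruct HL as (L & HLd & HLs). destruct (classic (In t0 L)) as [Hi|Hi].
    - now exists L.
    - exists (t0 :: L). split; [now constructor|split; [now left|]]. simpl. lra. }
  destruct HL as (L & HLd & HLi & HLs).
  assert (Hft : forall t, lsum (fun x => f x t) L <= B + eps).
  { intros t. destruct (Hh t) as (h & H1 & H2).
    pose proof (has_csum_scal (w * cexp (Ci * (lam t0 * t)))%C _ _ H1) as [HP _].
    set (h' := (w * cexp (Ci * (lam t0 * t)) * h)%C) in HP.
    assert (Hh' : Re h' <= B).
    { eapply Rle_trans; [apply Rle_abs|]. eapply Rle_trans; [apply re_le_Cmod|].
      unfold h'. rewrite !Cmod_mult, Hw, Cmod_cexp.
      replace (Re (Ci * (lam t0 * t))%C) with 0 by (simpl; ring). rewrite exp_0. lra. }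
    apply has_rsum_ext with (g := fun x => f x t) in HP.
    2:{ intros x. unfold f. f_equal.
        replace (cexp (t * z x)) with
          (cexp (Ci * (lam t0 * t)) * cexp (- (Ci * (lam x * t))))%C; [ring|].
        rewrite <- cexp_plus. f_equal. unfold z. ring. }
    (* [|q x| + f x t] is nonnegative, so its sum over [L] is at most [A + B]; the moduli on [L]
       already account for [A - eps]. *)
    assert (HS : has_sum (fun x => Cmod (q x) + f x t) (A + Re h')).
    { apply has_sum_of_rsum.
      - intros x. specialize (Hf x t). apply Rabs_le_between in Hf. lra.
      - apply has_rsum_plus; auto. now apply has_rsum_of_sum. }
    destruct HS as (_ & HS & _). specialize (HS L HLd). rewrite lsum_plus in HS. lra. }
  pose (dec := fun x => excluded_middle_informative (x = t0)).
  (* Averaging over [t] is done with explicit antiderivatives: linear in [t] for [t0], bounded for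
     every other [x] because [z x <> 0]. The mean value theorem on [[0, t]] takes the place of the
     integral, and [t] large removes the bounded part. *)
  pose (Phi := fun x (t : R) => if dec x then Cmod (q t0) * t
                          else Re (w * q x / z x * cexp (t * z x))%C).
  assert (HPhi : forall x t, is_derive (Phi x) t (f x t)).
  { intros x t. unfold Phi. destruct (dec x) as [->|Hx].
    - unfold f, z. replace (lam t0 - lam t0)%C with (RtoC 0) by ring.
      rewrite Cmult_0_r, Cmult_0_r, cexp_0, Cmult_1_r, Ew. simpl.
      auto_derive; [exact I|]. ring.
    - assert (Hzx : z x <> RtoC 0).
      { unfold z. intros E. apply (Hlam x Hx). inversion E. lra. }
      pose proof (is_derive_cexp (z x) (w * q x / z x)%C t) as D.
      replace (w * q x / z x * z x)%C with (w * q x)%C in D by (field; auto). exact D. }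
  pose (M := fun x => if dec x then 0 else 2 * Cmod (w * q x / z x)%C).
  assert (HM0 : 0 <= lsum M L).
  { apply lsum_nonneg. intros x. unfold M. destruct (dec x); [lra|].
    generalize (Cmod_ge_0 (w * q x / z x)%C); lra. }
  assert (Hup : forall t, 0 < t -> Cmod (q t0) * t <= (B + eps) * t + lsum M L).
  { intros t Ht.
    destruct (MVT_cor2 (fun t => lsum (fun x => Phi x t) L) (fun t => lsum (fun x => f x t) L) 0 t Ht)
      as (c & E & Hc).
    { intros c _. apply is_derive_Reals. apply is_derive_lsum. auto. }
    assert (H1 : Cmod (q t0) * t - lsum M L <=
              lsum (fun x => Phi x t) L - lsum (fun x => Phi x 0) L).
    { assert (Hin : Cmod (q t0) * t <= lsum (fun x => Phi x t - Phi x 0 + M x) L).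
      { apply Rle_trans with (lsum (fun x => Phi x t - Phi x 0 + M x) (t0 :: nil)).
        - simpl. unfold Phi, M. destruct (dec t0); [lra|tauto].
        - apply lsum_incl; auto.
          + intros x. unfold Phi, M. destruct (dec x); [nra|].
            assert (Q : forall s : R, Rabs (Re (w * q x / z x * cexp (s * z x))%C) <=
                                        Cmod (w * q x / z x)%C).
            { intros s. eapply Rle_trans; [apply re_le_Cmod|]. rewrite Cmod_mult, Hz. lra. }
            pose proof (Q t) as Q1. pose proof (Q 0) as Q2.
            apply Rabs_le_between in Q1. apply Rabs_le_between in Q2. lra.
          + repeat constructor. simpl; tauto.
          + intros x [<-|[]]; auto. }
      rewrite lsum_plus in Hin.
      assert (E2 : lsum (fun x => Phi x t - Phi x 0) L + lsum (fun x => Phi x 0) L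
                   = lsum (fun x => Phi x t) L).
      { rewrite <- lsum_plus. apply lsum_ext. intros; ring. }
      lra. }
    specialize (Hft c). rewrite Rminus_0_r in E.
    assert (lsum (fun x => f x c) L * t <= (B + eps) * t) by (apply Rmult_le_compat_r; lra).
    lra. }
  apply Rnot_lt_le. intros Hlt. set (g := Cmod (q t0) - (B + eps)).
  specialize (Hup ((lsum M L + 1) / g)).
  assert (Hg : 0 < g) by (unfold g; lra).
  assert (Hq : 0 < (lsum M L + 1) / g) by (apply Rdiv_lt_0_compat; lra).
  specialize (Hup Hq).
  assert (E : g * ((lsum M L + 1) / g) = lsum M L + 1) by (field; lra).
  unfold g in E at 1. lra.
Qed.

(** Otherwise [exp (theta x) = sum theta^k x^k / k!] would be at most the bound of the terms divided
    by [1 - theta], which is half of itself. A single term thus has nearly the size of the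
    exponential. *)
Lemma exp_term_large (x theta : R) : 0 <= x -> 0 < theta < 1 ->
  exists k, (1 - theta) / 2 * exp (theta * x) <= x ^ k / INR (fact k).
Proof.
  intros Hx Ht. apply NNPP. intros Hn.
  set (M := (1 - theta) / 2 * exp (theta * x)).
  assert (HM : forall k, x ^ k / INR (fact k) <= M).
  { intros k. apply Rnot_lt_le. intros Hlt. apply Hn. exists k. fold M. lra. }
  assert (H : exp (theta * x) <= M * / (1 - theta)).
  { apply (has_sum_le (fun k => (theta * x) ^ k / INR (fact k)) (fun k => M * theta ^ k)).
    - intros k. rewrite Rpow_mult_distr. unfold Rdiv. rewrite Rmult_assoc, Rmult_comm.
      apply Rmult_le_compat_r; [apply pow_le; lra|apply HM].
    - apply has_sum_exp. nra.
    - apply has_sum_scal; [|apply has_sum_geom; lra].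
      unfold M. apply Rmult_le_pos; [lra|left; apply exp_pos]. }
  unfold M in H. pose proof (exp_pos (theta * x)).
  replace ((1 - theta) / 2 * exp (theta * x) * / (1 - theta)) with (exp (theta * x) / 2) in H
    by (field; lra).
  lra.
Qed.

Lemma Cmod_clsum_le f l : Cmod (clsum f l) <= lsum (fun j => Cmod (f j)) l.
Proof.
  induction l as [|j l IH]; simpl; [rewrite Cmod_0; lra|].
  eapply Rle_trans; [apply Cmod_triangle|]. lra.
Qed.

(** The largest coefficient of the bounded function is at least [D exp (y theta rho)], with [D]
    independent of [y], and at most [exp (y R0)]. Large [y] gives [theta rho <= R0], for every
    [theta < 1]. *)
Lemma rho_bound (p : nat -> nat) (c : nat -> C) (l : list nat) (z : C) sigma :
  (forall j, In j l -> nprime (p j)) -> NoDup (map p l) -> 0 < sigma ->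
  (forall s, Re s = sigma ->
     1/2 < Re (z + clsum (fun j => c j * cpow_nat (p j) (- s)) l)%C) ->
  rho p c l sigma <= Re z - 1/2.
Proof.
  intros Hp Hl Hs H. set (R0 := Re z - 1/2).
  assert (Hcoef : forall y, 0 < y -> forall m : midx l,
    mprod (fun j k => (y * (Cmod (c j) * Rpower (INR (p j)) (- sigma))) ^ k / INR (fact k)) l m
    <= exp (y * R0)).
  { intros y Hy m0.
    pose (q := fun m => (ecoef c l m * RtoC y ^ wt l m * cpow_nat (enc p l m) (- sigma))%C).
    assert (Eq : forall m, Cmod (q m) =
      mprod (fun j k => (y * (Cmod (c j) * Rpower (INR (p j)) (- sigma))) ^ k / INR (fact k)) l m).
    { intros m. unfold q.
      rewrite !Cmod_mult, Cmod_ecoef, Cmod_pow, Cmod_R, Rabs_pos_eq by lra.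
      rewrite cpow_nat_enc, Cmod_cprod, <- mprod_pow, <- !mprod_mult by auto.
      apply mprod_ext. intros j k Hj. rewrite Cmod_pow, Cmod_cpow_nat, !Rpow_mult_distr.
      - change (Re (- sigma)%C) with (- sigma). unfold Rdiv. ring.
      - pose proof (nprime_ge2 _ (Hp j Hj)). lia. }
    rewrite <- Eq.
    apply (mean_value q (fun m => ln (INR (enc p l m))) (exp (y * rho p c l sigma))).
    - apply (exp_expansion_Cmod p c l y sigma); auto. lra.
    - intros t.
      exists (cexp (- (y * clsum (fun j => c j * cpow_nat (p j) (- (sigma + Ci * t))) l))%C).
      split.
      + apply has_csum_ext with (2 := exp_expansion p c l y (sigma + Ci * t)%C Hp).
        intros m. unfold q. replace (- (sigma + Ci * t))%C with (- sigma + - (Ci * t))%C by ring.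
        rewrite cpow_nat_plus, Cmult_assoc. f_equal. rewrite cpow_nat_cexp. f_equal. ring.
      + rewrite Cmod_cexp. apply exp_le_compat.
        specialize (H (sigma + Ci * t)%C). simpl in H.
        set (S0 := clsum _ l) in *. unfold R0. simpl.
        assert (1/2 < Re z + fst S0) by (apply H; ring).
        unfold Re in *. nra.
    (* Distinct multi-indices have distinct frequencies [ln N] by unique factorization; this is
       where the independence of the phases of different primes enters. *)
    - intros m Hm E. apply Hm. apply (enc_inj p l); auto.
      apply INR_eq. apply ln_inv; auto; apply lt_0_INR;
        [pose proof (enc_pos p l m Hp)|pose proof (enc_pos p l m0 Hp)]; lia. }
  assert (Hcj : forall j, 0 <= Cmod (c j) * Rpower (INR (p j)) (- sigma)).
  { intros j. apply Rmult_le_pos; [apply Cmod_ge_0|left; apply Rpower_pos]. }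
  assert (Hth : forall theta, 0 < theta < 1 -> theta * rho p c l sigma <= R0).
  { intros theta Ht. apply Rnot_lt_le. intros Hlt.
    assert (Hy : forall y, 0 < y ->
      ((1 - theta) / 2) ^ length l * exp (y * (theta * rho p c l sigma)) <= exp (y * R0)).
    { intros y Hy.
      assert (Hm : exists m, ((1 - theta) / 2) ^ length l * exp (y * (theta * rho p c l sigma)) <=
        mprod (fun j k => (y * (Cmod (c j) * Rpower (INR (p j)) (- sigma))) ^ k / INR (fact k)) l m).
      { clear - Hcj Ht Hy. unfold rho. induction l as [|j l IH].
        - exists tt. simpl. rewrite !Rmult_0_r, exp_0. lra.
        - destruct IH as (m & Hm).
          destruct (exp_term_large (y * (Cmod (c j) * Rpower (INR (p j)) (- sigma))) theta)
            as (k & Hk); auto.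
          { apply Rmult_le_pos; auto. lra. }
          exists (k, m). cbn [length pow lsum fold_right mprod fst snd].
          fold (lsum (fun j => Cmod (c j) * Rpower (INR (p j)) (- sigma)) l).
          rewrite Rmult_plus_distr_l, Rmult_plus_distr_l, exp_plus.
          set (X := exp (y * (theta * (Cmod (c j) * Rpower (INR (p j)) (- sigma))))).
          set (Y := exp (y * (theta * lsum _ l))) in *.
          replace ((1 - theta) / 2 * ((1 - theta) / 2) ^ length l * (X * Y)) with
            (((1 - theta) / 2 * X) * (((1 - theta) / 2) ^ length l * Y)) by ring.
          apply Rmult_le_compat; auto.
          + apply Rmult_le_pos; [lra|left; apply exp_pos].
          + apply Rmult_le_pos; [apply pow_le; lra|left; apply exp_pos].
          + apply Rle_trans with (2 := Hk). right. unfold X. f_equal. f_equal. ring. }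
      destruct Hm as (m & Hm). apply Rle_trans with (1 := Hm). now apply Hcoef. }
    set (D := ((1 - theta) / 2) ^ length l) in *.
    assert (HD : 0 < D) by (apply pow_lt; lra).
    set (g := theta * rho p c l sigma - R0).
    assert (Hg : 0 < g) by (unfold g; lra).
    assert (HDi : 0 < / D) by now apply Rinv_0_lt_compat.
    (* [y = 1/(D g)] turns the inequality into [D exp (1/D) <= 1], whereas
       [D exp (1/D) >= D + 1]. *)
    assert (Hq : 0 < / D / g) by (apply Rdiv_lt_0_compat; auto).
    specialize (Hy (/ D / g) Hq).
    assert (H2 : D * exp (/ D / g * g) <= 1).
    { apply Rmult_le_reg_r with (exp (/ D / g * R0)); [apply exp_pos|].
      rewrite Rmult_1_l, Rmult_assoc, <- exp_plus.
      replace (/ D / g * g + / D / g * R0) with (/ D / g * (theta * rho p c l sigma))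
        by (unfold g; ring). auto. }
    replace (/ D / g * g) with (/ D) in H2 by (field; lra).
    pose proof (exp_ineq (/ D)) as H3.
    apply Rmult_le_compat_l with (r := D) in H3; [|lra].
    rewrite Rmult_plus_distr_l, Rinv_r in H3; lra. }
  assert (Hrho : 0 <= rho p c l sigma).
  { unfold rho. apply lsum_nonneg. intros j. apply Hcj. }
  apply Rnot_lt_le. intros Hlt. set (g := rho p c l sigma) in *.
  assert (HR0 : 0 <= R0) by (specialize (Hth (1/2) ltac:(lra)); lra).
  (* This [theta] makes [theta g] the midpoint of [R0] and [g]. *)
  specialize (Hth ((R0 + g) / (2 * g))).
  assert (Hg : 0 < g) by lra.
  assert (0 < (R0 + g) / (2 * g) < 1).
  { split; [apply Rdiv_lt_0_compat; lra|].
    apply Rmult_lt_reg_r with (2 * g); [lra|]. unfold Rdiv. rewrite Rmult_assoc, Rinv_l; lra. }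
  specialize (Hth H0). replace ((R0 + g) / (2 * g) * g) with ((R0 + g) / 2) in Hth by (field; lra).
  lra.
Qed.

(** If [Re c1] were larger, the triangle inequality would keep the range away from the line
    [Re = 1/2], against unrestricted range. If it were smaller, [rho_bound] would fail for [sigma]
    near [0], where [rho] approaches [r]. *)
Lemma constant_term (d : nat) (p : nat -> nat) (c1 : C) (cp : nat -> C) :
  enumerates_primes p -> GH_class 0 (phi_coef d p c1 cp) ->
  unrestricted_range (phi_val d p c1 cp) ->
  Re c1 = 1/2 + lsum (fun j => Cmod (cp j)) (seq 0 d).
Proof.
  intros (Hp1 & Hp2 & _) (_ & _ & HG & _) Hu.
  assert (Hp : forall j, nprime (p j)) by exact Hp1.
  set (l := seq 0 d). set (r := lsum (fun j => Cmod (cp j)) l).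
  assert (Ephi : forall s, phi_val d p c1 cp s
      = (c1 + clsum (fun j => cp j * cpow_nat (p j) (- s)) l)%C).
  { intros s. unfold phi_val. now rewrite csum_clsum. }
  assert (Hl : NoDup (map p l)).
  { apply NoDup_map_NoDup_ForallPairs; [|apply seq_NoDup].
    intros x y _ _ E. destruct (lt_eq_lt_dec x y) as [[H|]|H]; auto; apply Hp2 in H; lia. }
  apply Rle_antisym.
  - apply Rnot_lt_le. intros Hlt. apply (Hu ((Re c1 - 1/2 - r) / 2)); [lra|].
    intros s Hs. rewrite Ephi.
    assert (Hle : Cmod (clsum (fun j => cp j * cpow_nat (p j) (- s)) l)%C <= r).
    { eapply Rle_trans; [apply Cmod_clsum_le|]. apply lsum_le. intros j _.
      pose proof (nprime_ge2 _ (Hp j)) as H2.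
      rewrite Cmod_mult, Cmod_cpow_nat by lia.
      rewrite <- (Rmult_1_r (Cmod (cp j))) at 2.
      apply Rmult_le_compat_l; [apply Cmod_ge_0|].
      rewrite <- (Rpower_O (INR (p j))) by (apply lt_0_INR; lia).
      apply Rle_Rpower; [apply (le_INR 1); lia|]. change (Re (- s)%C) with (- Re s). lra. }
    pose proof (re_le_Cmod (clsum (fun j => cp j * cpow_nat (p j) (- s)) l)%C) as Hre.
    apply (Rle_trans _ _ _ Hre) in Hle. apply Rabs_le_between in Hle.
    unfold Re in *. simpl. lra.
  - assert (Hrho : forall sigma, 0 < sigma -> rho p cp l sigma <= Re c1 - 1/2).
    { intros sigma Hs. apply (rho_bound p cp l c1 sigma); auto.
      intros s Es. destruct (HG eq_refl s) as (v & Hv & Hv2); [lra|].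
      rewrite (is_series_C_unique _ _ _ Hv (phi_val_series d p c1 cp s Hp)), Ephi in Hv2. auto. }
    (* [p d] is the first prime beyond those of [phi], so it bounds them all. *)
    set (P := INR (p d)).
    pose proof (nprime_ge2 _ (Hp d)) as HPd.
    assert (HP : 2 <= P) by (apply (le_INR 2); lia).
    assert (HlnP : 0 < ln P) by (rewrite <- ln_1; apply ln_increasing; lra).
    assert (Hr0 : 0 <= r) by (apply lsum_nonneg; intros; apply Cmod_ge_0).
    assert (Hlow : forall sigma, 0 < sigma -> r * (1 - sigma * ln P) <= Re c1 - 1/2).
    { intros sigma Hs. apply Rle_trans with (2 := Hrho sigma Hs).
      unfold r, rho. rewrite Rmult_comm, <- lsum_scal. apply lsum_le. intros j Hj.
      apply in_seq in Hj. rewrite Rmult_comm. apply Rmult_le_compat_l; [apply Cmod_ge_0|].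
      apply Rle_trans with (Rpower P (- sigma)).
      - unfold Rpower. generalize (exp_ineq (- sigma * ln P)). lra.
      - pose proof (nprime_ge2 _ (Hp j)).
        apply Rpower_base_ge; try lra; [apply lt_0_INR; lia|].
        apply le_INR. apply Nat.lt_le_incl, Hp2. lia. }
    apply Rnot_lt_le. intros Hlt. set (g := r - (Re c1 - 1/2)).
    assert (Hg : 0 < g) by (unfold g; lra).
    (* For this [sigma] the loss [r sigma ln P] is at most [g/2]; [r + 1] in the denominator avoids
       a division by zero. *)
    specialize (Hlow (g / (2 * (r + 1) * ln P))).
    assert (0 < g / (2 * (r + 1) * ln P)).
    { apply Rdiv_lt_0_compat; auto. repeat apply Rmult_lt_0_compat; lra. }
    specialize (Hlow H).
    replace (g / (2 * (r + 1) * ln P) * ln P) with (g / (2 * (r + 1))) in Hlow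
      by (field; split; lra).
    assert (r * (g / (2 * (r + 1))) <= g / 2).
    { replace (r * (g / (2 * (r + 1)))) with (g / 2 - g / (2 * (r + 1))) by (field; lra).
      assert (0 < g / (2 * (r + 1))) by (apply Rdiv_lt_0_compat; lra). lra. }
    unfold g in *. lra.
Qed.

(** * The composition operator in terms of the Poisson functionals *)

(** Summing [2 f <= t A + B/t] and taking the optimal [t = v/a]; when [a = 0], a suitable [t]
    excludes [v > 0]. *)
Lemma has_sum_cauchy_schwarz {T} (f A B : T -> R) v a b :
  (forall x, 0 <= A x) -> (forall x, 0 <= B x) -> (forall x, f x ^ 2 <= A x * B x) ->
  has_sum f v -> has_sum A a -> has_sum B b -> v ^ 2 <= a * b.
Proof.
  intros HA0 HB0 H Hv Ha Hb.
  assert (Hv0 : 0 <= v) by apply (has_sum_ge0 _ _ Hv).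
  assert (Ha0 : 0 <= a) by apply (has_sum_ge0 _ _ Ha).
  assert (Hb0 : 0 <= b) by apply (has_sum_ge0 _ _ Hb).
  assert (Ht : forall t, 0 < t -> 2 * v <= t * a + / t * b).
  { intros t Ht. assert (0 < / t) by now apply Rinv_0_lt_compat.
    apply (has_sum_le (fun x => 2 * f x) (fun x => t * A x + / t * B x)).
    - intros x. apply amgm; auto.
    - apply has_sum_scal; auto; lra.
    - apply has_sum_plus; apply has_sum_scal; auto; lra. }
  destruct (Req_dec v 0) as [->|Hv1]; [nra|].
  destruct (Req_dec a 0) as [E|Ha1].
  - subst a. specialize (Ht ((b + 1) / v)).
    assert (Hq : 0 < (b + 1) / v) by (apply Rdiv_lt_0_compat; lra). specialize (Ht Hq).
    replace (/ ((b + 1) / v) * b) with (v - v / (b + 1)) in Ht by (field; lra).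
    assert (0 < v / (b + 1)) by (apply Rdiv_lt_0_compat; lra). lra.
  - specialize (Ht (v / a)). assert (Hq : 0 < v / a) by (apply Rdiv_lt_0_compat; lra).
    specialize (Ht Hq). replace (v / a * a) with v in Ht by (field; lra).
    assert (v <= / (v / a) * b) by lra.
    apply Rmult_le_compat_l with (r := v) in H0; [|lra].
    replace (v * (/ (v / a) * b)) with (a * b) in H0 by (field; lra). lra.
Qed.

Lemma has_csum_cauchy_schwarz {T} (f : T -> C) (A B : T -> R) v a b :
  (forall x, 0 <= A x) -> (forall x, 0 <= B x) -> (forall x, Cmod (f x) ^ 2 <= A x * B x) ->
  has_csum f v -> has_sum A a -> has_sum B b -> Cmod v ^ 2 <= a * b.
Proof.
  intros HA0 HB0 H Hv Ha Hb. destruct (has_csum_abs _ _ Hv) as (u & Hu).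
  apply Rle_trans with (u ^ 2).
  - apply pow_incr. split; [apply Cmod_ge_0|].
    apply (has_csum_Cmod_le _ _ _ _ (fun x => Rle_refl _) Hu Hv).
  - apply (has_sum_cauchy_schwarz (fun x => Cmod (f x)) A B); auto.
Qed.

(** When [Re c1 = 1/2 + r], the power of [n] has modulus [n^(-1/2)]; the rest of [n^(- c1)] is the
    factor [exp (- r ln n)] inside the Poisson weight. *)
Definition lterm (c1 : C) (r : R) (a : nat -> C) (w n : nat) : C :=
  match n with
  | O => 0%C
  | _ => (a n * cpow_nat n (- (c1 - r)) * pois w (r * ln (INR n)))%C
  end.

Definition lval (c1 : C) (r : R) (a : nat -> C) (w : nat) : C :=
  epsilon (inhabits (RtoC 0)) (fun v => has_csum (lterm c1 r a w) v).

(** The divisor weights cancel between the two factors, and the square of the Poisson weight is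
    shared between them: the first factor then still sums over [w] to the term of the norm of
    [a]. *)
Lemma lterm_sq alpha c1 r a w n : 0 < r -> Re c1 = 1/2 + r ->
  Cmod (lterm c1 r a w n) ^ 2 <=
  (Dnorm_term alpha a n * pois w (r * ln (INR n))) * sterm alpha r w n.
Proof.
  intros Hr Hc. destruct n as [|n].
  { simpl. rewrite Cmod_0. lra. }
  set (N := S n). change (lterm c1 r a w N) with
    (a N * cpow_nat N (- (c1 - r)) * pois w (r * ln (INR N)))%C.
  assert (HN : (1 <= N)%nat) by (unfold N; lia).
  assert (Hp : 0 <= pois w (r * ln (INR N))).
  { apply pois_nonneg, Rmult_le_pos; [lra|apply ln_INR_nonneg]. }
  rewrite !Cmod_mult, Cmod_cpow_nat, Cmod_R, Rabs_pos_eq by auto.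
  replace (Re (- (c1 - r))%C) with (- (1/2)) by (destruct c1; simpl in *; lra).
  rewrite Rpow_mult_distr, (Dnorm_gterm_sq alpha) by auto. unfold sterm.
  replace (2 * (1/2)) with 1 by field. right. ring.
Qed.

Lemma lval_spec alpha c1 r a w : 0 <= alpha -> 0 < r -> Re c1 = 1/2 + r -> inD alpha a ->
  has_csum (lterm c1 r a w) (lval c1 r a w).
Proof.
  intros Ha Hr Hc Hin. unfold lval. apply epsilon_spec.
  apply inD_has_sum in Hin. destruct Hin as (x & Hx).
  destruct (sterm_sum_bound alpha r Ha Hr) as (K & S & _ & HS). destruct (HS w) as [Hw _].
  apply (has_csum_exists _ (fun n => / 2 * (1 * Dnorm_term alpha a n + / 1 * sterm alpha r w n))
    (/ 2 * (1 * x + / 1 * S w))).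
  - intros n.
    assert (Hp : 0 <= r * ln (INR n)) by (apply Rmult_le_pos; [lra|apply ln_INR_nonneg]).
    pose proof (Dnorm_term_nonneg alpha a n) as D0.
    pose proof (sterm_nonneg alpha r w n (Rlt_le _ _ Hr)) as S0.
    assert (H : Cmod (lterm c1 r a w n) ^ 2 <= Dnorm_term alpha a n * sterm alpha r w n).
    { eapply Rle_trans; [now apply (lterm_sq alpha)|]. apply Rmult_le_compat_r; auto.
      rewrite <- (Rmult_1_r (Dnorm_term alpha a n)) at 2.
      apply Rmult_le_compat_l; auto. now apply pois_le_1. }
    pose proof (amgm _ _ _ 1 D0 S0 Rlt_0_1 H). lra.
  - apply has_sum_scal; [lra|]. apply has_sum_plus; apply has_sum_scal; auto; lra.
Qed.

Lemma lval_eq c1 r a w v : has_csum (lterm c1 r a w) v -> lval c1 r a w = v.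
Proof.
  intros H. unfold lval. eapply has_csum_unique; [|exact H]. apply epsilon_spec. now exists v.
Qed.

(** Extension by [0] from the image of [e]. Choice provides a preimage, which is unique for
    injective [e]. *)
Definition pushforward {T} (e : T -> nat) (g : T -> C) (N : nat) : C :=
  match excluded_middle_informative (exists t, e t = N) with
  | left H => g (proj1_sig (constructive_indefinite_description _ H))
  | right _ => 0%C
  end.

Lemma pushforward_eq {T} (e : T -> nat) g t : (forall x y, e x = e y -> x = y) ->
  pushforward e g (e t) = g t.
Proof.
  intros He. unfold pushforward. destruct excluded_middle_informative as [H|H].
  - destruct constructive_indefinite_description as [x Hx]. simpl. f_equal. auto.
  - destruct H. now exists t.
Qed.

Lemma pushforward_out {T} (e : T -> nat) g N : ~ (exists t, e t = N) -> pushforward e g N = 0%C.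
Proof. intros H. unfold pushforward. destruct excluded_middle_informative; tauto. Qed.

(** The coefficients of the composition in terms of the functionals [L]; the factor [w! / r^w]
    undoes the normalization of the Poisson weight and restores [(ln n)^w]. *)
Definition bser (p : nat -> nat) (c : nat -> C) (l : list nat) (r : R) (L : nat -> C) : nat -> C :=
  pushforward (enc p l)
    (fun m => ecoef c l m * RtoC (INR (fact (wt l m)) / r ^ wt l m) * L (wt l m))%C.

(** Multi-indices are grouped by degree by interchanging two sums. Both directions matter, since
    summability has to pass from the composition to the functionals and back. *)
Lemma homog_sum beta c l (w Q : nat -> R) V : (forall j, In j l -> 0 < c j) ->
  (forall n, has_sum (homog beta c l n) (w n)) -> (forall n, 0 <= Q n) ->
  has_sum (fun n => w n * Q n) V <->
  has_sum (fun m => mprod (fun j k => hfac beta (c j) k) l m * Q (wt l m)) V.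
Proof.
  intros Hc Hw HQ.
  assert (H1 : forall n, has_sum (fun m => homog beta c l n m * Q n) (w n * Q n)).
  { intros n. apply has_sum_ext with (fun m => Q n * homog beta c l n m); [intros; ring|].
    rewrite Rmult_comm. now apply has_sum_scal. }
  assert (H2 : forall m, has_sum (fun n => homog beta c l n m * Q n)
            (mprod (fun j k => hfac beta (c j) k) l m * Q (wt l m))).
  { intros m. set (X := mprod (fun j k => hfac beta (c j) k) l m * Q (wt l m)).
    assert (HX : 0 <= X).
    { apply Rmult_le_pos; auto. apply mprod_nonneg. intros; left; apply hfac_pos; auto. }
    apply has_sum_ext with (2 := has_sum_point (wt l m) X HX). intros n. unfold homog.
    destruct excluded_middle_informative as [H|H], (Nat.eqb_spec (wt l m) n) as [E|E];
      try congruence; [now rewrite H|ring]. }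
  split; intros HV.
  - destruct (has_sum_swap (fun n m => homog beta c l n m * Q n) _ V H1 HV) as (h & Hh & HhV).
    apply has_sum_ext with (2 := HhV). intros m. eapply has_sum_unique; [apply Hh|apply H2].
  - destruct (has_sum_swap (fun m n => homog beta c l n m * Q n) _ V H2 HV) as (h & Hh & HhV).
    apply has_sum_ext with (2 := HhV). intros n. eapply has_sum_unique; [apply Hh|apply H1].
Qed.

(** Distinct multi-indices encode distinct integers, so no terms merge; the divisor weight factors
    as [prod_j (k_j + 1)^(- beta)] and joins the squared coefficients in [hfac]. *)
Lemma bser_norm beta p c l r L V :
  (forall j, nprime (p j)) -> NoDup (map p l) ->
  has_sum (Dnorm_term beta (bser p c l r L)) V <->
  has_sum (fun m => mprod (fun j k => hfac beta (Cmod (c j)) k) l m *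
     ((INR (fact (wt l m)) / r ^ wt l m) ^ 2 * Cmod (L (wt l m)) ^ 2)) V.
Proof.
  intros Hp Hl.
  assert (Hp' : forall j, In j l -> nprime (p j)) by auto.
  assert (He : forall x y, enc p l x = enc p l y -> x = y) by (intros; now apply (enc_inj p l)).
  rewrite <- (has_sum_inj (enc p l) (Dnorm_term beta (bser p c l r L)) V He).
  - assert (E : forall m, Dnorm_term beta (bser p c l r L) (enc p l m) =
      mprod (fun j k => hfac beta (Cmod (c j)) k) l m *
       ((INR (fact (wt l m)) / r ^ wt l m) ^ 2 * Cmod (L (wt l m)) ^ 2)).
    { intros m. rewrite Dnorm_term_pos by (now apply enc_pos).
      unfold bser. rewrite pushforward_eq by auto.
      rewrite !Cmod_mult, Cmod_ecoef, Cmod_R, !Rpow_mult_distr, pow2_abs.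
      rewrite ndivisors_enc, Rpower_mprod by (auto; intros; apply lt_0_INR; lia).
      unfold hfac. rewrite (mprod_mult (fun j k => (Cmod (c j) ^ k / INR (fact k)) ^ 2)).
      replace (mprod (fun j k => (Cmod (c j) ^ k / INR (fact k)) ^ 2) l m) with
        (mprod (fun j k => Cmod (c j) ^ k / INR (fact k)) l m ^ 2); [ring|].
      simpl. rewrite Rmult_1_r, <- mprod_mult. apply mprod_ext. intros; ring. }
    split; intros H; (eapply has_sum_ext; [|exact H]); intros m; cbv beta;
      rewrite E; reflexivity.
  - apply Dnorm_term_nonneg.
  - intros N. destruct (classic (exists t, enc p l t = N)) as [|HN]; auto. right.
    destruct N as [|N]; [reflexivity|]. rewrite Dnorm_term_pos by lia.
    unfold bser. rewrite pushforward_out, Cmod_0 by auto. simpl. ring.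
Qed.

(** Fubini's theorem in [n] and the multi-index. For fixed [n] the moduli sum to [|a_n| n^(- u)]
    with [u = Re c1 - rho(Re s)], and [u > 1/2] because every prime with [c_j <> 0] makes [rho]
    strictly smaller than [r] when [Re s > 0]. *)
Lemma bser_represents (alpha : R) (d : nat) (p : nat -> nat) (c1 : C) (c : nat -> C) a s :
  0 <= alpha -> (forall j, nprime (p j)) -> NoDup (map p (seq 0 d)) ->
  0 < lsum (fun j => Cmod (c j)) (seq 0 d) ->
  Re c1 = 1/2 + lsum (fun j => Cmod (c j)) (seq 0 d) -> inD alpha a -> 0 < Re s ->
  let r := lsum (fun j => Cmod (c j)) (seq 0 d) in
  exists v, has_csum (DS_term a (phi_val d p c1 c s)) v /\
            has_csum (DS_term (bser p c (seq 0 d) r (lval c1 r a)) s) v.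
Proof.
  intros Hal Hp Hl Hr Hc Hin Hs r. set (l := seq 0 d) in *. fold r in Hr, Hc.
  assert (Hp' : forall j, In j l -> nprime (p j)) by auto.
  pose (F := fun (n : nat) (m : midx l) => match n return C with O => 0%C | _ =>
    (a n * cpow_nat n (- c1) * (ecoef c l m * RtoC (ln (INR n)) ^ wt l m *
       cpow_nat (enc p l m) (- s)))%C end).
  set (u := Re c1 - rho p c l (Re s)).
  assert (Hu : 1/2 < u).
  { unfold u. rewrite Hc. assert (rho p c l (Re s) < r); [|lra].
    unfold r, rho. fold l. revert Hr. unfold r. fold l. clear - Hp Hs.
    assert (Q : forall l, lsum (fun j => Cmod (c j) * Rpower (INR (p j)) (- Re s)) l <=
                          lsum (fun j => Cmod (c j)) l /\
      (0 < lsum (fun j => Cmod (c j)) l -> lsum (fun j => Cmod (c j) * Rpower (INR (p j)) (- Re s)) l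
        < lsum (fun j => Cmod (c j)) l)).
    { induction l0 as [|j l0 [I1 I2]]; simpl; [split; lra|].
      pose proof (nprime_ge2 _ (Hp j)) as H2. pose proof (Cmod_ge_0 (c j)) as H0.
      assert (Hlt : Rpower (INR (p j)) (- Re s) < 1).
      { rewrite <- (Rpower_O (INR (p j))) by (apply lt_0_INR; lia).
        apply Rpower_lt; [apply (lt_INR 1); lia|lra]. }
      split; [nra|]. intros Hpos. destruct (Req_dec (Cmod (c j)) 0) as [E|E].
      - rewrite E in *. rewrite Rmult_0_l. assert (0 < lsum (fun j => Cmod (c j)) l0) by lra.
        specialize (I2 H). lra.
      - assert (Cmod (c j) * Rpower (INR (p j)) (- Re s) < Cmod (c j) * 1)
          by (apply Rmult_lt_compat_l; lra). lra. }
    apply Q. }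
  destruct (Dnorm_abs_convergence alpha a u Hal Hu Hin) as (A & HA).
  destruct (has_csum_swap F
    (fun n => match n with O => 0 | _ => Cmod (a n) * Rpower (INR n) (- u) end)
    (DS_term a (phi_val d p c1 c s)) A)
    as (k & v & Hk & Hkv & Hv).
  - intros [|n].
    + apply has_sum_ext with (fun _ => 0); [|apply has_sum_zero].
      intros m. simpl. now rewrite Cmod_0.
    + set (N := S n).
      assert (E : Cmod (a N) * Rpower (INR N) (- u) = Cmod (a N) * Rpower (INR N) (- Re c1) *
         exp (ln (INR N) * rho p c l (Re s))).
      { rewrite Rmult_assoc. f_equal. unfold Rpower, u. rewrite <- exp_plus. f_equal. ring. }
      rewrite E. apply has_sum_ext with (fun m => Cmod (a N) * Rpower (INR N) (- Re c1) *
        Cmod (ecoef c l m * RtoC (ln (INR N)) ^ wt l m * cpow_nat (enc p l m) (- s))%C).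
      * intros m. unfold F, N. rewrite (Cmod_mult (a (S n) * _)), (Cmod_mult (a (S n))).
        rewrite Cmod_cpow_nat by lia. reflexivity.
      * apply has_sum_scal; [apply Rmult_le_pos; [apply Cmod_ge_0|left; apply Rpower_pos]|].
        apply exp_expansion_Cmod; auto. apply ln_INR_nonneg.
  - exact HA.
  - intros [|n].
    + split; simpl; apply has_rsum_of_sum, has_sum_zero.
    + rewrite DS_term_pos by lia. set (N := S n).
      replace (cpow_nat N (- phi_val d p c1 c s))%C with (cpow_nat N (- c1) *
        cexp (- (RtoC (ln (INR N)) * clsum (fun j => c j * cpow_nat (p j) (- s)) l)))%C.
      * rewrite Cmult_assoc. apply has_csum_scal, exp_expansion; auto.
      * unfold phi_val. rewrite csum_clsum, !cpow_nat_cexp, <- cexp_plus. f_equal. fold l. ring.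
  - exists v. split; auto.
    apply (has_csum_inj (enc p l)).
    + intros x y. now apply (enc_inj p l).
    + intros N. destruct (classic (exists t, enc p l t = N)) as [|HN]; auto. right.
      destruct N as [|N]; [reflexivity|]. rewrite DS_term_pos by lia.
      unfold bser. rewrite pushforward_out by auto. ring.
    + apply has_csum_ext with (2 := Hkv). intros m.
      apply (has_csum_unique _ _ _ (Hk m)).
      rewrite DS_term_pos by (now apply enc_pos). unfold bser.
      rewrite pushforward_eq by (intros; now apply (enc_inj p l)).
      set (W := wt l m).
      replace (ecoef c l m * RtoC (INR (fact W) / r ^ W) * lval c1 r a W * cpow_nat (enc p l m) (- s))%C
        with (ecoef c l m * RtoC (INR (fact W) / r ^ W) * cpow_nat (enc p l m) (- s) * lval c1 r a W)%C
        by ring.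
      apply has_csum_ext with (fun n => ecoef c l m * RtoC (INR (fact W) / r ^ W) *
         cpow_nat (enc p l m) (- s) * lterm c1 r a W n)%C.
      * intros [|n]; [simpl; ring|]. set (N := S n).
        change (lterm c1 r a W N) with
          (a N * cpow_nat N (- (c1 - r)) * pois W (r * ln (INR N)))%C.
        change (F N m) with (a N * cpow_nat N (- c1) * (ecoef c l m * RtoC (ln (INR N)) ^ W *
             cpow_nat (enc p l m) (- s)))%C.
        assert (E : (cpow_nat N (- (c1 - r)) * RtoC (exp (- (r * ln (INR N)))) = cpow_nat N (- c1))%C).
        { replace (RtoC (exp (- (r * ln (INR N))))) with (cexp (- (r * ln (INR N)))%R).
          - rewrite !cpow_nat_cexp, <- cexp_plus. f_equal.
            rewrite RtoC_opp, RtoC_mult. ring.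
          - unfold cexp. simpl. rewrite cos_0, sin_0. unfold RtoC. f_equal; ring. }
        rewrite <- E. unfold pois. rewrite RtoC_mult, <- RtoC_pow.
        assert (Er : (RtoC (INR (fact W) / r ^ W) * RtoC ((r * ln (INR N)) ^ W / INR (fact W))
                     = RtoC (ln (INR N) ^ W))%C).
        { rewrite <- RtoC_mult. f_equal. rewrite Rpow_mult_distr. field.
          split; [apply INR_fact_neq_0|apply pow_nonzero; lra]. }
        rewrite <- Er. ring.
      * apply has_csum_scal. now apply (lval_spec alpha).
Qed.

(* [bs L] is the Dirichlet series with functionals [L], and [lval c1 r a] are those of [f o phi]. *)
Record comp_model (alpha beta : R) (phi : C -> C) (c1 : C) (r K kp : R) (omega : nat -> R)
    (bs : (nat -> C) -> nat -> C) : Prop := {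
  cm_r : 0 < r;
  cm_c1 : Re c1 = 1/2 + r;
  cm_K : 0 < K;
  cm_omega : forall n,
    / K * Rpower (INR (S n)) (- kp) <= omega n <= K * Rpower (INR (S n)) (- kp);
  cm_norm : forall L V, has_sum (Dnorm_term beta (bs L)) V <->
                        has_sum (fun n => omega n * Cmod (L n) ^ 2) V;
  cm_sub : forall L L' n, bs (fun k => L k - L' k)%C n = (bs L n - bs L' n)%C;
  cm_coef : forall n, exists w D, 0 <= D /\ forall L, Cmod (bs L n) <= D * Cmod (L w);
  cm_rep : forall a, inD alpha a -> represents phi a (bs (lval c1 r a));
  cm_unique : forall a b, inD alpha a -> inD beta b -> represents phi a b ->
    forall n, (1 <= n)%nat -> b n = bs (lval c1 r a) n
}.

Arguments cm_r {_ _ _ _ _ _ _ _ _} _.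
Arguments cm_c1 {_ _ _ _ _ _ _ _ _} _.
Arguments cm_K {_ _ _ _ _ _ _ _ _} _.
Arguments cm_omega {_ _ _ _ _ _ _ _ _} _.
Arguments cm_norm {_ _ _ _ _ _ _ _ _} _.
Arguments cm_coef {_ _ _ _ _ _ _ _ _} _.
Arguments cm_rep {_ _ _ _ _ _ _ _ _} _.
Arguments cm_sub {_ _ _ _ _ _ _ _ _} _.
Arguments cm_unique {_ _ _ _ _ _ _ _ _} _ {_ _}.

Lemma composition_model (alpha beta : R) (d : nat) (p : nat -> nat) (c1 : C) (c : nat -> C) :
  0 <= alpha -> 0 <= beta -> (1 <= d)%nat -> enumerates_primes p ->
  GH_class 0 (phi_coef d p c1 c) -> unrestricted_range (phi_val d p c1 c) ->
  (forall j, (j < d)%nat -> c j <> 0%C) ->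
  exists r K omega bs, comp_model alpha beta (phi_val d p c1 c) c1 r K
    ((INR d - 1) / 2 + beta * INR d) omega bs.
Proof.
  intros Hal Hbe Hd Hen HG Hu Hc. set (phi := phi_val d p c1 c).
  set (kp := (INR d - 1) / 2 + beta * INR d).
  pose proof (constant_term d p c1 c Hen HG Hu) as Hc1.
  destruct Hen as (Hp1 & Hp2 & _).
  assert (Hp : forall j, nprime (p j)) by exact Hp1.
  set (l := seq 0 d) in *.
  assert (Hl : NoDup (map p l)).
  { apply NoDup_map_NoDup_ForallPairs; [|apply seq_NoDup].
    intros x y _ _ E. destruct (lt_eq_lt_dec x y) as [[H|]|H]; auto; apply Hp2 in H; lia. }
  assert (Hcl : forall j, In j l -> 0 < Cmod (c j)).
  { intros j Hj. apply in_seq in Hj. apply Cmod_gt_0, Hc. lia. }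
  destruct (weight_bounds beta (fun j => Cmod (c j)) l Hbe) as (w & K & HK & Hr & Hw); auto.
  { unfold l. destruct d; [lia|discriminate]. }
  set (r := lsum (fun j => Cmod (c j)) l) in *.
  assert (Hrep : forall a s, inD alpha a -> 0 < Re s ->
     exists v, has_csum (DS_term a (phi s)) v /\ has_csum (DS_term (bser p c l r (lval c1 r a)) s) v).
  { intros a s Ha Hs. now apply (bser_represents alpha). }
  (* [(n!/r^n)^2] cancels the factor [(r^n/n!)^2] of [hfac], so that [omega n] is comparable to a
     pure power of [n + 1]. *)
  exists r, K, (fun n => w n * (INR (fact n) / r ^ n) ^ 2), (bser p c l r).
  split; [auto|auto|auto| | | | | |].
  - intros n. destruct (Hw n) as (_ & H1 & H2).
    assert (E : hfac (kappa beta l) r n * (INR (fact n) / r ^ n) ^ 2 = Rpower (INR (S n)) (- kp)).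
    { unfold hfac. replace (kappa beta l) with kp by (unfold kappa, l; now rewrite length_seq).
      field. split; [apply pow_nonzero; lra|apply INR_fact_neq_0]. }
    pose proof (pow2_ge_0 (INR (fact n) / r ^ n)) as Q.
    rewrite <- E, <- !Rmult_assoc.
    split; apply Rmult_le_compat_r; auto.
  - intros L V. rewrite (bser_norm beta p c l r L V Hp Hl).
    rewrite <- (homog_sum beta (fun j => Cmod (c j)) l w
      (fun n => (INR (fact n) / r ^ n) ^ 2 * Cmod (L n) ^ 2) V); auto.
    + split; intros H; (eapply has_sum_ext; [|exact H]); intros n; cbv beta; ring.
    + intros n; apply Hw.
    + intros n. apply Rmult_le_pos; apply pow2_ge_0.
  - intros L L' n. unfold bser. destruct (classic (exists t, enc p l t = n)) as [[t <-]|Hn].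
    + rewrite !pushforward_eq by (intros; now apply (enc_inj p l)). ring.
    + rewrite !pushforward_out by auto. ring.
  - intros n. destruct (classic (exists t, enc p l t = n)) as [[t <-]|Hn].
    + exists (wt l t), (Cmod (ecoef c l t * RtoC (INR (fact (wt l t)) / r ^ wt l t))%C).
      split; [apply Cmod_ge_0|]. intros L. unfold bser.
      rewrite pushforward_eq by (intros; now apply (enc_inj p l)). rewrite Cmod_mult. lra.
    + exists 0%nat, 0. split; [lra|]. intros L. unfold bser.
      rewrite pushforward_out, Cmod_0 by auto. lra.
  - intros a Ha s Hs. destruct (Hrep a s Ha) as (v & H1 & H2); [lra|].
    exists v. split; now apply has_csum_series.
  - intros a b Ha Hb Hab n Hn.
    assert (Hz : (b n - bser p c l r (lval c1 r a) n)%C = 0%C).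
    { apply (DS_coef_zero (fun n => b n - bser p c l r (lval c1 r a) n)%C); auto.
      intros s Hs. destruct (Hrep a s Ha) as (v & H1 & H2); [simpl; lra|].
      destruct (Hab s) as (v' & H3 & H4); [simpl; lra|].
      destruct (DS_csum beta b s Hbe Hb) as (v'' & H5); [simpl; lra|].
      assert (E1 : v' = v) by exact (is_series_C_unique _ _ _ H3 (has_csum_series _ _ H1)).
      assert (E2 : v'' = v') by exact (is_series_C_unique _ _ _ (has_csum_series _ _ H5) H4).
      subst v'' . rewrite E1 in H5.
      apply (has_csum_scal (- (1))%C) in H2.
      apply has_csum_ext with
        (fun n => DS_term b s n + - (1) * DS_term (bser p c l r (lval c1 r a)) s n)%C.
      - intros [|k]; [simpl; ring|]. rewrite !DS_term_pos by lia. ring.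
      - replace (RtoC 0) with (v + - (1) * v)%C by ring. now apply has_csum_plus. }
    apply (f_equal (fun z => z + bser p c l r (lval c1 r a) n)%C) in Hz.
    replace (b n - bser p c l r (lval c1 r a) n + bser p c l r (lval c1 r a) n)%C
      with (b n) in Hz by ring. rewrite Hz. ring.
Qed.

(** * Boundedness and compactness *)

(** [X n] is the part of the squared norm of [a] carried by the Poisson weight [n]; these parts add
    up to [N] because the weights have total mass [1]. Boundedness and tails are both read off from
    this pointwise form. *)
Lemma lval_energy alpha c1 r (omega : nat -> R) K kp :
  0 <= alpha -> 0 < r -> Re c1 = 1/2 + r -> 0 < K ->
  (forall n, 0 <= omega n <= K * Rpower (INR (S n)) (- kp)) ->
  exists D, 0 < D /\ forall a N, has_sum (Dnorm_term alpha a) N ->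
    exists X, has_sum X N /\ forall n, omega n * Cmod (lval c1 r a n) ^ 2 <=
      D * Rpower (INR (S n)) (Rpower 2 alpha - 1 - kp) * X n.
Proof.
  intros Ha Hr Hc HK Hom.
  destruct (sterm_sum_bound alpha r Ha Hr) as (D & S' & HD & HS).
  exists (K * D). split; [nra|]. intros a N HN.
  assert (Hin : inD alpha a) by (apply inD_has_sum; eauto).
  assert (Hln : forall k, 0 <= r * ln (INR k)).
  { intros k. apply Rmult_le_pos; [lra|apply ln_INR_nonneg]. }
  destruct (has_sum_swap (fun k n => Dnorm_term alpha a k * pois n (r * ln (INR k)))
    (Dnorm_term alpha a) N) as (X & HX & HXN); auto.
  { intros k.
    refine (eq_rect _ (has_sum _) (has_sum_scal _ _ 1 _ _) _ (Rmult_1_r _));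
      [apply Dnorm_term_nonneg|now apply has_sum_pois]. }
  exists X. split; auto. intros n. destruct (HS n) as [HSn Hle].
  assert (HX0 : 0 <= X n) by apply (has_sum_ge0 _ _ (HX n)).
  assert (Hl : Cmod (lval c1 r a n) ^ 2 <= X n * S' n).
  { apply (has_csum_cauchy_schwarz (lterm c1 r a n)
      (fun k => Dnorm_term alpha a k * pois n (r * ln (INR k))) (sterm alpha r n)); auto.
    - intros k. apply Rmult_le_pos; [apply Dnorm_term_nonneg|now apply pois_nonneg].
    - intros k. apply sterm_nonneg; lra.
    - intros k. now apply lterm_sq.
    - now apply (lval_spec alpha). }
  set (u := INR (S n)) in *.
  apply Rle_trans with (K * Rpower u (- kp) * (X n * (D * Rpower u (Rpower 2 alpha - 1)))).
  - apply Rmult_le_compat; try apply Hom; [apply pow2_ge_0|].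
    apply Rle_trans with (1 := Hl). now apply Rmult_le_compat_l.
  - right. unfold Rminus at 2. rewrite (Rpower_plus _ (- kp)). ring.
Qed.

(** One limit is built coordinate by coordinate. The invariant [P M L] asks for arbitrarily late
    indices at which the first [M] coordinates are simultaneously close to [L], and is extended from
    [M] to [M + 1]. *)
Lemma cluster_point (u : nat -> nat -> R) :
  (forall n, exists B, forall k, Rabs (u k n) <= B) ->
  exists L : nat -> R, forall M eps N, 0 < eps ->
    exists k, (N <= k)%nat /\ forall n, (n < M)%nat -> Rabs (u k n - L n) < eps.
Proof.
  intros HB.
  pose (P := fun (M : nat) (L : nat -> R) => forall eps N, 0 < eps ->
    exists k, (N <= k)%nat /\ forall n, (n < M)%nat -> Rabs (u k n - L n) < eps).
  pose (upd := fun (L : nat -> R) M x n => if Nat.eqb n M then x else L n).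
  assert (Step : forall M L, P M L -> exists x, P (S M) (upd L M x)).
  { intros M L HP. destruct (HB M) as (B & HBM).
    (* The supremum of [E] is the limit superior of coordinate [M] along indices whose first [M]
       coordinates approach [L]. *)
    pose (E := fun t => forall eps N, 0 < eps -> exists k, (N <= k)%nat /\
      (forall n, (n < M)%nat -> Rabs (u k n - L n) < eps) /\ t <= u k M).
    assert (HE0 : E (- B)).
    { intros eps N He. destruct (HP eps N He) as (k & Hk & Hn). exists k. split; [|split]; auto.
      specialize (HBM k). apply Rabs_le_between in HBM. lra. }
    destruct (completeness E) as (x & Hx1 & Hx2).
    - exists B. intros t Ht. destruct (Ht 1 0%nat Rlt_0_1) as (k & _ & _ & Hk).
      specialize (HBM k). apply Rabs_le_between in HBM. lra.
    - now exists (- B).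
    - exists x. intros eps N He.
      assert (Hlow : exists t, E t /\ x - eps < t).
      { apply NNPP. intros Hn. assert (x <= x - eps); [|lra]. apply Hx2. intros t Ht.
        apply Rnot_lt_le. intros Hlt. apply Hn. now exists t. }
      destruct Hlow as (t & Ht & Hlt).
      assert (Hup : ~ E (x + eps)) by (intros Hn; specialize (Hx1 _ Hn); lra).
      apply not_all_ex_not in Hup. destruct Hup as (e' & Hup).
      apply not_all_ex_not in Hup. destruct Hup as (N' & Hup).
      apply imply_to_and in Hup. destruct Hup as (He' & Hup).
      destruct (Ht (Rmin eps e') (max N N')) as (k & Hk & Hk1 & Hk2).
      { now apply Rmin_glb_lt. }
      exists k. split; [lia|]. intros n Hn. unfold upd. destruct (Nat.eqb_spec n M) as [->|HnM].
      + apply Rabs_def1; [|lra]. apply Rnot_le_lt. intros Hge. apply Hup. exists k.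
        split; [lia|]. split; [|lra].
        intros n Hn'. apply Rlt_le_trans with (1 := Hk1 n Hn'). apply Rmin_r.
      + apply Rlt_le_trans with (2 := Rmin_l eps e'). apply Hk1. lia. }
  pose (G := fix G (M : nat) : nat -> R := match M with
    | O => fun _ => 0
    | S M => upd (G M) M (epsilon (inhabits 0) (fun x => P (S M) (upd (G M) M x))) end).
  assert (HG : forall M, P M (G M)).
  { induction M as [|M IH].
    - intros eps N He. exists N. split; [lia|]. intros; lia.
    - change (G (S M)) with
        (upd (G M) M (epsilon (inhabits 0) (fun x => P (S M) (upd (G M) M x)))).
      apply (epsilon_spec (inhabits 0) (fun x => P (S M) (upd (G M) M x))). now apply Step. }
  assert (HGn : forall M n, (n < M)%nat -> G M n = G (S n) n).
  { induction M as [|M IH]; intros n Hn; [lia|].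
    destruct (Nat.eq_dec n M) as [->|Hne]; [reflexivity|].
    rewrite <- IH by lia. simpl. unfold upd at 1. destruct (Nat.eqb_spec n M); [lia|reflexivity]. }
  exists (fun n => G (S n) n). intros M eps N He. destruct (HG M eps N He) as (k & Hk & Hn).
  exists k. split; auto. intros n HnM. rewrite <- (HGn M n HnM). auto.
Qed.

(** Real and imaginary parts are interleaved as even and odd coordinates, which reduces the
    extraction to the real cluster point; the [j]-th index makes the first [j] complex coordinates
    accurate to [2/(j+1)]. *)
Lemma bounded_subsequence (u : nat -> nat -> C) :
  (forall n, exists B, forall k, Cmod (u k n) <= B) ->
  exists (sigma : nat -> nat) (L : nat -> C), (forall k, (sigma k < sigma (S k))%nat) /\
    forall n eps, 0 < eps -> exists K, forall k, (K <= k)%nat -> Cmod (u (sigma k) n - L n)%C < eps.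
Proof.
  intros HB.
  pose (v := fun k n => if Nat.even n then Re (u k (Nat.div2 n)) else Im (u k (Nat.div2 n))).
  destruct (cluster_point v) as (L & HL).
  { intros n. destruct (HB (Nat.div2 n)) as (B & HBn). exists B. intros k. unfold v.
    destruct (Nat.even n); (eapply Rle_trans; [|apply HBn]); [apply re_le_Cmod|apply im_le_Cmod]. }
  pose (Lc := fun n => (L (2 * n)%nat, L (2 * n + 1)%nat) : C).
  assert (Hstep : forall j N, exists k, (N <= k)%nat /\
     forall n, (n < j)%nat -> Cmod (u k n - Lc n)%C < 2 * / INR (S j)).
  { intros j N. destruct (HL (2 * j)%nat (/ INR (S j)) N) as (k & Hk & Hn).
    { apply Rinv_0_lt_compat, lt_0_INR; lia. }
    exists k. split; auto. intros n Hnj.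
    pose proof (Hn (2 * n)%nat ltac:(lia)) as A1. pose proof (Hn (2 * n + 1)%nat ltac:(lia)) as A2.
    unfold v in A1, A2.
    rewrite Nat.even_mul in A1. rewrite Nat.even_add, Nat.even_mul in A2. cbn in A1, A2.
    rewrite !Nat.add_0_r in *. replace (n + n)%nat with (2 * n)%nat in * by lia.
    rewrite Nat.div2_double in A1. rewrite Nat.add_1_r, Nat.div2_succ_double in A2.
    eapply Rle_lt_trans; [apply Cmod_2Rmax|].
    assert (S2 : sqrt 2 <= 2).
    { rewrite <- (sqrt_square 2) at 2 by lra. apply sqrt_le_1_alt. lra. }
    assert (Hm : Rmax (Rabs (fst (u k n - Lc n)%C)) (Rabs (snd (u k n - Lc n)%C)) < / INR (S j)).
    { apply Rmax_lub_lt.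
      - exact A1.
      - replace (snd (u k n - Lc n)%C) with (Im (u k n) - L (S (2 * n))); auto.
        unfold Lc. simpl. rewrite Nat.add_1_r. reflexivity. }
    assert (0 <= Rmax (Rabs (fst (u k n - Lc n)%C)) (Rabs (snd (u k n - Lc n)%C))).
    { eapply Rle_trans; [apply Rabs_pos|apply Rmax_l]. }
    pose proof (sqrt_pos 2). nra. }
  pose (g := fun j N => proj1_sig (constructive_indefinite_description _ (Hstep j N))).
  assert (Hg : forall j N, (N <= g j N)%nat /\
     forall n, (n < j)%nat -> Cmod (u (g j N) n - Lc n)%C < 2 * / INR (S j)).
  { intros j N. unfold g. now destruct constructive_indefinite_description. }
  pose (sigma := fix sigma (j : nat) : nat := match j with
    | O => g 0%nat 0%nat | S j => g (S j) (S (sigma j)) end).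
  assert (Hsig : forall j, exists N, sigma j = g j N).
  { intros [|j]; simpl; eauto. }
  exists sigma, Lc. split.
  - intros k. simpl. destruct (Hg (S k) (S (sigma k))). lia.
  - intros n eps He. destruct (nfloor_ex (2 / eps)) as (N & HN).
    { apply Rlt_le, Rdiv_lt_0_compat; lra. }
    exists (max (S n) N). intros k Hk. destruct (Hsig k) as (N' & ->).
    eapply Rlt_trans; [apply (Hg k N'); lia|].
    assert (HkN : INR N <= INR k) by (apply le_INR; lia).
    assert (Hk0 : 0 < INR (S k)) by (apply lt_0_INR; lia).
    apply Rmult_lt_reg_r with (INR (S k)); auto. rewrite Rmult_assoc, Rinv_l by lra.
    assert (2 / eps < INR (S k)) by (rewrite S_INR; lra).
    apply Rmult_lt_compat_l with (r := eps) in H; auto.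
    replace (eps * (2 / eps)) with 2 in H by (field; lra). lra.
Qed.

(** Half of the exponential pays for the power, since [n^k] is at most a multiple of
    [delta^(- k) exp (delta n)]; the other half leaves a geometric series of size [1/delta]. This is
    the dual weight in the necessity argument. *)
Lemma inv_weight_sum (k : R) : 0 <= k -> exists D, 0 < D /\ forall delta, 0 < delta <= 1 ->
  exists v, has_sum (fun n => Rpower (INR (S n)) k * exp (- (2 * delta * INR n))) v /\
    v <= D * Rpower delta (- (k + 1)).
Proof.
  intros Hk. destruct (Rpower_le_exp k Hk) as (K & HK & HE).
  exists (K * exp 1 * 2). pose proof (exp_pos 1). split; [nra|]. intros delta Hd.
  assert (Hq : 0 < exp (- delta) < 1).
  { split; [apply exp_pos|]. rewrite <- exp_0. apply exp_increasing. lra. }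
  assert (Hq2 : / (1 - exp (- delta)) <= 2 * / delta).
  { replace (2 * / delta) with (/ (delta / 2)) by (field; lra).
    apply Rinv_le_contravar; [lra|]. rewrite exp_Ropp.
    assert (/ exp delta <= / (1 + delta)) by (apply Rinv_le_contravar; [lra|apply exp_ineq]).
    assert (delta / 2 <= 1 - / (1 + delta)); [|lra].
    apply Rmult_le_reg_r with (1 + delta); [lra|].
    rewrite Rmult_minus_distr_r, Rinv_l by lra. nra. }
  assert (HP : 0 < Rpower delta (- k)) by apply Rpower_pos.
  set (c := K * exp 1 * Rpower delta (- k)).
  assert (Hc : 0 < c) by (unfold c; repeat apply Rmult_lt_0_compat; auto).
  destruct (has_sum_dom (fun n => Rpower (INR (S n)) k * exp (- (2 * delta * INR n)))
    (fun n => c * exp (- delta) ^ n) (c * / (1 - exp (- delta)))) as (v & Hv & Hle).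
  - intros n. pose proof (exp_pos (- (2 * delta * INR n))).
    split; [apply Rmult_le_pos; [left; apply Rpower_pos|lra]|].
    assert (Hn : 0 < INR (S n)) by (apply lt_0_INR; lia).
    specialize (HE (delta * INR (S n)) ltac:(nra)).
    rewrite <- Rpower_mult_distr in HE by lra.
    assert (H1 : Rpower (INR (S n)) k <= Rpower delta (- k) * (K * exp (delta * INR (S n)))).
    { apply Rmult_le_reg_l with (Rpower delta k); [apply Rpower_pos|].
      rewrite <- Rmult_assoc, <- Rpower_plus, Rplus_opp_r, Rpower_O, Rmult_1_l by lra. auto. }
    apply Rle_trans with
      (Rpower delta (- k) * (K * exp (delta * INR (S n))) * exp (- (2 * delta * INR n))).
    { apply Rmult_le_compat_r; lra. }
    apply Rle_trans with (Rpower delta (- k) * (K * (exp 1 * exp (- delta) ^ n))).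
    2:{ unfold c. right; ring. }
    rewrite Rmult_assoc, (Rmult_assoc K), <- exp_plus.
    apply Rmult_le_compat_l; [lra|]. apply Rmult_le_compat_l; [lra|].
    rewrite <- Rpower_pow by apply exp_pos. unfold Rpower. rewrite ln_exp, <- exp_plus.
    apply exp_le_compat. rewrite S_INR. lra.
  - apply has_sum_scal; [lra|]. apply has_sum_geom. lra.
  - exists v. split; auto. apply Rle_trans with (1 := Hle).
    apply Rle_trans with (c * (2 * / delta)); [apply Rmult_le_compat_l; lra|].
    right. unfold c. replace (- (k + 1)) with (- k + - (1)) by ring.
    rewrite Rpower_plus, (Rpower_Ropp delta 1), Rpower_1 by lra. ring.
Qed.

(** Besides the modulus, the exponent carries the phase of [n^(c1 - r)]: it cancels the phase in
    [lterm], so that every functional is a sum of nonnegative terms and becomes a Poisson average of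
    the divisor series. *)
Definition test_seq (alpha : R) (c1 : C) (r delta : R) (n : nat) : C :=
  match n with
  | O => 0%C
  | _ => (RtoC (Rpower (INR (ndivisors n)) alpha) * cpow_nat n (c1 - r - 1 - delta))%C
  end.

Lemma test_seq_norm alpha c1 r delta n : Re c1 = 1/2 + r ->
  Dnorm_term alpha (test_seq alpha c1 r delta) n = gterm alpha (1 + 2 * delta) n.
Proof.
  intros Hc. destruct n as [|n]; [reflexivity|].
  rewrite Dnorm_term_pos, gterm_pos_eq by lia.
  change (test_seq alpha c1 r delta (S n)) with
    (RtoC (Rpower (INR (ndivisors (S n))) alpha) * cpow_nat (S n) (c1 - r - 1 - delta))%C.
  rewrite Cmod_mult, Cmod_R, Rabs_pos_eq, Cmod_cpow_nat by (try lia; left; apply Rpower_pos).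
  replace (Re (c1 - r - 1 - delta)%C) with (- (1/2) - delta) by (destruct c1; simpl in *; lra).
  generalize (INR (ndivisors (S n))) (INR (S n)). intros x y.
  unfold Rpower. simpl. rewrite Rmult_1_r, <- !exp_plus. f_equal. field.
Qed.

Lemma test_seq_lterm alpha c1 r delta w n :
  lterm c1 r (test_seq alpha c1 r delta) w n =
  RtoC (gterm alpha (1 + delta) n * pois w (r * ln (INR n))).
Proof.
  destruct n as [|n]; [simpl; f_equal; ring|]. rewrite gterm_pos_eq by lia.
  set (N := S n).
  change (lterm c1 r (test_seq alpha c1 r delta) w N) with
    (RtoC (Rpower (INR (ndivisors N)) alpha) * cpow_nat N (c1 - r - 1 - delta) *
     cpow_nat N (- (c1 - r)) * pois w (r * ln (INR N)))%C.
  rewrite !RtoC_mult. f_equal. rewrite <- Cmult_assoc, <- cpow_nat_plus. f_equal.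
  replace (c1 - r - 1 - delta + - (c1 - r))%C with (RtoC (- (1 + delta))).
  - unfold cpow_nat, Rpower, RtoC. simpl. rewrite Rmult_0_l, cos_0, sin_0. f_equal; ring.
  - rewrite RtoC_opp, RtoC_plus. ring.
Qed.

Lemma has_csum_RtoC {T} (f : T -> R) v : has_sum f v -> has_csum (fun x => RtoC (f x)) (RtoC v).
Proof.
  intros H. split; simpl; apply has_rsum_of_sum; [auto|apply has_sum_zero].
Qed.

(** The Cauchy-Schwarz inequality is used backwards. The Abel sum of the functionals at
    [z = exp (- delta)] is the divisor series at [1 + delta + r (1 - z)], of size at least
    [delta^(- A)]; the dual sum of [z^(2n) / omega n] is at most of size [delta^(- (kp + 1))]. The
    square of the first over the second bounds the squared norm of the composition from below. *)
Lemma test_seq_bounds alpha c1 r (omega : nat -> R) K kp :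
  0 <= alpha -> 0 < r -> Re c1 = 1/2 + r -> 0 < K -> 0 <= kp ->
  (forall n, / K * Rpower (INR (S n)) (- kp) <= omega n) ->
  exists D delta0 S0, 0 < D /\ 0 < delta0 <= 1 /\ forall delta, 0 < delta <= delta0 ->
    let a := test_seq alpha c1 r delta in
    exists N, has_sum (Dnorm_term alpha a) N /\
      / D * Rpower delta (- Rpower 2 alpha) <= N <= D * Rpower delta (- Rpower 2 alpha) /\
      (forall w, Cmod (lval c1 r a w) <= S0 w) /\
      (forall V, has_sum (fun n => omega n * Cmod (lval c1 r a n) ^ 2) V ->
         / D * Rpower delta (kp + 1 - 2 * Rpower 2 alpha) <= V).
Proof.
  intros Ha Hr Hc HK Hkp Hom. set (A := Rpower 2 alpha).
  assert (HA : 0 < A) by apply Rpower_pos.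
  destruct (ndivisors_series_bounds alpha Ha) as (G & HG & HGb). fold A in HGb.
  destruct (sterm_sum_bound alpha r Ha Hr) as (K1 & S0 & HK1 & HS0).
  destruct (inv_weight_sum kp Hkp) as (W & HW & HWb).
  set (D1 := G * Rpower 2 A). set (g := / G * Rpower (1 + r) (- A)).
  assert (HD1 : 0 < D1) by (apply Rmult_lt_0_compat; [auto|apply Rpower_pos]).
  assert (HGi : 0 < / G) by now apply Rinv_0_lt_compat.
  assert (HKi : 0 < / K) by now apply Rinv_0_lt_compat.
  assert (Hg : 0 < g) by (apply Rmult_lt_0_compat; [auto|apply Rpower_pos]).
  set (D2 := g ^ 2 / (K * W)).
  assert (HKW : 0 < K * W) by now apply Rmult_lt_0_compat.
  assert (HD2 : 0 < D2) by (apply Rdiv_lt_0_compat; auto; now apply pow_lt).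
  assert (HD2i : 0 < / D2) by now apply Rinv_0_lt_compat.
  (* [delta0 = 1/(2 + r)] keeps both [2 delta] and [delta + r (1 - z)] in [(0, 1]], the range of the
     bounds at the pole. *)
  exists (D1 + / D2), (/ (2 + r)), S0.
  split; [lra|]. split.
  { split; [apply Rinv_0_lt_compat; lra|]. rewrite <- Rinv_1. apply Rinv_le_contravar; lra. }
  intros delta Hd a.
  assert (Hd1 : delta * (2 + r) <= 1).
  { apply Rmult_le_reg_r with (/ (2 + r)); [apply Rinv_0_lt_compat; lra|].
    rewrite Rmult_assoc, Rinv_r by lra. lra. }
  assert (Hdr : 0 < delta * r) by nra.
  assert (HP : 0 < Rpower delta (- A)) by apply Rpower_pos.
  destruct (HGb (2 * delta)) as (N & HN & HN1 & HN2); [lra|].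
  rewrite <- Rpower_mult_distr in HN1, HN2 by lra.
  assert (H2A : 0 < Rpower 2 A) by apply Rpower_pos.
  assert (H2A1 : 1 <= Rpower 2 A).
  { rewrite <- (Rpower_O 2) by lra. apply Rle_Rpower; lra. }
  exists N. split; [|split; [|split]].
  - apply has_sum_ext with (2 := HN). intros n. symmetry. now apply test_seq_norm.
  - rewrite (Rpower_Ropp 2 A) in *. split.
    + apply Rle_trans with (2 := HN1). rewrite <- Rmult_assoc.
      apply Rmult_le_compat_r; [lra|]. rewrite <- Rinv_mult. fold D1.
      apply Rinv_le_contravar; lra.
    + apply Rle_trans with (1 := HN2). rewrite <- Rmult_assoc.
      apply Rmult_le_compat_r; [lra|].
      assert (/ Rpower 2 A <= Rpower 2 A).
      { apply Rle_trans with 1; auto. rewrite <- Rinv_1. apply Rinv_le_contravar; lra. }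
      apply Rle_trans with D1; [|lra]. apply Rmult_le_compat_l; lra.
  (* The terms decrease in [delta], so the value at [delta = 0] dominates. A bound independent of
     [delta] makes each functional of the normalized test functions tend to [0]. *)
  - intros w. destruct (HS0 w) as [HSw _].
    destruct (has_sum_dom (fun n => gterm alpha (1 + delta) n * pois w (r * ln (INR n)))
       (sterm alpha r w) (S0 w)) as (t & Ht & Htle); auto.
    { intros n. assert (0 <= pois w (r * ln (INR n))).
      { apply pois_nonneg, Rmult_le_pos; [lra|apply ln_INR_nonneg]. }
      split; [apply Rmult_le_pos; auto; apply gterm_nonneg|].
      apply Rmult_le_compat_r; auto. destruct n; [simpl; lra|]. rewrite !gterm_pos_eq by lia.
      apply Rmult_le_compat_l; [left; apply Rpower_pos|].
      apply Rle_Rpower; [apply (le_INR 1); lia|lra]. }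
    rewrite (lval_eq c1 r a w (RtoC t)).
    + rewrite Cmod_R, Rabs_pos_eq; auto. apply (has_sum_ge0 _ _ Ht).
    + apply has_csum_ext with (2 := has_csum_RtoC _ _ Ht). intros n.
      symmetry. apply test_seq_lterm.
  - intros V HV. set (z := exp (- delta)).
    assert (Hz : 0 < z < 1).
    { split; [apply exp_pos|]. unfold z. rewrite <- exp_0. apply exp_increasing. lra. }
    assert (Hz1 : 1 - z <= delta) by (unfold z; generalize (exp_ineq (- delta)); lra).
    assert (Hx : 0 < delta + r * (1 - z) <= 1) by nra.
    destruct (HGb (delta + r * (1 - z)) Hx) as (v & Hv & Hv1 & _).
    replace (1 + (delta + r * (1 - z))) with (1 + delta + r * (1 - z)) in Hv by ring.
    destruct (pois_generating alpha (1 + delta) r z v Hr Hz Hv) as (T & HT & HTv).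
    assert (HTl : forall m, Cmod (lval c1 r a m) = T m).
    { intros m. rewrite (lval_eq c1 r a m (RtoC (T m))).
      - rewrite Cmod_R. apply Rabs_pos_eq, (has_sum_ge0 _ _ (HT m)).
      - apply has_csum_ext with (2 := has_csum_RtoC _ _ (HT m)). intros n.
        symmetry. apply test_seq_lterm. }
    destruct (HWb delta) as (U & HU & HU2); [lra|].
    assert (Hom0 : forall n, 0 < omega n).
    { intros n. apply Rlt_le_trans with (2 := Hom n). apply Rmult_lt_0_compat; auto. apply Rpower_pos. }
    assert (HCS : v ^ 2 <= V * (K * U)).
    { apply (has_sum_cauchy_schwarz (fun m => z ^ m * T m) (fun n => omega n * Cmod (lval c1 r a n) ^ 2)
        (fun n => K * (Rpower (INR (S n)) kp * exp (- (2 * delta * INR n))))); auto.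
      - intros n. apply Rmult_le_pos; [left; apply Hom0|apply pow2_ge_0].
      - intros n. apply Rmult_le_pos; [lra|]. left.
        apply Rmult_lt_0_compat; [apply Rpower_pos|apply exp_pos].
      - intros n. rewrite <- HTl, Rpow_mult_distr.
        assert (E : exp (- (2 * delta * INR n)) = (z ^ n) ^ 2).
        { unfold z. rewrite <- (Rpower_pow n) by apply exp_pos. unfold Rpower. rewrite ln_exp.
          simpl. rewrite Rmult_1_r, <- exp_plus. f_equal. ring. }
        rewrite E.
        assert (H1 : 1 <= omega n * (K * Rpower (INR (S n)) kp)).
        { apply Rle_trans with (/ K * Rpower (INR (S n)) (- kp) * (K * Rpower (INR (S n)) kp)).
          - right. rewrite Rpower_Ropp. pose proof (Rpower_pos (INR (S n)) kp). field. lra.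
          - apply Rmult_le_compat_r; auto. apply Rmult_le_pos; [lra|left; apply Rpower_pos]. }
        set (X := (z ^ n) ^ 2 * Cmod (lval c1 r a n) ^ 2).
        assert (HX : 0 <= X) by (apply Rmult_le_pos; apply pow2_ge_0).
        replace (omega n * Cmod (lval c1 r a n) ^ 2 * (K * (Rpower (INR (S n)) kp * (z ^ n) ^ 2)))
          with (omega n * (K * Rpower (INR (S n)) kp) * X) by (unfold X; ring).
        nra.
      - apply has_sum_scal; auto. lra. }
    assert (Hvlow : g * Rpower delta (- A) <= v).
    { apply Rle_trans with (2 := Hv1). unfold g. rewrite Rmult_assoc.
      apply Rmult_le_compat_l; [lra|]. rewrite Rpower_mult_distr by lra.
      apply Rpower_base_ge; lra || nra. }
    assert (HgP : 0 <= g * Rpower delta (- A)) by (apply Rmult_le_pos; lra).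
    assert (HU0 : 0 <= U) by apply (has_sum_ge0 _ _ HU).
    assert (HV0 : 0 <= V) by apply (has_sum_ge0 _ _ HV).
    assert (Hfin : (g * Rpower delta (- A)) ^ 2 <= V * (K * (W * Rpower delta (- (kp + 1))))).
    { apply Rle_trans with (v ^ 2); [apply pow_incr; lra|].
      apply Rle_trans with (1 := HCS). apply Rmult_le_compat_l; auto.
      apply Rmult_le_compat_l; lra. }
    assert (HQ : 0 < Rpower delta (kp + 1)) by apply Rpower_pos.
    rewrite (Rpower_Ropp delta (kp + 1)) in Hfin.
    apply Rle_trans with (D2 * Rpower delta (kp + 1 - 2 * A)).
    { apply Rmult_le_compat_r; [left; apply Rpower_pos|].
      apply Rle_trans with (/ / D2); [apply Rinv_le_contravar; lra|rewrite Rinv_inv; lra]. }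
    replace (kp + 1 - 2 * A) with (kp + 1 + (- A + - A)) by ring.
    rewrite (Rpower_plus (kp + 1)), (Rpower_plus (- A)).
    apply Rmult_le_reg_r with (K * (W * / Rpower delta (kp + 1))).
    { apply Rmult_lt_0_compat; [auto|]. apply Rmult_lt_0_compat; [auto|now apply Rinv_0_lt_compat]. }
    apply Rle_trans with (2 := Hfin). right. unfold D2. field. repeat split; lra.
Qed.

(** * The criterion for operators described by the model *)

Lemma Dnorm_term_ext beta b b' : (forall n, (1 <= n)%nat -> b n = b' n) ->
  Dnorm_term beta b = Dnorm_term beta b'.
Proof.
  intros H. apply functional_extensionality. intros [|n]; [reflexivity|].
  rewrite !Dnorm_term_pos, H by lia. reflexivity.
Qed.

Lemma Dnorm_term_scal alpha (z : C) a n :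
  Dnorm_term alpha (fun n => z * a n)%C n = Cmod z ^ 2 * Dnorm_term alpha a n.
Proof.
  destruct n; [simpl; ring|]. rewrite !Dnorm_term_pos, Cmod_mult by lia. ring.
Qed.

Lemma lval_scal alpha c1 r (z : C) a w : 0 <= alpha -> 0 < r -> Re c1 = 1/2 + r -> inD alpha a ->
  lval c1 r (fun n => z * a n)%C w = (z * lval c1 r a w)%C.
Proof.
  intros Ha Hr Hc Hin. apply lval_eq.
  apply has_csum_ext with (fun n => z * lterm c1 r a w n)%C.
  - intros [|n]; simpl; ring.
  - now apply has_csum_scal, (lval_spec alpha).
Qed.

Lemma Cmod_sub_sq (x y : C) : Cmod (x - y) ^ 2 <= 2 * Cmod x ^ 2 + 2 * Cmod y ^ 2.
Proof.
  assert (H : Cmod (x - y) <= Cmod x + Cmod y).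
  { eapply Rle_trans; [apply Cmod_triangle|]. rewrite Cmod_opp. lra. }
  apply Rle_trans with ((Cmod x + Cmod y) ^ 2).
  - apply pow_incr. split; [apply Cmod_ge_0|auto].
  - generalize (pow2_ge_0 (Cmod x - Cmod y)). lra.
Qed.

Lemma inD_sub beta b b' : inD beta b -> inD beta b' -> inD beta (fun n => b n - b' n)%C.
Proof.
  intros H H'. apply inD_has_sum in H. apply inD_has_sum in H'.
  destruct H as (v & Hv), H' as (v' & Hv'). apply inD_has_sum.
  destruct (has_sum_dom (Dnorm_term beta (fun n => b n - b' n)%C)
    (fun n => 2 * Dnorm_term beta b n + 2 * Dnorm_term beta b' n) (2 * v + 2 * v')) as (u & Hu & _).
  - intros n. split; [apply Dnorm_term_nonneg|]. destruct n; [simpl; lra|].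
    rewrite !Dnorm_term_pos by lia. pose proof (Cmod_sub_sq (b (S n)) (b' (S n))).
    pose proof (Rpower_pos (INR (ndivisors (S n))) (- beta)). nra.
  - apply has_sum_plus; apply has_sum_scal; auto; lra.
  - now exists u.
Qed.

Lemma model_omega_pos {alpha beta phi c1 r K kp omega bs} n :
  comp_model alpha beta phi c1 r K kp omega bs -> 0 < omega n.
Proof.
  intros M. destruct (cm_omega M n) as [H _].
  apply Rlt_le_trans with (2 := H). apply Rmult_lt_0_compat; [|apply Rpower_pos].
  apply Rinv_0_lt_compat, (cm_K M).
Qed.

Lemma model_norm {alpha beta phi c1 r K kp omega bs a b} :
  comp_model alpha beta phi c1 r K kp omega bs ->
  inD alpha a -> inD beta b -> represents phi a b ->
  exists V, has_sum (fun n => omega n * Cmod (lval c1 r a n) ^ 2) V /\ Dnorm beta b = sqrt V.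
Proof.
  intros M Ha Hb Hab. pose proof Hb as Hb'. apply inD_has_sum in Hb'. destruct Hb' as (V & HV).
  exists V. split; [|now apply Dnorm_eq].
  apply (cm_norm M).
  rewrite <- (Dnorm_term_ext beta b); auto. now apply (cm_unique M).
Qed.

Lemma model_energy {alpha beta phi c1 r K kp omega bs} : 0 <= alpha ->
  comp_model alpha beta phi c1 r K kp omega bs ->
  exists D, 0 < D /\ forall a N, has_sum (Dnorm_term alpha a) N ->
    exists X, has_sum X N /\ forall n, omega n * Cmod (lval c1 r a n) ^ 2 <=
      D * Rpower (INR (S n)) (- (kp + 1 - Rpower 2 alpha)) * X n.
Proof.
  intros Ha M. destruct (lval_energy alpha c1 r omega K kp Ha) as (D & HD & H);
    try apply (cm_r M); try apply (cm_c1 M);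
    try apply (cm_K M).
  - intros n. split; [left; now apply (model_omega_pos n M)|].
    apply (cm_omega M).
  - exists D. split; auto. intros a N HN. destruct (H a N HN) as (X & HX & HX2).
    exists X. split; auto. intros n.
    replace (- (kp + 1 - Rpower 2 alpha)) with (Rpower 2 alpha - 1 - kp) by ring. apply HX2.
Qed.

Lemma Rpower_neg_le_1 n t : 0 <= t -> Rpower (INR (S n)) (- t) <= 1.
Proof.
  intros Ht. rewrite <- (Rpower_O (INR (S n))) by (apply lt_0_INR; lia).
  apply Rle_Rpower; [apply (le_INR 1); lia|lra].
Qed.

Lemma model_bounded {alpha beta phi c1 r K kp omega bs} : 0 <= alpha ->
  comp_model alpha beta phi c1 r K kp omega bs -> Rpower 2 alpha <= kp + 1 ->
  comp_bounded alpha beta phi.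
Proof.
  intros Ha M HA. destruct (model_energy Ha M) as (D & HD & HE).
  exists (sqrt D). intros a Hin. pose proof Hin as HN. apply inD_has_sum in HN.
  destruct HN as (N & HN). destruct (HE a N HN) as (X & HX & HXn).
  destruct (has_sum_dom (fun n => omega n * Cmod (lval c1 r a n) ^ 2) (fun n => D * X n) (D * N))
    as (V & HV & HVle).
  - intros n. pose proof (model_omega_pos n M).
    split; [apply Rmult_le_pos; [lra|apply pow2_ge_0]|].
    apply Rle_trans with (1 := HXn n). apply Rmult_le_compat_r; [apply HX|].
    rewrite <- (Rmult_1_r D) at 2. apply Rmult_le_compat_l; [lra|].
    apply Rpower_neg_le_1. lra.
  - apply has_sum_scal; auto; lra.
  - apply (cm_norm M) in HV.
    exists (bs (lval c1 r a)). split; [|split].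
    + apply inD_has_sum. eauto.
    + now apply (cm_rep M).
    + rewrite (Dnorm_eq _ _ _ HV), (Dnorm_eq _ _ _ HN).
      rewrite <- sqrt_mult by (try lra; apply (has_sum_ge0 _ _ HN)).
      now apply sqrt_le_1_alt.
Qed.

Lemma small_tail (D t eta : R) : 0 < D -> 0 < t -> 0 < eta ->
  exists n, D * Rpower (INR (S n)) (- t) < eta.
Proof.
  intros HD Ht He. set (T := D / eta / t).
  assert (HT : 0 < T) by (unfold T; repeat apply Rdiv_lt_0_compat; auto).
  destruct (nfloor_ex (exp T)) as (n & Hn); [left; apply exp_pos|].
  exists n. set (u := INR (S n)).
  assert (Hu : exp T < u) by (unfold u; rewrite S_INR; lra).
  assert (Hl : T < ln u).
  { rewrite <- (ln_exp T). apply ln_increasing; auto. apply exp_pos. }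
  assert (Hb : D / eta < t * ln u).
  { replace (D / eta) with (t * T) by (unfold T; field; lra). now apply Rmult_lt_compat_l. }
  rewrite Rpower_Ropp. unfold Rpower.
  assert (He2 : D / eta < exp (t * ln u)) by (generalize (exp_ineq (t * ln u)); lra).
  apply Rmult_lt_reg_r with (exp (t * ln u)); [apply exp_pos|].
  rewrite Rmult_assoc, Rinv_l by (generalize (exp_pos (t * ln u)); lra).
  apply Rmult_lt_compat_l with (r := eta) in He2; auto.
  replace (eta * (D / eta)) with D in He2 by (field; lra). lra.
Qed.

(** The exponent [t > 0] makes the tails in [n] uniformly small over the unit ball. Along a
    subsequence every single functional converges, so finitely many coordinates together with the
    small tails give convergence in norm to the series with the limit functionals. *)
Lemma model_compact {alpha beta phi c1 r K kp omega bs} : 0 <= alpha ->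
  comp_model alpha beta phi c1 r K kp omega bs -> Rpower 2 alpha < kp + 1 ->
  comp_compact alpha beta phi.
Proof.
  intros Ha M HA. split.
  { destruct (model_bounded Ha M (Rlt_le _ _ HA)) as (B & HB).
    intros a Hin. destruct (HB a Hin) as (b & H1 & H2 & _). now exists b. }
  intros a b Hab. destruct (model_energy Ha M) as (D & HD & HE).
  set (t := kp + 1 - Rpower 2 alpha) in *. assert (Ht : 0 < t) by (unfold t; lra).
  assert (Hom : forall n, 0 < omega n) by (intros n; now apply (model_omega_pos n M)).
  pose (ell := fun k => lval c1 r (a k)).
  pose (tau := fun m => D * Rpower (INR (S m)) (- t)).
  assert (Htau0 : forall m, 0 < tau m).
  { intros m. apply Rmult_lt_0_compat; auto. apply Rpower_pos. }
  assert (Htail : forall k m l, NoDup l -> (forall n, In n l -> (m <= n)%nat) ->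
    lsum (fun n => omega n * Cmod (ell k n) ^ 2) l <= tau m).
  { intros k m l Hl Hm. destruct (Hab k) as (Hin & Hn1 & _).
    apply inD_has_sum in Hin. destruct Hin as (N & HN).
    rewrite (Dnorm_eq _ _ _ HN) in Hn1.
    assert (HN1 : N <= 1).
    { rewrite <- sqrt_1 in Hn1. apply sqrt_le_0 in Hn1; auto; [apply (has_sum_ge0 _ _ HN)|lra]. }
    destruct (HE _ _ HN) as (X & HX & HXn).
    apply Rle_trans with (lsum (fun n => tau m * X n) l).
    - apply lsum_le. intros n Hnl. apply Rle_trans with (1 := HXn n).
      apply Rmult_le_compat_r; [apply HX|]. apply Rmult_le_compat_l; [lra|].
      apply Rpower_base_ge; try lra; [apply lt_0_INR; lia|]. apply le_INR.
      specialize (Hm n Hnl). lia.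
    - rewrite lsum_scal. rewrite <- (Rmult_1_r (tau m)) at 2.
      apply Rmult_le_compat_l; [left; apply Htau0|].
      apply Rle_trans with (2 := HN1). now apply HX. }
  destruct (bounded_subsequence ell) as (sigma & L & Hsig & HL).
  { intros n. exists (1 + tau 0%nat / omega n). intros k.
    assert (H : lsum (fun n => omega n * Cmod (ell k n) ^ 2) (n :: nil) <= tau 0%nat).
    { apply Htail; [repeat constructor; simpl; tauto|intros; lia]. }
    simpl in H. rewrite Rplus_0_r, Rmult_1_r in H. specialize (Hom n).
    assert (H2 : Cmod (ell k n) * Cmod (ell k n) <= tau 0%nat / omega n).
    { apply Rmult_le_reg_l with (omega n); auto.
      replace (omega n * (tau 0%nat / omega n)) with (tau 0%nat) by (field; lra). auto. }
    nra. }
  pose (dif := fun k n => omega n * Cmod (ell (sigma k) n - L n)%C ^ 2).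
  assert (Hdif0 : forall k n, 0 <= dif k n).
  { intros k n. apply Rmult_le_pos; [left; apply Hom|apply pow2_ge_0]. }
  assert (Hfin : forall l eps, 0 < eps -> exists k0, forall k, (k0 <= k)%nat ->
            lsum (dif k) l < eps).
  { induction l as [|n l IH]; intros eps He.
    - exists 0%nat. intros k _. simpl. auto.
    - destruct (IH (eps / 2)) as (k1 & Hk1); [lra|].
      destruct (HL n (Rmin 1 (eps / 2 / omega n))) as (k2 & Hk2).
      { apply Rmin_glb_lt; [lra|]. apply Rdiv_lt_0_compat; [lra|auto]. }
      exists (max k1 k2). intros k Hk. simpl.
      specialize (Hk1 k ltac:(lia)). specialize (Hk2 k ltac:(lia)).
      assert (H1 := Rmin_l 1 (eps / 2 / omega n)). assert (H2 := Rmin_r 1 (eps / 2 / omega n)).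
      pose proof (Cmod_ge_0 (ell (sigma k) n - L n)%C) as H0. specialize (Hom n).
      assert (H3 : Cmod (ell (sigma k) n - L n)%C ^ 2 < eps / 2 / omega n).
      { simpl. rewrite Rmult_1_r. nra. }
      assert (H4 : dif k n < eps / 2).
      { unfold dif. replace (eps / 2) with (omega n * (eps / 2 / omega n)) by (field; lra).
        now apply Rmult_lt_compat_l. }
      lra. }
  (* The limit inherits the tail bound through finite sums; the factor [2] comes from
     [|x|^2 <= 2 |y|^2 + 2 |y - x|^2]. *)
  assert (HLtail : forall m l, NoDup l -> (forall n, In n l -> (m <= n)%nat) ->
    lsum (fun n => omega n * Cmod (L n) ^ 2) l <= 2 * tau m).
  { intros m l Hl Hm. apply le_epsilon. intros eps He.
    destruct (Hfin l (eps / 2)) as (k & Hk); [lra|]. specialize (Hk k (le_n k)).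
    specialize (Htail (sigma k) m l Hl Hm).
    apply Rle_trans with (lsum (fun n => 2 * (omega n * Cmod (ell (sigma k) n) ^ 2) + 2 * dif k n) l).
    - apply lsum_le. intros n _. unfold dif.
      pose proof (Cmod_sub_sq (ell (sigma k) n) (ell (sigma k) n - L n)%C) as H.
      replace (ell (sigma k) n - (ell (sigma k) n - L n))%C with (L n) in H by ring.
      specialize (Hom n). nra.
    - rewrite lsum_plus, !lsum_scal. lra. }
  destruct (has_sum_bounded (fun n => omega n * Cmod (L n) ^ 2) (2 * tau 0%nat)) as (VL & HVL & _).
  { intros n. apply Rmult_le_pos; [left; apply Hom|apply pow2_ge_0]. }
  { intros l Hl. apply HLtail; auto. intros; lia. }
  exists sigma, (bs L). split; [auto|]. split.
  { apply inD_has_sum. exists VL. now apply (cm_norm M). }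
  (* The tail of the difference is at most [2 tau m] from the sequence plus [2 (2 tau m)] from the
     limit. *)
  assert (Hdn : forall k m, exists V, Dnorm beta (fun n => b (sigma k) n - bs L n)%C = sqrt V /\
     0 <= V <= lsum (dif k) (seq 0 m) + 6 * tau m).
  { intros k m. destruct (has_sum_bounded (dif k) (lsum (dif k) (seq 0 m) + 6 * tau m)) as (V & HV & HVle).
    - auto.
    - intros l Hl. rewrite (lsum_filter (fun n => Nat.ltb n m)). apply Rplus_le_compat.
      + apply lsum_incl; [auto|now apply NoDup_filter|]. intros n Hn. apply filter_In in Hn.
        destruct Hn as [_ Hn]. apply Nat.ltb_lt in Hn. apply in_seq. lia.
      + set (l' := filter _ l). assert (Hl' : NoDup l') by now apply NoDup_filter.
        assert (Hm : forall n, In n l' -> (m <= n)%nat).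
        { intros n Hn. apply filter_In in Hn. destruct Hn as [_ Hn].
          apply Bool.negb_true_iff, Nat.ltb_ge in Hn. auto. }
        apply Rle_trans with (lsum (fun n => 2 * (omega n * Cmod (ell (sigma k) n) ^ 2) +
          2 * (omega n * Cmod (L n) ^ 2)) l').
        * apply lsum_le. intros n _. unfold dif.
          pose proof (Cmod_sub_sq (ell (sigma k) n) (L n)). specialize (Hom n). nra.
        * rewrite lsum_plus, !lsum_scal. specialize (Htail (sigma k) m l' Hl' Hm).
          specialize (HLtail m l' Hl' Hm). lra.
    - exists V. split; [|split; [apply (has_sum_ge0 _ _ HV)|auto]]. apply Dnorm_eq.
      destruct (Hab (sigma k)) as (Hin & _ & Hinb & Hrep).
      rewrite (Dnorm_term_ext _ _ (bs (fun n => ell (sigma k) n - L n)%C)).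
      + now apply (cm_norm M).
      + intros n Hn. rewrite (cm_sub M). f_equal.
        now apply (cm_unique M). }
  apply is_lim_seq_spec. intros eps. pose proof (cond_pos eps) as He.
  (* [6 tau m < eps^2 / 2]; the other half of [eps^2] is left to the first [m] coordinates. *)
  destruct (small_tail D t (eps ^ 2 / 12) HD Ht) as (m & Hm).
  { apply Rdiv_lt_0_compat; [now apply pow_lt|lra]. }
  destruct (Hfin (seq 0 m) (eps ^ 2 / 2)) as (k0 & Hk0).
  { apply Rdiv_lt_0_compat; [now apply pow_lt|lra]. }
  exists k0. intros k Hk. specialize (Hk0 k Hk). destruct (Hdn k m) as (V & -> & HV).
  rewrite Rminus_0_r, Rabs_pos_eq by apply sqrt_pos.
  fold (tau m) in Hm. rewrite <- (sqrt_pow2 eps) by lra.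
  apply sqrt_lt_1_alt. lra.
Qed.

Lemma model_test_seq {alpha beta phi c1 r K kp omega bs} : 0 <= alpha -> 0 <= kp ->
  comp_model alpha beta phi c1 r K kp omega bs ->
  exists D delta0 S0, 0 < D /\ 0 < delta0 <= 1 /\ forall delta, 0 < delta <= delta0 ->
    exists a N, inD alpha a /\ has_sum (Dnorm_term alpha a) N /\
      / D * Rpower delta (- Rpower 2 alpha) <= N <= D * Rpower delta (- Rpower 2 alpha) /\
      (forall w, Cmod (lval c1 r a w) <= S0 w) /\
      (forall V, has_sum (fun n => omega n * Cmod (lval c1 r a n) ^ 2) V ->
         / D * Rpower delta (kp + 1 - 2 * Rpower 2 alpha) <= V).
Proof.
  intros Ha Hkp M.
  destruct (test_seq_bounds alpha c1 r omega K kp Ha) as (D & delta0 & S0 & HD & Hd0 & H);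
    try apply (cm_r M); try apply (cm_c1 M);
    try apply (cm_K M); auto.
  - intros n. apply (cm_omega M).
  - exists D, delta0, S0. split; [auto|split; [auto|]]. intros delta Hd.
    destruct (H delta Hd) as (N & H1 & H2 & H3 & H4).
    exists (test_seq alpha c1 r delta), N. split; [apply inD_has_sum; eauto|auto].
Qed.

(** On the test functions the quotient of the squared norms is at least a constant times
    [delta^(- eta)] with [eta = 2^alpha - kp - 1], which is unbounded as soon as [eta > 0]. *)
Lemma model_bounded_inv {alpha beta phi c1 r K kp omega bs} : 0 <= alpha -> 0 <= kp ->
  comp_model alpha beta phi c1 r K kp omega bs -> comp_bounded alpha beta phi ->
  Rpower 2 alpha <= kp + 1.
Proof.
  intros Ha Hkp M (B & HB).
  destruct (model_test_seq Ha Hkp M) as (D & delta0 & S0 & HD & Hd0 & HT).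
  apply Rnot_lt_le. intros Hlt. set (A := Rpower 2 alpha) in *.
  set (eta := A - kp - 1). assert (Heta : 0 < eta) by (unfold eta; lra).
  (* The factor [exp (- T)] in [delta] forces [delta^(- eta) >= 1 + eta T = 1 + B^2 D^2], more than
     boundedness allows. *)
  set (T := B ^ 2 * D * D / eta).
  assert (HT0 : 0 <= T).
  { unfold T, Rdiv. pose proof (pow2_ge_0 B).
    assert (0 < / eta) by now apply Rinv_0_lt_compat.
    apply Rmult_le_pos; [apply Rmult_le_pos; [apply Rmult_le_pos|]|]; lra. }
  set (delta := delta0 * exp (- T)).
  assert (Hexp : 0 < exp (- T) <= 1).
  { split; [apply exp_pos|]. rewrite <- exp_0. apply exp_le_compat. lra. }
  assert (Hd : 0 < delta <= delta0) by (unfold delta; nra).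
  destruct (HT delta Hd) as (a & N & Hin & HN & [HN1 HN2] & _ & HV).
  destruct (HB a Hin) as (b & Hb & Hrep & Hle).
  destruct (model_norm M Hin Hb Hrep) as (V & HV1 & HV2).
  specialize (HV V HV1). rewrite HV2, (Dnorm_eq _ _ _ HN) in Hle.
  assert (HN0 : 0 <= N) by apply (has_sum_ge0 _ _ HN).
  assert (HV0 : 0 <= V) by apply (has_sum_ge0 _ _ HV1).
  assert (HVN : V <= B ^ 2 * N).
  { rewrite <- (sqrt_sqrt V), <- (sqrt_sqrt N) by auto.
    replace (B ^ 2 * (sqrt N * sqrt N)) with ((B * sqrt N) * (B * sqrt N)) by ring.
    pose proof (sqrt_pos V). apply Rmult_le_compat; auto. }
  set (Y := Rpower delta (- A)) in *. assert (HY : 0 < Y) by apply Rpower_pos.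
  assert (E : Rpower delta (kp + 1 - 2 * A) = Rpower delta (- eta) * Y).
  { unfold Y. rewrite <- Rpower_plus. f_equal. unfold eta. ring. }
  rewrite E in HV.
  assert (H1 : / D * (Rpower delta (- eta) * Y) <= B ^ 2 * (D * Y)).
  { apply Rle_trans with (1 := HV). apply Rle_trans with (1 := HVN).
    apply Rmult_le_compat_l; [apply pow2_ge_0|auto]. }
  assert (H2 : Rpower delta (- eta) <= B ^ 2 * D * D).
  { apply Rmult_le_reg_r with (/ D * Y).
    - apply Rmult_lt_0_compat; auto. now apply Rinv_0_lt_compat.
    - replace (B ^ 2 * D * D * (/ D * Y)) with (B ^ 2 * (D * Y)) by (field; lra). lra. }
  assert (H3 : 1 + eta * T <= Rpower delta (- eta)).
  { unfold Rpower. eapply Rle_trans; [apply exp_ineq|]. apply exp_le_compat.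
    assert (Hln : ln delta <= - T).
    { unfold delta. rewrite ln_mult, ln_exp by (try apply exp_pos; lra).
      assert (ln delta0 <= ln 1) by (apply ln_le; lra). rewrite ln_1 in H. lra. }
    nra. }
  replace (eta * T) with (B ^ 2 * D * D) in H3 by (unfold T; field; lra). lra.
Qed.

(** At or above the threshold the images of the normalized test functions keep norm at least [1/D],
    while each of their functionals tends to [0]. A limit of the images would have all coefficients
    [0], against the lower bound of the norms. *)
Lemma model_compact_inv {alpha beta phi c1 r K kp omega bs} : 0 <= alpha -> 0 <= kp ->
  comp_model alpha beta phi c1 r K kp omega bs -> comp_compact alpha beta phi ->
  Rpower 2 alpha < kp + 1.
Proof.
  intros Ha Hkp M (Hdef & Hcomp).
  destruct (model_test_seq Ha Hkp M) as (D & delta0 & S0 & HD & Hd0 & HT).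
  apply Rnot_le_lt. intros Hge. set (A := Rpower 2 alpha) in *.
  assert (HA1 : 1 <= A).
  { unfold A. rewrite <- (Rpower_O 2) by lra. apply Rle_Rpower; lra. }
  assert (HDi : 0 < / D) by now apply Rinv_0_lt_compat.
  assert (Hk : forall k : nat, exists a b, inD alpha a /\ Dnorm alpha a <= 1 /\
    inD beta b /\ represents phi a b /\ / D <= Dnorm beta b /\
    forall w, Cmod (lval c1 r a w) ^ 2 <= D * S0 w ^ 2 / INR (S k)).
  { intros k. set (u := INR (S k)).
    assert (Hu : 1 <= u) by (unfold u; rewrite S_INR; generalize (pos_INR k); lra).
    set (delta := delta0 / u).
    assert (Hd : 0 < delta <= delta0).
    { unfold delta. split; [apply Rdiv_lt_0_compat; lra|].
      apply Rmult_le_reg_r with u; [lra|]. unfold Rdiv. rewrite Rmult_assoc, Rinv_l by lra. nra. }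
    destruct (HT delta Hd) as (a & N & Hin & HN & [HN1 HN2] & HS & HV).
    set (Y := Rpower delta (- A)) in *.
    assert (HYu : u <= Y).
    { unfold Y. rewrite Rpower_Ropp. apply Rle_trans with (/ delta).
      - rewrite <- (Rinv_inv u) at 1. apply Rinv_le_contravar; [lra|].
        unfold delta. unfold Rdiv. assert (0 < / u) by (apply Rinv_0_lt_compat; lra). nra.
      - apply Rinv_le_contravar; [apply Rpower_pos|].
        unfold Rpower. rewrite <- (exp_ln delta) at 2 by lra. apply exp_le_compat.
        assert (ln delta <= ln 1) by (apply ln_le; lra). rewrite ln_1 in H. nra. }
    assert (HNu : / D * u <= N).
    { apply Rle_trans with (2 := HN1). apply Rmult_le_compat_l; lra. }
    assert (HN0 : 0 < N) by nra.
    set (s := / sqrt N).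
    assert (HsN : 0 < sqrt N) by now apply sqrt_lt_R0.
    assert (Hs2 : s ^ 2 = / N).
    { unfold s. simpl. rewrite Rmult_1_r, <- Rinv_mult, sqrt_sqrt; lra. }
    pose (a' := fun n => (RtoC s * a n)%C).
    assert (Hcs : Cmod (RtoC s) ^ 2 = / N) by (rewrite Cmod_R, pow2_abs; auto).
    assert (HN' : has_sum (Dnorm_term alpha a') 1).
    { apply has_sum_ext with (fun n => / N * Dnorm_term alpha a n).
      - intros n. unfold a'. now rewrite Dnorm_term_scal, Hcs.
      - refine (eq_rect _ (has_sum _) (has_sum_scal (/ N) _ N _ HN) _ _).
        + left. now apply Rinv_0_lt_compat.
        + field. lra. }
    assert (Hin' : inD alpha a') by (apply inD_has_sum; eauto).
    assert (Hlv : forall w, Cmod (lval c1 r a' w) ^ 2 = / N * Cmod (lval c1 r a w) ^ 2).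
    { intros w. unfold a'. rewrite (lval_scal alpha), Cmod_mult, Rpow_mult_distr, Hcs; auto.
      - apply (cm_r M).
      - apply (cm_c1 M). }
    destruct (Hdef a' Hin') as (b & Hb & Hrep).
    exists a', b. split; [auto|]. split.
    { rewrite (Dnorm_eq _ _ _ HN'), sqrt_1. lra. }
    split; [auto|]. split; [auto|]. split.
    - destruct (model_norm M Hin' Hb Hrep) as (V & HV1 & ->).
      assert (HV2 : has_sum (fun n => omega n * Cmod (lval c1 r a n) ^ 2) (N * V)).
      { apply has_sum_ext with (fun n => N * (omega n * Cmod (lval c1 r a' n) ^ 2)).
        - intros n. rewrite Hlv. field. lra.
        - apply has_sum_scal; [lra|auto]. }
      specialize (HV _ HV2).
      assert (HV0 : 0 <= V) by apply (has_sum_ge0 _ _ HV1).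
      assert (HY : 0 < Y) by apply Rpower_pos.
      (* Here [delta <= 1] and [kp + 1 <= A] give [delta^(kp + 1 - 2A) >= delta^(- A)], so the image
         is at least comparable to the test function in norm. *)
      assert (HYV : / D * Y <= D * Y * V).
      { apply Rle_trans with (N * V); [|apply Rmult_le_compat_r; lra].
        apply Rle_trans with (2 := HV). apply Rmult_le_compat_l; [lra|].
        unfold Y, Rpower. apply exp_le_compat.
        assert (ln delta <= ln 1) by (apply ln_le; lra). rewrite ln_1 in H. nra. }
      assert (HVlow : (/ D) ^ 2 <= V).
      { apply Rmult_le_reg_l with (D * Y); [now apply Rmult_lt_0_compat|].
        replace (D * Y * (/ D) ^ 2) with (/ D * Y) by (field; lra). auto. }
      rewrite <- (sqrt_pow2 (/ D)) by lra. now apply sqrt_le_1_alt.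
    - intros w. rewrite Hlv. pose proof (HS w) as Hw. pose proof (Cmod_ge_0 (lval c1 r a w)).
      assert (Cmod (lval c1 r a w) ^ 2 <= S0 w ^ 2) by (apply pow_incr; lra).
      assert (/ N <= D / u).
      { replace (D / u) with (/ (/ D * u)) by (field; split; lra).
        apply Rinv_le_contravar; auto. apply Rmult_lt_0_compat; lra. }
      replace (D * S0 w ^ 2 / u) with (D / u * S0 w ^ 2) by (field; lra).
      apply Rmult_le_compat; auto; [left; now apply Rinv_0_lt_compat|apply pow2_ge_0]. }
  pose (a := fun k => proj1_sig (constructive_indefinite_description _ (Hk k))).
  assert (Hk2 : forall k, exists b, inD alpha (a k) /\ Dnorm alpha (a k) <= 1 /\
    inD beta b /\ represents phi (a k) b /\ / D <= Dnorm beta b /\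
    forall w, Cmod (lval c1 r (a k) w) ^ 2 <= D * S0 w ^ 2 / INR (S k)).
  { intros k. unfold a. now destruct constructive_indefinite_description. }
  pose (b := fun k => proj1_sig (constructive_indefinite_description _ (Hk2 k))).
  assert (Hk3 : forall k, inD alpha (a k) /\ Dnorm alpha (a k) <= 1 /\
    inD beta (b k) /\ represents phi (a k) (b k) /\ / D <= Dnorm beta (b k) /\
    forall w, Cmod (lval c1 r (a k) w) ^ 2 <= D * S0 w ^ 2 / INR (S k)).
  { intros k. unfold b. now destruct constructive_indefinite_description. }
  clearbody a b. clear Hk Hk2.
  destruct (Hcomp a b) as (sigma & g & Hsig & Hg & Hlim).
  { intros k. destruct (Hk3 k) as (H1 & H2 & H3 & H4 & _). auto. }
  assert (Hsk : forall k, (k <= sigma k)%nat).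
  { induction k as [|k IH]; [lia|]. specialize (Hsig k). lia. }
  apply is_lim_seq_spec in Hlim.
  assert (Hterm : forall n k, (1 <= n)%nat ->
    Cmod (b (sigma k) n - g n)%C * sqrt (Rpower (INR (ndivisors n)) (- beta))
      <= Dnorm beta (fun n => b (sigma k) n - g n)%C).
  { intros n k Hn. destruct (Hk3 (sigma k)) as (_ & _ & H3 & _).
    pose proof (inD_sub _ _ _ H3 Hg) as Hd. apply inD_has_sum in Hd. destruct Hd as (v & Hv).
    rewrite (Dnorm_eq _ _ _ Hv).
    rewrite <- (sqrt_pow2 (Cmod (b (sigma k) n - g n)%C)) by apply Cmod_ge_0.
    rewrite <- sqrt_mult by (try apply pow2_ge_0; left; apply Rpower_pos).
    apply sqrt_le_1_alt.
    pose proof (has_sum_term _ _ n Hv) as H. now rewrite Dnorm_term_pos in H. }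
  (* Norm convergence implies convergence of each coefficient, and a coefficient of an image is
     controlled by a single functional. Index [0] is invisible to the norm, whence [1 <= n]. *)
  assert (Hg0 : forall n, (1 <= n)%nat -> g n = 0%C).
  { intros n Hn. apply Cmod_eq_0. apply Rle_antisym; [|apply Cmod_ge_0].
    apply le_epsilon. intros eps He. rewrite Rplus_0_l.
    set (q := sqrt (Rpower (INR (ndivisors n)) (- beta))).
    assert (Hq : 0 < q) by apply sqrt_lt_R0, Rpower_pos.
    destruct (cm_coef M n) as (w & E & HE & HEL).
    destruct (Hlim (mkposreal (eps / 2 * q) ltac:(nra))) as (k1 & Hk1). simpl in Hk1.
    destruct (nfloor_ex (E ^ 2 * (D * S0 w ^ 2) * 4 / eps ^ 2)) as (k2 & Hk2).
    { assert (0 < eps ^ 2) by now apply pow_lt.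
      assert (0 < / eps ^ 2) by now apply Rinv_0_lt_compat.
      assert (0 <= D * S0 w ^ 2) by (apply Rmult_le_pos; [lra|apply pow2_ge_0]).
      apply Rmult_le_pos; [|lra]. apply Rmult_le_pos; [|lra].
      apply Rmult_le_pos; [apply pow2_ge_0|auto]. }
    set (k := max k1 k2). specialize (Hk1 k ltac:(unfold k; lia)).
    destruct (Hk3 (sigma k)) as (H1 & _ & H3 & H4 & _ & H5).
    assert (B1 : Cmod (b (sigma k) n - g n)%C <= eps / 2).
    { apply Rmult_le_reg_r with q; auto. apply Rle_trans with (1 := Hterm n k Hn).
      rewrite Rminus_0_r in Hk1. pose proof (Rle_abs (Dnorm beta (fun n => b (sigma k) n - g n)%C)). lra. }
    assert (B2 : Cmod (b (sigma k) n) <= eps / 2).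
    { rewrite (cm_unique M H1 H3 H4 n Hn).
      apply Rle_trans with (1 := HEL _).
      set (x := Cmod (lval c1 r (a (sigma k)) w)).
      assert (Hx0 : 0 <= x) by apply Cmod_ge_0.
      specialize (H5 w). fold x in H5.
      set (u := INR (S (sigma k))) in *.
      assert (Hu : E ^ 2 * (D * S0 w ^ 2) * 4 / eps ^ 2 < u).
      { apply Rlt_le_trans with (1 := proj2 Hk2). unfold u. rewrite S_INR.
        apply Rplus_le_compat_r. apply le_INR. specialize (Hsk k). unfold k in *. lia. }
      assert (Hu0 : 0 < u) by (apply lt_0_INR; lia).
      apply Rnot_lt_le. intros Hlt.
      assert (He2 : 0 < eps ^ 2) by now apply pow_lt.
      assert (C1 : (eps / 2) ^ 2 <= (E * x) ^ 2) by (apply pow_incr; lra).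
      assert (C2 : (E * x) ^ 2 <= E ^ 2 * (D * S0 w ^ 2 / u)).
      { rewrite Rpow_mult_distr. apply Rmult_le_compat_l; [apply pow2_ge_0|auto]. }
      assert (C3 : E ^ 2 * (D * S0 w ^ 2) * 4 < u * eps ^ 2).
      { apply Rmult_lt_compat_r with (r := eps ^ 2) in Hu; auto.
        unfold Rdiv in Hu. rewrite Rmult_assoc, Rinv_l, Rmult_1_r in Hu by lra. auto. }
      assert (C4 : (eps / 2) ^ 2 * u <= E ^ 2 * (D * S0 w ^ 2)).
      { apply Rmult_le_reg_r with (/ u); [now apply Rinv_0_lt_compat|].
        rewrite Rmult_assoc, Rinv_r by lra. unfold Rdiv in C2. lra. }
      nra. }
    replace (g n) with (b (sigma k) n - (b (sigma k) n - g n))%C by ring.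
    eapply Rle_trans; [apply Cmod_triangle|]. rewrite Cmod_opp. lra. }
  destruct (Hlim (mkposreal (/ D) HDi)) as (k & Hk). simpl in Hk.
  specialize (Hk k (le_n k)). destruct (Hk3 (sigma k)) as (_ & _ & _ & _ & Hlow & _).
  assert (E : Dnorm beta (fun n => b (sigma k) n - g n)%C = Dnorm beta (b (sigma k))).
  { unfold Dnorm. rewrite (Dnorm_term_ext beta _ (b (sigma k))); auto.
    intros n Hn. rewrite Hg0 by auto. ring. }
  rewrite E, Rminus_0_r in Hk. pose proof (Rle_abs (Dnorm beta (b (sigma k)))). lra.
Qed.

Theorem theorem4p4 (alpha beta : R) (d : nat) (p : nat -> nat) (c1 : C) (cp : nat -> C) :
  0 <= alpha -> 0 <= beta -> (1 <= d)%nat ->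
  enumerates_primes p ->
  GH_class 0 (phi_coef d p c1 cp) ->
  unrestricted_range (phi_val d p c1 cp) ->
  (forall j, (j < d)%nat -> cp j <> 0%C) ->
  (comp_bounded alpha beta (phi_val d p c1 cp) <->
     Rpower 2 alpha <= 1/2 + INR d * (1/2 + beta)) /\
  (comp_compact alpha beta (phi_val d p c1 cp) <->
     Rpower 2 alpha < 1/2 + INR d * (1/2 + beta)).
Proof.
  intros Ha Hb Hd Hen HG Hu Hc.
  destruct (composition_model alpha beta d p c1 cp Ha Hb Hd Hen HG Hu Hc)
    as (r & K & omega & bs & M).
  set (kp := (INR d - 1) / 2 + beta * INR d) in M.
  assert (Hd1 : 1 <= INR d) by (apply (le_INR 1); lia).
  assert (Hkp : 0 <= kp) by (assert (0 <= beta * INR d) by nra; unfold kp; lra).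
  replace (1/2 + INR d * (1/2 + beta)) with (kp + 1) by (unfold kp; field).
  split; split.
  - now apply (model_bounded_inv Ha Hkp M).
  - now apply (model_bounded Ha M).
  - now apply (model_compact_inv Ha Hkp M).
  - now apply (model_compact Ha M).
Qed.
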